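(* Let $(X_i)_{i\ge 1}$ be a stationary mean-zero Gaussian process with covariances $\rho(k)=\mathbb{E}(X_1X_{k+1})$ satisfying $\rho(0)=1$ and $\rho(k)=k^{-D}L(k)$ for $k\ge1$, where $0<D<1$ and $L$ is slowly varying at infinity and positive for large $k$. Let $T_n$ be the Wilcoxon signed-rank statistic computed from $X_1,\dots,X_n$ (i.e. under the null hypothesis $\theta=0$ in the model $Y_i=\theta+X_i$). Then, as $n\to\infty$, $$n^{D/2}L(n)^{-1/2}\left(\frac{2}{n(n-1)}T_n-\frac{1}{n-1}-\frac12\right)\stackrel{d}{\longrightarrow}\frac{k(D)^{-1/2}}{\sqrt{\pi}}Z_{1,D}(1),$$ and the limit is Gaussian.
   Context: The Wilcoxon signed-rank statistic is $T_n=\sum_{j=1}^nR_j\mathbf{1}_{\{X_j>0\}}$, where $R_j$ is the rank of $|X_j|$ among $|X_1|,\dots,|X_n|$; equivalently (almost surely) $T_n=\sum_{i=1}^n\mathbf{1}_{\{X_i>0\}}+\sum_{1\le i<j\le n}\mathbf{1}_{\{X_i+X_j>0\}}$. With $B$ a standard Brownian motion on $\mathbb{R}$, $Z_{1,D}(t)=\int_{\mathbb{R}}[\int_0^t(u-x)_+^{-(D+1)/2}du]\,dB(x)$, $0<D<1$. The constant is $k(D)=\mathrm{B}((1-D)/2,D)$ where $\mathrm{B}(\alpha,\beta)=\Gamma(\alpha)\Gamma(\beta)/\Gamma(\alpha+\beta)$ is the Beta function. *)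

(* Defs.v *)
From HB Require Import structures.
From mathcomp Require Import all_boot all_order all_algebra.
From mathcomp Require Import all_classical all_reals all_analysis.
From mathcomp Require Import measurable_realfun.

Set Implicit Arguments.
Unset Strict Implicit.
Unset Printing Implicit Defensive.

Import Order.TTheory GRing.Theory Num.Theory.
Import numFieldNormedType.Exports.

Local Open Scope classical_set_scope.
Local Open Scope ring_scope.

Definition Gamma {R : realType} (a : R) : R :=
  \int[lebesgue_measure]_(x in `]0, +oo[) (x `^ (a - 1) * expR (- x)).

Definition Beta {R : realType} (a b : R) : R :=
  Gamma a * Gamma b / Gamma (a + b).

Definition kD {R : realType} (D : R) : R := Beta ((1 - D) / 2) D.

(* Slow variation in Karamata's sense: measurability of [L] near infinity is
   part of the notion. *)
Definition slowly_varying {R : realType} (L : R -> R) : Prop :=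
  (exists M : R, measurable_fun `[M, +oo[ L) /\
  (forall a : R, 0 < a -> L (a * x) / L x @[x --> +oo] --> (1 : R)).

Section laws.
Context {d} {T : measurableType d} {R : realType} (P : probability T R).

(* A Gaussian law may be degenerate. The case [s = 0] is separate because the
   library's [normal_prob m 0] is the uniform law on [0, 1]. *)
Definition gaussian_rv (Y : T -> R) : Prop :=
  exists m s : R, 0 <= s /\
    forall A : set R, measurable A ->
      P (Y @^-1` A) = if s == 0 then \d_m A else normal_prob m s A.

Definition nondegenerate_gaussian_rv (Y : T -> R) : Prop :=
  exists m s : R, 0 < s /\
    forall A : set R, measurable A -> P (Y @^-1` A) = normal_prob m s A.

Definition gaussian_process (X : {RV P >-> R}^nat) : Prop :=
  forall (n : nat) (a : 'I_n -> R),
    gaussian_rv (fun w => \sum_(i < n) a i * X i w).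

Definition stationary (X : {RV P >-> R}^nat) : Prop :=
  forall (h n : nat) (A : set (n.-tuple (measurableTypeR R))), measurable A ->
    P ((fun w => [tuple X (h + i)%N w | i < n]) @^-1` A) =
    P ((fun w => [tuple X i w | i < n]) @^-1` A).

End laws.

Definition cvg_in_distribution {R : realType}
    {d} {T : measurableType d} {P : probability T R}
    {d'} {T' : measurableType d'} {Q : probability T' R}
    (X : {RV P >-> R}^nat) (Y : {RV Q >-> R}) : Prop :=
  forall r : R, {for r, continuous (cdf Y)} ->
    cdf (X n) r @[n --> \oo] --> cdf Y r.

Section brownian.
Context {d} {T : measurableType d} {R : realType} (Q : probability T R).

Definition brownian_motion (B : R -> {RV Q >-> R}) : Prop :=
  [/\ {ae Q, forall w, B 0 w = 0},
      forall s t : R, s < t -> forall A : set R, measurable A ->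
        Q ((B t \- B s) @^-1` A) = normal_prob 0 (Num.sqrt (t - s)) A,
      forall (n : nat) (t : nat -> R) (A : nat -> set R),
        (forall i, t i <= t i.+1) -> (forall i, measurable (A i)) ->
        let E i := (B (t i.+1) \- B (t i)) @^-1` A i in
        Q (\bigcap_(i < n) E i) = (\prod_(i < n) Q (E i))%E
    & {ae Q, forall w, continuous (fun t : R => B t w)}].

(* The list [s] of triples [(c, (a, b))], with [a <= b], represents the step
   function [\sum_((c, (a, b)) <- s) c * \1_`]a, b]]. *)
Definition step_fun (s : seq (R * (R * R))) (x : R) : R :=
  \sum_(p <- s) p.1 * \1_(`]p.2.1, p.2.2]) x.

Definition step_integral (B : R -> {RV Q >-> R}) (s : seq (R * (R * R)))
    (w : T) : R :=
  \sum_(p <- s) p.1 * (B p.2.2 w - B p.2.1 w).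

(* [Z] is a version of the Wiener integral of the deterministic function [f]
   against [B]: the limit in mean square of the integrals of step functions
   that converge to [f] in L^2. *)
Definition wiener_integral (B : R -> {RV Q >-> R}) (f : R -> R)
    (Z : {RV Q >-> R}) : Prop :=
  exists s : nat -> seq (R * (R * R)),
    [/\ forall m p, p \in s m -> p.2.1 <= p.2.2,
        ('N[lebesgue_measure]_2%:E[EFin \o (f \- step_fun (s m))%R])%E
          @[m --> \oo] --> 0%E
      & ('N[Q]_2%:E[EFin \o (Z \- step_integral B (s m))%R])%E
          @[m --> \oo] --> 0%E].

End brownian.

(* [(y)_+ ^ (- (D + 1) / 2)] is [0] for [y <= 0], since [0 `^ a = 0] for
   [a != 0]. *)
Definition Z1D_kernel {R : realType} (D t x : R) : R :=
  \int[lebesgue_measure]_(u in `[0, t])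
    (Num.max (u - x) 0 `^ (- ((D + 1) / 2))).

Section wilcoxon.
Context {d} {T : measurableType d} {R : realType} {P : probability T R}.
Variable X : {RV P >-> R}^nat.

(* The sample X_1, ..., X_n is [X 0], ..., [X n.-1]. *)
Definition abs_rank (n : nat) (j : nat) (w : T) : nat :=
  #|[set i : 'I_n | `|X i w| <= `|X j w| ]%SET|.

Definition wilcoxon (n : nat) (w : T) : R :=
  \sum_(j < n) (abs_rank n j w)%:R * \1_[set v | 0 < X j v] w.

Lemma measurable_wilcoxon n : measurable_fun setT (wilcoxon n).
Proof.
have mX i : measurable_fun setT (X i) by exact: measurable_funP.
have mN i : measurable_fun setT (fun w => `|X i w|) by exact: measurableT_comp.
have mtrue (f : T -> bool) : measurable_fun setT f -> measurable [set w | f w].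
  by move=> /(_ measurableT [set true] I); rewrite setTI.
apply: measurable_sum => j; apply: measurable_funM; last first.
  by apply: measurable_indic; apply: mtrue; exact: measurable_fun_ltr.
rewrite (_ : (fun w => _) = fun w => \sum_(i < n)
    \1_[set v | `|X i v| <= `|X j v| ] w); last first.
  apply/funext => w; rewrite /abs_rank -sum1_card natr_sum big_mkcond /=.
  apply: eq_bigr => i _; rewrite inE indicE.
  case: ifPn => h; first by rewrite mem_set.
  by rewrite memNset //=; apply/negP.
apply: measurable_sum => i; apply: measurable_indic.
by apply: mtrue; exact: measurable_fun_ler.
Qed.

HB.instance Definition _ n :=
  isMeasurableFun.Build _ _ _ _ (wilcoxon n) (measurable_wilcoxon n).

Variables (D : R) (L : R -> R).

Definition normalized_wilcoxon (n : nat) (w : T) : R :=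
  n%:R `^ (D / 2) * L n%:R `^ (- (1 / 2)) *
  (2 / (n%:R * (n%:R - 1)) * wilcoxon n w - 1 / (n%:R - 1) - 1 / 2).

Lemma measurable_normalized_wilcoxon n :
  measurable_fun setT (normalized_wilcoxon n).
Proof.
apply: measurable_funM => //.
do 2 (apply: measurable_funB => //).
apply: measurable_funM => //; exact: measurable_wilcoxon.
Qed.

HB.instance Definition _ n := isMeasurableFun.Build _ _ _ _
  (normalized_wilcoxon n) (measurable_normalized_wilcoxon n).

End wilcoxon.

(* Main.v *)
Require Import Defs.
From HB Require Import structures.
From mathcomp Require Import all_boot all_order all_algebra.
From mathcomp Require Import all_classical all_reals all_analysis.
From mathcomp Require Import measurable_realfun.
From mathcomp Require Import ring lra.

(* Twice the signed-rank statistic is a sum over pairs (i, j) of a bounded kernel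
   which, when X_i and X_j are weakly correlated, is almost surely
   1 / 2 + sg (X_i + X_j) / 2.  For centered jointly Gaussian W, W' with standard
   deviations t, t' and covariance c, with k = sqrt (2 / pi),
     E (sg W * W') = k c / t,   E (sg W * sg W') = k^2 c / (t t') + O(c^2),
   so once sg (X_i + X_j) / 2 is replaced by (X_i + X_j) / (2 sqrt pi), its
   regression for uncorrelated X_i, X_j, the remainders of two pairs have a
   covariance that is negligible against the rho's between them.  Their sum has
   variance o (n^4 rho(n)), because rho(n) + ... + rho(1) = O (n rho(n)) and
   n rho(n) tends to infinity.  Hence the normalized statistic is, up to o(1) in
   mean square, a multiple of X_1 + ... + X_n.  This is exactly Gaussian, and its
   variance converges by Potter's bounds for L.  The limit agrees with the variance
   of the Wiener integral, since the square norm of the kernel of Z_{1,D}(1)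
   reduces to a Beta integral and equals 2 k(D) / ((1 - D) (2 - D)). *)

Set Implicit Arguments.
Unset Strict Implicit.
Unset Printing Implicit Defensive.

Import Order.TTheory GRing.Theory Num.Theory.
Import numFieldNormedType.Exports.

Local Open Scope classical_set_scope.
Local Open Scope ring_scope.

(** * Square-integrable functions *)

(** The hypotheses give Gaussian laws for linear combinations of the [X i] only, and cosine
    integrals with a phase are what such laws make explicit. Sine polynomials therefore take the
    place of joint densities and Hermite expansions: their covariances under a Gaussian pair are
    closed formulas, and [sg] is reached from them by two bounded pointwise limits. The same limits
    show that cosine integrals determine a law, which identifies the law of the Wiener integral. One
    slope has to serve all pairs, since a single multiple of X_1 + ... + X_n must come out. It is
    wrong for pairs (i, j) of small lag, where ties may even have positive probability. So [e] and
    [K] are fixed with |rho| <= e from lag [K] on; smaller lags are bounded crudely and, being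
    boundedly many, contribute O(n^3), which is o (n^4 rho(n)). The convergence in distribution is a
    coupling argument: X_1 + ... + X_n is rescaled to have exactly the law of the limit, and the
    mean square distance to the normalized statistic tends to 0. *)

Notation intgb mu f := (integrable mu setT (EFin \o f)).

Section real_integrable.
Context {d} {T : measurableType d} {R : realType}.
Variable mu : {measure set T -> \bar R}.
Implicit Types f g : T -> R.

Lemma intgb_measurable f : intgb mu f -> measurable_fun setT f.
Proof. by move=> /measurable_int /measurable_EFinP. Qed.

Lemma intgb_le f g : measurable_fun setT f -> (forall x, `|f x| <= g x) ->
  intgb mu g -> intgb mu f.
Proof.
move=> mf fg; apply: le_integrable => //; first exact/measurable_EFinP.
move=> x _ /=; rewrite lee_fin; apply: (le_trans (fg x)); exact: ler_norm.
Qed.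

Lemma intgbD f g : intgb mu f -> intgb mu g -> intgb mu (fun x => f x + g x).
Proof. by move=> i1 i2; exact: (integrableD measurableT i1 i2). Qed.

Lemma intgbB f g : intgb mu f -> intgb mu g -> intgb mu (fun x => f x - g x).
Proof. by move=> i1 i2; exact: (integrableB measurableT i1 i2). Qed.

Lemma intgbZ k f : intgb mu f -> intgb mu (fun x => k * f x).
Proof. by move=> i1; have := integrableZl measurableT k i1. Qed.

Lemma intgb_sum I (s : seq I) (h : I -> T -> R) :
  (forall i, intgb mu (h i)) -> intgb mu (fun x => \sum_(i <- s) h i x).
Proof.
move=> ih; elim: s => [|i s IH].
  apply: (@eq_integrable _ _ _ mu setT measurableT (cst 0%E)).
    by move=> x _; rewrite /= big_nil.
  exact: integrable0.
apply: (@eq_integrable _ _ _ mu setT measurableT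
  (EFin \o (fun x => h i x + \sum_(j <- s) h j x))).
  by move=> x _; rewrite /= big_cons.
exact: intgbD.
Qed.

Lemma intgb_norm f : intgb mu f -> intgb mu (fun x => `|f x|).
Proof. by move=> i1; apply: integrable_norm. Qed.

Lemma Rintegral_sum I (s : seq I) (h : I -> T -> R) :
  (forall i, intgb mu (h i)) ->
  \int[mu]_x (\sum_(i <- s) h i x) = \sum_(i <- s) \int[mu]_x h i x.
Proof.
move=> ih; elim: s => [|i s IH].
  under eq_Rintegral do rewrite big_nil.
  by rewrite big_nil /Rintegral integral0.
under eq_Rintegral do rewrite big_cons.
rewrite big_cons -IH RintegralD//; exact: intgb_sum.
Qed.

Lemma Rintegral_dominated_cvg (f_ : nat -> T -> R) f g :
  (forall n, measurable_fun setT (f_ n)) -> intgb mu g ->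
  (forall n x, `|f_ n x| <= g x) ->
  (forall x, f_ n x @[n --> \oo] --> f x) ->
  [/\ measurable_fun setT f, intgb mu f &
    (\int[mu]_x f_ n x) @[n --> \oo] --> \int[mu]_x f x].
Proof.
move=> mf ig fg cf.
have mlim : measurable_fun setT f.
  by apply: (measurable_fun_cvg mf) => x _; exact: cf.
have [] := @dominated_convergence _ _ _ mu setT measurableT
  (fun n => EFin \o f_ n) (EFin \o f) (EFin \o g).
- by move=> n; apply/measurable_EFinP.
- exact/measurable_EFinP.
- by apply: aeW => x _; apply: cvg_EFin; [apply: nearW | exact: cf].
- exact: ig.
- by apply: aeW => x n _ /=; rewrite lee_fin.
move=> iF _ cF; split => //.
by apply: fine_cvg; rewrite fineK// integrable_fin_num.
Qed.

(** Membership in L^2. Measurability of [f] is recorded apart, since it does not follow from that of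
    the square. *)
Definition sqint f := measurable_fun setT f /\ intgb mu (fun x => f x ^+ 2).

Lemma sqintM f g : sqint f -> sqint g -> intgb mu (fun x => f x * g x).
Proof.
move=> [mf f2] [mg g2].
apply: (@intgb_le _ (fun x => f x ^+ 2 + g x ^+ 2)); last exact: intgbD.
  exact: measurable_funM.
move=> x; rewrite ler_norml.
have := sqr_ge0 (f x + g x); have := sqr_ge0 (f x - g x).
have := sqr_ge0 (f x); have := sqr_ge0 (g x).
rewrite sqrrB sqrrD !mulr2n => *; apply/andP; split; lra.
Qed.

Lemma sqintD f g : sqint f -> sqint g -> sqint (fun x => f x + g x).
Proof.
move=> sf sg; have := sqintM sf sg; move: sf sg => [mf f2] [mg g2] fg.
split; first exact: measurable_funD.
apply: (@eq_integrable _ _ _ mu setT measurableT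
  (EFin \o (fun x => f x ^+ 2 + (2 * (f x * g x) + g x ^+ 2)))).
  by move=> x _; rewrite /=; congr EFin; ring.
by apply: intgbD => //; apply: intgbD => //; apply: intgbZ.
Qed.

Lemma sqintZ k f : sqint f -> sqint (fun x => k * f x).
Proof.
move=> [mf f2]; split; first exact: measurable_funM.
apply: (@eq_integrable _ _ _ mu setT measurableT
  (EFin \o (fun x => k ^+ 2 * f x ^+ 2))).
  by move=> x _; rewrite /= exprMn.
exact: intgbZ.
Qed.

Lemma sqintB f g : sqint f -> sqint g -> sqint (fun x => f x - g x).
Proof.
move=> sf sg; have := sqintD sf (sqintZ (-1) sg).
by under eq_fun do rewrite mulN1r.
Qed.

Lemma sqint_sum I (s : seq I) (h : I -> T -> R) :
  (forall i, sqint (h i)) -> sqint (fun x => \sum_(i <- s) h i x).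
Proof.
move=> ih; elim: s => [|i s IH].
  rewrite (_ : (fun x => _) = cst 0); last by apply/funext => x; rewrite big_nil.
  split; first exact: measurable_cst.
  rewrite (_ : EFin \o _ = cst 0%E); first exact: integrable0.
  by apply/funext => x; rewrite /= expr0n.
rewrite (_ : (fun x => _) = (fun x => h i x + \sum_(j <- s) h j x)).
  exact: sqintD.
by apply/funext => x; rewrite big_cons.
Qed.

Lemma Rintegral_sqr_sum I (s : seq I) (h : I -> T -> R) :
  (forall i, sqint (h i)) ->
  \int[mu]_x (\sum_(i <- s) h i x) ^+ 2 =
  \sum_(i <- s) \sum_(j <- s) \int[mu]_x (h i x * h j x).
Proof.
move=> ih.
under eq_Rintegral do rewrite expr2 big_distrlr /=.
rewrite Rintegral_sum; last first.
  by move=> i; apply: intgb_sum => j; exact: sqintM.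
by apply: eq_bigr => i _; rewrite Rintegral_sum// => j; exact: sqintM.
Qed.

Lemma Rintegral_sqrD_le f g : sqint f -> sqint g ->
  \int[mu]_x (f x + g x) ^+ 2 <=
  2 * \int[mu]_x f x ^+ 2 + 2 * \int[mu]_x g x ^+ 2.
Proof.
move=> sf sg; move: (sqintD sf sg) => [_ sfg]; move: sf sg => [mf f2] [mg g2].
rewrite -!RintegralZl// -RintegralD//; [|exact: intgbZ..].
apply: le_Rintegral => //; first by apply: intgbD; exact: intgbZ.
move=> x _; have := sqr_ge0 (f x - g x); rewrite sqrrB sqrrD !mulr2n => ?; lra.
Qed.

(** With h = f - f_n, the difference f_n^2 - f^2 is h^2 - 2 f h, and Young's inequality bounds |2 f
    h| by e f^2 + h^2 / e. The weight e is then chosen small against the integral of f^2. *)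
Lemma Rintegral_sqr_cvg (f_ : nat -> T -> R) f : sqint f ->
  (forall n, sqint (f_ n)) ->
  \int[mu]_x (f x - f_ n x) ^+ 2 @[n --> \oo] --> (0 : R) ->
  \int[mu]_x f_ n x ^+ 2 @[n --> \oo] --> \int[mu]_x f x ^+ 2.
Proof.
move=> sf sfn fn0.
set I := \int[mu]_x f x ^+ 2.
have I0 : 0 <= I by apply: Rintegral_ge0 => x _; exact: sqr_ge0.
have key e n : 0 < e -> `|\int[mu]_x f_ n x ^+ 2 - I| <=
    e * I + (1 + e^-1) * \int[mu]_x (f x - f_ n x) ^+ 2.
  move=> e0; have [_ i1] := sfn n; have [_ i2] := sf.
  have [_ i3] := sqintB sf (sfn n).
  rewrite -RintegralB// /I -!RintegralZl// -RintegralD//; [|exact: intgbZ..].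
  apply: (le_trans (le_normr_Rintegral _ _)) => //; first exact: intgbB.
  apply: le_Rintegral => //; first by apply: intgb_norm; exact: intgbB.
    by apply: intgbD; exact: intgbZ.
  move=> x _; set a := f x; set h := a - f_ n x.
  have -> : f_ n x = a - h by rewrite /h subKr.
  have q1 := sqr_ge0 h.
  have q2 : 0 <= e * (a - e^-1 * h) ^+ 2 by rewrite mulr_ge0 ?sqr_ge0// ltW.
  have q3 : 0 <= e * (a + e^-1 * h) ^+ 2 by rewrite mulr_ge0 ?sqr_ge0// ltW.
  have E1 : e * (a - e^-1 * h) ^+ 2 = e * a ^+ 2 - 2 * a * h + e^-1 * h ^+ 2.
    by field; rewrite gt_eqF.
  have E2 : e * (a + e^-1 * h) ^+ 2 = e * a ^+ 2 + 2 * a * h + e^-1 * h ^+ 2.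
    by field; rewrite gt_eqF.
  rewrite E1 in q2; rewrite E2 in q3.
  have -> : (a - h) ^+ 2 - a ^+ 2 = h ^+ 2 - 2 * a * h by ring.
  have q4 : 0 <= e^-1 * h ^+ 2 by rewrite mulr_ge0 ?invr_ge0// ltW.
  rewrite ler_norml; apply/andP; split; nra.
apply/cvgrPdist_le => eps eps0.
(* The [+ 1] covers the case [I = 0]. *)
pose e := eps / (2 * (I + 1)).
have e0 : 0 < e by rewrite divr_gt0// mulr_gt0// ltr_wpDl.
have c0 : 0 < eps / 2 / (1 + e^-1).
  by rewrite !divr_gt0// ltr_pwDl// ltW// invr_gt0.
move/cvgrPdist_le: fn0 => /(_ _ c0); apply: filterS => n.
rewrite sub0r normrN ger0_norm; last by apply: Rintegral_ge0 => x _; exact: sqr_ge0.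
rewrite ler_pdivlMr; last by rewrite ltr_pwDl// ltW// invr_gt0.
move=> h; rewrite distrC; apply: (le_trans (key e n e0)).
have -> : eps = eps / 2 + eps / 2 by field.
apply: lerD; last by rewrite mulrC.
rewrite /e mulrAC ler_pdivrMr ?mulr_gt0// ?ltr_wpDl//; nra.
Qed.

Lemma eq_Rintegral_ae f g :
  measurable_fun setT f -> measurable_fun setT g ->
  {ae mu, forall x, f x = g x} -> \int[mu]_x f x = \int[mu]_x g x.
Proof.
move=> mf mg fg; rewrite /Rintegral; congr fine; apply: ae_eq_integral => //.
- exact/measurable_EFinP.
- exact/measurable_EFinP.
- by apply: filterS fg => x fgx _ /=; rewrite fgx.
Qed.

End real_integrable.

Section probability_integrable.
Context {d} {T : measurableType d} {R : realType} (P : probability T R).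

Lemma intgb_cst c : intgb P (fun _ : T => c : R).
Proof. exact: finite_measure_integrable_cst. Qed.

Lemma intgb_bounded (f : T -> R) M : measurable_fun setT f ->
  (forall x, `|f x| <= M) -> intgb P f.
Proof. by move=> mf fM; apply: (intgb_le mf fM); exact: intgb_cst. Qed.

Lemma sqint_bounded (f : T -> R) M : measurable_fun setT f ->
  (forall x, `|f x| <= M) -> sqint P f.
Proof.
move=> mf fM; split => //.
apply: (@intgb_bounded _ (M ^+ 2)); first exact: measurable_funX.
move=> x; rewrite normrX lerXn2r ?nnegrE//; exact: le_trans (fM x).
Qed.

Lemma sqint_intgb (f : T -> R) : sqint P f -> intgb P f.
Proof.
move=> sf; have s1 : sqint P (fun _ => 1) by apply: (@sqint_bounded _ 1) => // x; rewrite normr1.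
by have := sqintM sf s1; under [in X in X -> _]eq_fun do rewrite mulr1.
Qed.

Lemma Rintegral_prob_cst (c : R) : \int[P]_x c = c.
Proof.
by rewrite Rintegral_cst// (_ : fine _ = 1) ?mulr1// -[RHS]/(fine 1%E) -(@probability_setT _ _ _ P).
Qed.

End probability_integrable.

(** * Change of variables from a map to its law *)

Section law_transfer.
Context {d} {T : measurableType d} {R : realType}.
Context {d'} {S : measurableType d'}.
Variables (mu : {measure set T -> \bar R}) (nu : {measure set S -> \bar R}).
Variable Y : T -> S.
Hypothesis mY : measurable_fun setT Y.
Hypothesis lawY : forall A, measurable A -> mu (Y @^-1` A) = nu A.

Lemma ge0_integral_law (h : S -> \bar R) : measurable_fun setT h ->
  (forall x, 0 <= h x)%E -> (\int[nu]_y h y = \int[mu]_x h (Y x))%E.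
Proof.
move=> mh h0.
have := @ge0_integral_pushforward _ _ _ _ R Y mY mu setT h measurableT mh
  (fun x _ => h0 x).
rewrite preimage_setT => <-; apply: eq_measure_integral => A mA _.
by rewrite -lawY.
Qed.

Lemma intgb_law (h : S -> R) : measurable_fun setT h ->
  intgb nu h <-> intgb mu (h \o Y).
Proof.
move=> mh; have mhY : measurable_fun setT (h \o Y) by exact: measurableT_comp.
have E : (\int[nu]_y `|(EFin \o h) y| = \int[mu]_x `|(EFin \o (h \o Y)) x|)%E.
  by apply: ge0_integral_law => //; apply: measurableT_comp => //; exact/measurable_EFinP.
split => /integrableP[_ fin]; apply/integrableP; split.
- exact/measurable_EFinP.
- by rewrite -E.
- exact/measurable_EFinP.
- by rewrite E.
Qed.

Lemma Rintegral_law (h : S -> R) : measurable_fun setT h ->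
  \int[nu]_y h y = \int[mu]_x h (Y x).
Proof.
move=> mh; rewrite /Rintegral; congr fine.
rewrite integralE [RHS]integralE.
rewrite (@ge0_integral_law (fun z => (h z)%:E)^\+%E)//; last first.
  by apply: measurable_funepos; exact/measurable_EFinP.
rewrite (@ge0_integral_law (fun z => (h z)%:E)^\-%E)//; last first.
  by apply: measurable_funeneg; exact/measurable_EFinP.
congr (_ - _)%E; apply: eq_integral => x _; rewrite ?funeposE ?funenegE ?/funepos ?/funeneg /=; reflexivity.
Qed.

End law_transfer.

(** * Gaussian laws *)

Section density.
Context {d} {T : measurableType d} {R : realType}.
Variables (mu nu : {measure set T -> \bar R}) (p : T -> R).
Hypotheses (mp : measurable_fun setT p) (p_ge0 : forall x, 0 <= p x).
Hypothesis nuE :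
  forall A, measurable A -> nu A = (\int[mu]_(x in A) (p x)%:E)%E.
Local Open Scope ereal_scope.
Import HBNNSimple.

Let density_nnsfun (f : {nnsfun T >-> R}) :
  \int[nu]_x (f x)%:E = \int[mu]_x ((f x)%:E * (p x)%:E).
Proof.
have mi r : measurable_fun setT (fun x => (r * \1_(f @^-1` [set r]) x)%:E).
  by apply/measurable_EFinP; exact: measurable_funM.
under [LHS]eq_integral do rewrite fimfunE -fsumEFin//.
rewrite [LHS]ge0_integral_fsum//; last first.
  by move=> r x _; exact: nnfun_muleindic_ge0.
under [RHS]eq_integral => x _.
  rewrite fimfunE -fsumEFin// ge0_mule_fsuml; last first.
    by move=> r; exact: nnfun_muleindic_ge0.
  over.
rewrite [RHS]ge0_integral_fsum//; last 2 first.
  - by move=> r; apply: emeasurable_funM => //; exact/measurable_EFinP.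
  - by move=> r x _; apply: mule_ge0; rewrite ?lee_fin//; exact: nnfun_muleindic_ge0.
apply: eq_fsbigr => r rf.
have r0 : (0 <= r)%R by move: rf; rewrite inE => -[x _ <-].
rewrite integralZl_indic_nnsfun//= integral_indic//= setIT nuE//.
under [RHS]eq_integral do rewrite EFinM -muleA.
rewrite [RHS]ge0_integralZl//; last 2 first.
  - by apply: emeasurable_funM; apply/measurable_EFinP.
  - by move=> x _; rewrite mule_ge0 ?lee_fin.
congr (_ * _); rewrite integral_mkcond; apply: eq_integral => x _.
by rewrite patchE indicE; case: ifPn => xf; rewrite ?xf ?(negbTE xf) ?mul1e ?mul0e.
Qed.

(** Simple functions are treated by [density_nnsfun]; monotone convergence, applied on both sides to
    the same approximation of [f], does the rest. *)
Lemma ge0_integral_density (f : T -> \bar R) : measurable_fun setT f ->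
  (forall x, 0 <= f x) -> \int[nu]_x f x = \int[mu]_x (f x * (p x)%:E).
Proof.
move=> mf f0; pose h := nnsfun_approx measurableT mf.
have hf x : (EFin \o h n) x @[n --> \oo] --> f x.
  by apply: cvg_nnsfun_approx => //; move=> ? _; exact: f0.
transitivity (limn (fun n => \int[nu]_x (h n x)%:E)).
  rewrite -monotone_convergence//.
  - by apply: eq_integral => x _; apply/esym/cvg_lim => //; exact: hf.
  - by move=> n; exact/measurable_EFinP.
  - by move=> n x _; rewrite lee_fin.
  - by move=> x _ a b ab; rewrite lee_fin; exact/lefP/nd_nnsfun_approx.
transitivity (limn (fun n => \int[mu]_x ((h n x)%:E * (p x)%:E))).
  by apply: congr_lim; apply/funext => n; exact: density_nnsfun.
rewrite -monotone_convergence//.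
- apply: eq_integral => x _; apply/cvg_lim => //.
  by apply: cvgeZr => //; exact: hf.
- by move=> n; apply: emeasurable_funM; exact/measurable_EFinP.
- by move=> n x _; rewrite mule_ge0 ?lee_fin.
- move=> x _ a b ab; rewrite lee_wpmul2r ?lee_fin//.
  exact/lefP/nd_nnsfun_approx.
Qed.

Lemma intgb_density (f : T -> R) : measurable_fun setT f ->
  intgb nu f <-> intgb mu (fun x => f x * p x)%R.
Proof.
move=> mf; have mfp : measurable_fun setT (fun x => f x * p x)%R by exact: measurable_funM.
have E : \int[nu]_x `|(EFin \o f) x| = \int[mu]_x `|(EFin \o (fun x => f x * p x)%R) x|.
  rewrite ge0_integral_density//; last by apply: measurableT_comp => //; exact/measurable_EFinP.
  by apply: eq_integral => x _; rewrite /= normrM (ger0_norm (p_ge0 x)) EFinM.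
split => /integrableP[_ fin]; apply/integrableP; split.
- exact/measurable_EFinP.
- by rewrite -E.
- exact/measurable_EFinP.
- by rewrite E.
Qed.

Lemma Rintegral_density (f : T -> R) : measurable_fun setT f ->
  (\int[nu]_x f x = \int[mu]_x (f x * p x))%R.
Proof.
move=> mf; rewrite /Rintegral; congr fine.
have mE : measurable_fun setT (EFin \o f) by exact/measurable_EFinP.
rewrite integralE [RHS]integralE; congr (_ - _).
  rewrite ge0_integral_density//; last exact: measurable_funepos.
  apply: eq_integral => x _; rewrite !funeposE EFinM maxeMl ?lee_fin//.
  by rewrite mul0e.
rewrite ge0_integral_density//; last exact: measurable_funeneg.
apply: eq_integral => x _; rewrite !funenegE EFinM -mulNe maxeMl ?lee_fin//.
by rewrite mul0e.
Qed.

End density.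

Section normal_integrals.
Context {R : realType}.
Local Notation mu := (@lebesgue_measure R).

(** The fundamental theorem on [-n, n], then dominated convergence. With [F] equal to a function
    times the normal density, this is the integration by parts behind the Gaussian integrals
    below. *)
Lemma Rintegral_setT_derive0 (F f : R -> R) :
  (forall x, is_derive x (1 : R) F (f x)) -> continuous f -> intgb mu f ->
  F x @[x --> +oo] --> (0 : R) -> F x @[x --> -oo] --> (0 : R) ->
  \int[mu]_x f x = 0.
Proof.
move=> dF cf intf Fy FNy.
pose f_ n : R -> R := f \_ `[- n%:R, n%:R].
have mf : measurable_fun setT f by exact: continuous_measurable_fun.
have mf_ n : measurable_fun setT (f_ n).
  by apply/(measurable_restrictT _ _).1 => //; exact: measurable_funTS.
have [|| |_ _ C] := @Rintegral_dominated_cvg _ _ R mu f_ f (fun x => `|f x|) mf_.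
- exact: intgb_norm.
- by move=> n x; rewrite /f_ patchE; case: ifP => // _; rewrite normr0.
- move=> x; apply: cvg_near_cst.
  exists (Num.bound `|x|) => // n /= hn; rewrite /f_ patchE mem_set//=.
  rewrite in_itv/= -ler_norml; apply/ltW/(lt_le_trans (archi_boundP (normr_ge0 x))).
  by rewrite ler_nat.
apply/esym/(cvg_unique _ _ C) => //=.
rewrite (_ : (fun n => _) = fun n => F n%:R - F (- n%:R)); last first.
  apply/funext => n.
  rewrite /f_ -Rintegral_mkcond /Rintegral.
  (* At [n = 0] the interval is a point, while the fundamental theorem asks for distinct bounds. *)
  case: n => [|n].
    by rewrite mulr0n oppr0 set_itv1 integral_set1/= subrr.
  rewrite (@continuous_FTC2 _ _ F)//.
  - by rewrite -subr_gt0 opprK addr_gt0 ?ltr0n.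
  - by apply: continuous_subspaceT => x; exact: cf.
  - have cF x : {for x, continuous F}.
      by apply: differentiable_continuous; apply/derivable1_diffP; case: (dF x).
    split.
    + by move=> x _; case: (dF x).
    + by apply: cvg_at_right_filter; exact: cF.
    + by apply: cvg_at_left_filter; exact: cF.
  - by move=> x _; rewrite derive1E; case: (dF x).
rewrite -[X in _ --> X](subrr (0 : R)); apply: cvgB.
  by apply: (cvg_comp _ _ _ Fy); exact: cvgr_idn.
by apply: (cvg_comp _ _ _ FNy); apply/cvgNrNy; exact: cvgr_idn.
Qed.

End normal_integrals.

Section lebesgue_affine.
Context {R : realType}.
Local Notation mu := (@lebesgue_measure R).

(** The rescaled image measure agrees with Lebesgue measure on the intervals []x, y]], which
    determine it. A negative [a] exchanges the endpoints and turns them into intervals closed on the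
    left, of the same length. *)
Lemma lebesgue_measure_affine (a b : R) (A : set R) : a != 0 -> measurable A ->
  mu A = (`|a|%:E * mu ((fun x => (a * x + b)%R) @^-1` A))%E.
Proof.
move=> a0; move: A.
have mphi : measurable_fun setT
    (fun x : measurableTypeR R => a * x + b : measurableTypeR R).
  by apply: measurable_funD => //; exact: measurable_funM.
pose k : {nonneg R} := NngNum (normr_ge0 a).
pose phi := (fun x : measurableTypeR R => a * x + b : measurableTypeR R).
pose m2 : {measure set (measurableTypeR R) -> \bar R} :=
  mscale k (pushforward mu phi).
suff H (A : set (measurableTypeR R)) : measurable A -> mu A = m2 mphi A.
  by move=> A /H ->.
apply: lebesgue_measure_unique => _ [[x y] _ <-].
rewrite -[LHS]/(mu `]x, y]) -[RHS]/((`|a|%:E * mu (phi @^-1` `]x, y]))%E).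
have [a_gt0|a_lt0|] := ltrgt0P a; last by move/eqP; rewrite (negbTE a0).
  have pre : phi @^-1` `]x, y] = `](x - b) / a, (y - b) / a]%classic.
    by apply/seteqP; split => z /=; rewrite !in_itv/= ltr_pdivrMr// ler_pdivlMr//
      ltrBlDr lerBrDr (mulrC z).
  rewrite pre !lebesgue_measure_itv/= !lte_fin.
  rewrite ltr_pM2r ?invr_gt0// ltrBlDr subrK.
  case: ifPn => _; last by rewrite mule0.
  by rewrite -!EFinD -EFinM; congr EFin; field; rewrite gt_eqF.
have pre : phi @^-1` `]x, y] = `[(y - b) / a, (x - b) / a[%classic.
  by apply/seteqP; split => z /=; rewrite !in_itv/= ltr_ndivlMr// ler_ndivrMr//
    ltrBlDr lerBrDr (mulrC z) andbC.
rewrite pre !lebesgue_measure_itv/= !lte_fin.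
rewrite ltr_nM2r ?invr_lt0// ltrBlDr subrK.
case: ifPn => _; last by rewrite mule0.
by rewrite -!EFinD -EFinM; congr EFin; field; rewrite lt_eqF.
Qed.

Lemma ge0_integral_affine (a b : R) (f : R -> \bar R) : a != 0 ->
  measurable_fun setT f -> (forall x, 0 <= f x)%E ->
  (\int[mu]_x f x = `|a|%:E * \int[mu]_x f (a * x + b)%R)%E.
Proof.
move=> a0 mf f0.
have mphi : measurable_fun setT
    (fun x : measurableTypeR R => a * x + b : measurableTypeR R).
  by apply: measurable_funD => //; exact: measurable_funM.
pose k : {nonneg R} := NngNum (normr_ge0 a).
rewrite (@ge0_integral_law _ _ R _ _ (mscale k mu) mu _ mphi _ f mf f0).
  by rewrite ge0_integral_mscale//; exact: measurableT_comp.
by move=> A mA; rewrite [RHS](lebesgue_measure_affine b a0 mA).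
Qed.

End lebesgue_affine.

Section normal_integrals.
Context {R : realType}.
Local Notation mu := (@lebesgue_measure R).
Local Notation p := (normal_pdf (0 : R) 1).

Lemma std_normal_pdfE (x : R) : p x = normal_peak 1 * expR (- x ^+ 2 / 2).
Proof.
by rewrite normal_pdfE ?oner_neq0// /normal_fun subr0 expr1n.
Qed.

Lemma is_derive_std_normal_pdf (x : R) : is_derive x (1 : R) p (- x * p x).
Proof.
rewrite (_ : p = fun x => normal_peak 1 * expR (- x ^+ 2 / 2)); last first.
  by apply/funext => y; exact: std_normal_pdfE.
have h : is_derive x (1 : R) (fun x : R => - x ^+ 2 / 2) (- x).
  apply: is_derive_eq; rewrite /GRing.scale/=; lra.
have h2 := @is_derive1_comp _ expR (fun x : R => - x ^+ 2 / 2) x _ _ (is_derive_expR (- x ^+ 2 / 2)) h.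
apply: is_derive_eq; rewrite /GRing.scale/=; ring.
Qed.

Lemma std_normal_pdf_cvgy : p x @[x --> +oo] --> (0 : R).
Proof.
rewrite (_ : p = fun x => normal_peak 1 * gauss_fun ((Num.sqrt 2)^-1 * x)); last first.
  apply/funext => y; rewrite std_normal_pdfE /gauss_fun exprMn exprVn sqr_sqrtr; last exact: ler0n.
  by congr (_ * expR _); field.
rewrite -[X in _ --> X](mulr0 (normal_peak (1 : R))); apply: cvgM; first exact: cvg_cst.
apply: (cvg_comp _ _ _ cvg_gauss_fun); apply: gt0_cvgMry => //.
Qed.

Lemma std_normal_pdf_cvgNy : p x @[x --> -oo] --> (0 : R).
Proof.
apply/cvgNy_compNP; rewrite (_ : _ \o _ = p); first exact: std_normal_pdf_cvgy.
by apply/funext => x; rewrite /= !std_normal_pdfE sqrrN.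
Qed.

(** Since |x| <= 1 + x^2 / 4 <= exp (x^2 / 4), the product is at most a multiple of exp (- x^2 / 4),
    the density of variance 2. Integrability and decay of [x * p x] are read off from it. *)
Lemma std_normal_pdf_absM_le (x : R) :
  `|x| * p x <= normal_peak 1 / normal_peak (Num.sqrt 2) * normal_pdf 0 (Num.sqrt 2) x.
Proof.
have s0 : Num.sqrt 2 != 0 :> R by rewrite sqrtr_eq0 -ltNge.
rewrite std_normal_pdfE normal_pdfE// /normal_fun subr0 sqr_sqrtr; last exact: ler0n.
rewrite mulrCA -[leRHS]mulrA mulKf ?gt_eqF ?normal_peak_gt0//.
rewrite ler_wpM2l ?normal_peak_ge0//.
rewrite (_ : - x ^+ 2 / 2 = - (x ^+ 2) / (2 *+ 2) - x ^+ 2 / 4); last first.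
  by rewrite -mulr_natr; field.
rewrite expRD mulrCA ler_piMr ?expR_ge0// expRN ler_pdivrMr ?expR_gt0// mul1r.
apply: le_trans (expR_ge1Dx _).
have := sqr_ge0 (`|x| / 2 - 1); have := real_normK (num_real x); nra.
Qed.

Lemma intgb_std_normal_pdf : intgb mu p.
Proof. exact: integrable_normal_pdf. Qed.

Lemma measurable_std_normal_pdf : measurable_fun setT p.
Proof. exact: measurable_normal_pdf. Qed.

Lemma std_normal_pdf_ge0 x : 0 <= p x.
Proof. exact: normal_pdf_ge0. Qed.

Lemma intgb_abs_std_normal : intgb mu (fun x => `|x| * p x).
Proof.
apply: (@intgb_le _ _ _ mu _ (fun x => normal_peak 1 / normal_peak (Num.sqrt 2) *
    normal_pdf 0 (Num.sqrt 2) x)).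
- by apply: measurable_funM; [exact: normr_measurable|exact: measurable_std_normal_pdf].
- move=> x; rewrite ger0_norm ?mulr_ge0 ?std_normal_pdf_ge0//.
  exact: std_normal_pdf_absM_le.
- apply: intgbZ; exact: integrable_normal_pdf.
Qed.

(** The phase [th] lets one family of cosine integrals carry both the real and the imaginary part of
    the characteristic function. *)
Let phi (th t : R) := \int[mu]_x (cos (t * x + th) * p x).

Lemma abs_cos_le1 (x : R) : `|cos x| <= 1.
Proof. by rewrite ler_norml cos_geN1 cos_le1. Qed.

Lemma abs_sin_le1 (x : R) : `|sin x| <= 1.
Proof. by rewrite ler_norml sin_geN1 sin_le1. Qed.

Lemma continuous_affine (a b : R) : continuous (fun x : R => a * x + b).
Proof.
move=> x; apply: cvgD; last exact: cvg_cst.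
by apply: cvgM; [exact: cvg_cst|exact: cvg_id].
Qed.

Lemma continuous_cos_affine (t th : R) : continuous (fun x : R => cos (t * x + th)).
Proof.
move=> x; apply: (@continuous_comp _ _ _ (fun x => t * x + th) cos).
  exact: continuous_affine.
exact: continuous_cos.
Qed.

Lemma continuous_sin_affine (t th : R) : continuous (fun x : R => sin (t * x + th)).
Proof.
move=> x; apply: (@continuous_comp _ _ _ (fun x => t * x + th) sin).
  exact: continuous_affine.
exact: continuous_sin.
Qed.

Lemma continuous_std_normal_pdf : continuous p.
Proof. exact: continuous_normal_pdf (oner_neq0 R). Qed.

Lemma is_derive_sin_affine (t th x : R) :
  is_derive x (1 : R) (fun x => sin (t * x + th)) (t * cos (t * x + th)).
Proof.
have h : is_derive x (1 : R) (fun x : R => t * x + th) t.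
  by apply: is_derive_eq; rewrite /GRing.scale/=; ring.
have := @is_derive1_comp _ sin (fun x : R => t * x + th) x _ _ (is_derive_sin _) h.
by move=> h2; apply: is_derive_eq; rewrite mulrC.
Qed.

Lemma is_derive_cos_affine (t th x : R) :
  is_derive x (1 : R) (fun x => cos (t * x + th)) (- t * sin (t * x + th)).
Proof.
have h : is_derive x (1 : R) (fun x : R => t * x + th) t.
  by apply: is_derive_eq; rewrite /GRing.scale/=; ring.
have := @is_derive1_comp _ cos (fun x : R => t * x + th) x _ _ (is_derive_cos _) h.
by move=> h2; apply: is_derive_eq; rewrite mulrC mulrN mulNr.
Qed.

Lemma intgb_bounded_pdf (f : R -> R) M : continuous f -> (forall x, `|f x| <= M) ->
  intgb mu (fun x => f x * p x).
Proof.
move=> cf fM; apply: (@intgb_le _ _ _ mu _ (fun x => M * p x)).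
- by apply: measurable_funM; [exact: continuous_measurable_fun|exact: measurable_std_normal_pdf].
- move=> x; rewrite normrM (ger0_norm (std_normal_pdf_ge0 x)).
  by rewrite ler_wpM2r// std_normal_pdf_ge0.
- by apply: intgbZ; exact: intgb_std_normal_pdf.
Qed.

Lemma intgb_x_sin_pdf (t th : R) :
  intgb mu (fun x => x * sin (t * x + th) * p x).
Proof.
apply: (intgb_le _ _ intgb_abs_std_normal).
  apply: measurable_funM; last exact: measurable_std_normal_pdf.
  apply: measurable_funM => //.
  by apply: continuous_measurable_fun; exact: continuous_sin_affine.
move=> x; rewrite !normrM (ger0_norm (std_normal_pdf_ge0 x)).
by rewrite ler_wpM2r ?std_normal_pdf_ge0// ler_piMr// abs_sin_le1.
Qed.

(** As p' = - x p, the difference of the two integrands is the derivative of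
    [sin (t * x + th) * p x], which vanishes at both infinities. *)
Lemma Rintegral_x_sin_pdf (t th : R) :
  \int[mu]_x (x * sin (t * x + th) * p x) = t * phi th t.
Proof.
have i1 := intgb_x_sin_pdf t th.
have i2 : intgb mu (fun x => cos (t * x + th) * p x).
  by apply: (@intgb_bounded_pdf _ 1) => [|x]; [exact: continuous_cos_affine|exact: abs_cos_le1].
suff : \int[mu]_x (t * (cos (t * x + th) * p x) - x * sin (t * x + th) * p x) = 0.
  by rewrite RintegralB//; [rewrite RintegralZl// => /eqP; rewrite subr_eq0 => /eqP|exact: intgbZ].
apply: (@Rintegral_setT_derive0 _ (fun x => sin (t * x + th) * p x)).
- move=> x; have h1 := is_derive_sin_affine t th x.
  have h2 := is_derive_std_normal_pdf x.
  by apply: is_derive_eq; rewrite /GRing.scale/=; ring.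
- move=> x; apply: cvgB.
    apply: cvgM; [exact: cvg_cst|].
    by apply: cvgM; [exact: continuous_cos_affine|exact: continuous_std_normal_pdf].
  apply: cvgM; last exact: continuous_std_normal_pdf.
  by apply: cvgM; [exact: cvg_id|exact: continuous_sin_affine].
- by apply: intgbB => //; exact: intgbZ.
- apply/norm_cvg0P; apply: (@squeeze_cvgr _ _ _ _ (cst 0) p).
  + apply: nearW => x; rewrite normr_ge0 normrM (ger0_norm (std_normal_pdf_ge0 x)).
    by rewrite ler_piMl ?std_normal_pdf_ge0// abs_sin_le1.
  + exact: cvg_cst.
  + exact: std_normal_pdf_cvgy.
- apply/norm_cvg0P; apply: (@squeeze_cvgr _ _ _ _ (cst 0) p).
  + apply: nearW => x; rewrite normr_ge0 normrM (ger0_norm (std_normal_pdf_ge0 x)).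
    by rewrite ler_piMl ?std_normal_pdf_ge0// abs_sin_le1.
  + exact: cvg_cst.
  + exact: std_normal_pdf_cvgNy.
Qed.

(** Differentiation under the integral, dominated by [|x| * p x], followed by the integration by
    parts above. *)
Lemma is_derive_phi (th t : R) : is_derive t (1 : R) (phi th) (- t * phi th t).
Proof.
pose f (t x : R) := cos (t * x + th) * p x.
have dfx (u x : R) : is_derive u (1 : R) (f ^~ x) (- x * sin (u * x + th) * p x).
  rewrite /f; have h := is_derive_cos_affine x th u.
  rewrite (_ : (fun u => _) = fun u => cos (x * u + th) * p x); last first.
    by apply/funext => v; rewrite (mulrC v).
  by apply: is_derive_eq; rewrite /GRing.scale/= (mulrC u); ring.
have intf u : intgb mu (f u).
  by apply: (@intgb_bounded_pdf _ 1) => [|x]; [exact: continuous_cos_affine|exact: abs_cos_le1].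
have tI : `]t - 1, t + 1[%classic t by rewrite /= in_itv/= ltrDl ltrBlDl ltrDr ltr01.
have G0 x : 0 <= `|x| * p x by rewrite mulr_ge0// std_normal_pdf_ge0.
have Gub u x : `]t - 1, t + 1[%classic u -> setT x -> `|partial1of2 f u x| <= `|x| * p x.
  move=> _ _; rewrite partial1of2E; have [_ ->] := dfx u x.
  rewrite !normrM normrN (ger0_norm (std_normal_pdf_ge0 x)).
  by rewrite ler_wpM2r ?std_normal_pdf_ge0// ler_piMr// abs_sin_le1.
have dd u x : `]t - 1, t + 1[%classic u -> setT x -> derivable (f ^~ x) u 1.
  by move=> _ _; case: (dfx u x).
have D := @derivable_under_integral _ _ _ mu f setT measurableT t (t - 1) (t + 1) tI
  (fun u _ => intf u) dd (fun x => `|x| * p x) G0 intgb_abs_std_normal Gub.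
have E := @differentiation_under_integral _ _ _ mu f setT measurableT t (t - 1) (t + 1) tI
  (fun u _ => intf u) dd (fun x => `|x| * p x) G0 intgb_abs_std_normal Gub.
apply: DeriveDef => //; rewrite -derive1E -[LHS]/(derive1 (fun u => \int[mu]_x f u x) t) E.
rewrite mulNr -Rintegral_x_sin_pdf -mulN1r -RintegralZl//; last exact: intgb_x_sin_pdf.
apply: eq_Rintegral => x _; rewrite partial1of2E; have [_ ->] := dfx t x.
by rewrite mulN1r !mulNr.
Qed.

(** The equation phi' = - t phi makes [g], that is phi times exp (t^2 / 2), constant; its value at 0
    is [cos th]. *)
Lemma Rintegral_cos_std_normal_pdf (th t : R) :
  \int[mu]_x (cos (t * x + th) * p x) = cos th * expR (- t ^+ 2 / 2).
Proof.
pose g u := phi th u * expR (u ^+ 2 / 2).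
have dg u : is_derive u (1 : R) g 0.
  have h : is_derive u (1 : R) (fun x : R => x ^+ 2 / 2) u.
    by apply: is_derive_eq; rewrite /GRing.scale/=; lra.
  have h2 := @is_derive1_comp _ expR (fun x : R => x ^+ 2 / 2) u _ _ (is_derive_expR (u ^+ 2 / 2)) h.
  have h3 := is_derive_phi th u.
  by apply: is_derive_eq; rewrite /GRing.scale/=; ring.
have := is_derive_0_is_cst t 0 dg.
rewrite /g expr0n mul0r expR0 mulr1 => H.
rewrite -[LHS]/(phi th t) mulNr expRN -[LHS](mulfK (lt0r_neq0 (expR_gt0 (t ^+ 2 / 2)))) H.
congr (_ * _); rewrite /phi.
under eq_Rintegral do rewrite mul0r add0r.
rewrite RintegralZl//; last exact: intgb_std_normal_pdf.
by rewrite /Rintegral integral_normal_pdf/= mulr1.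
Qed.

End normal_integrals.

Section normal_moments.
Context {R : realType}.
Local Notation mu := (@lebesgue_measure R).
Local Notation p := (normal_pdf (0 : R) 1).

(** Here x^2 <= 4 exp (x^2 / 4), which again leaves a multiple of the density of variance 2. *)
Lemma std_normal_pdf_sqrM_le (x : R) :
  x ^+ 2 * p x <= 4 * (normal_peak 1 / normal_peak (Num.sqrt 2)) * normal_pdf 0 (Num.sqrt 2) x.
Proof.
have s0 : Num.sqrt 2 != 0 :> R by rewrite sqrtr_eq0 -ltNge.
rewrite std_normal_pdfE normal_pdfE// /normal_fun subr0 sqr_sqrtr; last exact: ler0n.
rewrite -[leRHS]mulrA -[X in _ <= 4 * X]mulrA mulKf ?gt_eqF ?normal_peak_gt0//.
rewrite mulrCA [leRHS]mulrCA ler_wpM2l ?normal_peak_ge0//.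
rewrite (_ : - x ^+ 2 / 2 = - (x ^+ 2) / (2 *+ 2) - x ^+ 2 / 4); last first.
  by rewrite -mulr_natr; field.
rewrite expRD mulrCA mulrC ler_wpM2r ?expR_ge0// expRN ler_pdivrMr ?expR_gt0//.
have := expR_ge1Dx (x ^+ 2 / 4 : R); lra.
Qed.

Lemma intgb_normal_pdf (s : R) : intgb mu (normal_pdf 0 s).
Proof. exact: integrable_normal_pdf. Qed.

Lemma intgb_sqr_std_normal : intgb mu (fun x => x ^+ 2 * p x).
Proof.
apply: (@intgb_le _ _ _ mu _ (fun x => 4 * (normal_peak 1 / normal_peak (Num.sqrt 2)) *
    normal_pdf 0 (Num.sqrt 2) x)).
- by apply: measurable_funM; [exact: measurable_funX|exact: measurable_std_normal_pdf].
- move=> x; rewrite ger0_norm; last by apply: mulr_ge0; [exact: sqr_ge0|exact: std_normal_pdf_ge0].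
  exact: std_normal_pdf_sqrM_le.
- by apply: intgbZ; exact: intgb_normal_pdf.
Qed.

Lemma intgb_id_std_normal : intgb mu (fun x => x * p x).
Proof.
apply: (intgb_le _ _ intgb_abs_std_normal).
  by apply: measurable_funM => //; exact: measurable_std_normal_pdf.
by move=> x; rewrite normrM (ger0_norm (std_normal_pdf_ge0 x)).
Qed.

Lemma Rintegral_std_normal_pdf : \int[mu]_x p x = 1.
Proof. by rewrite /Rintegral integral_normal_pdf. Qed.

Lemma Rintegral_id_std_normal : \int[mu]_x (x * p x) = 0.
Proof.
have h : \int[mu]_x (-1 * (x * p x)) = 0.
  apply: (@Rintegral_setT_derive0 _ p).
  - by move=> x; have h := is_derive_std_normal_pdf x; apply: is_derive_eq; ring.
  - move=> x; apply: cvgM; first exact: cvg_cst.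
    by apply: cvgM; [exact: cvg_id|exact: continuous_std_normal_pdf].
  - by apply: intgbZ; exact: intgb_id_std_normal.
  - exact: std_normal_pdf_cvgy.
  - exact: std_normal_pdf_cvgNy.
by move: h; rewrite RintegralZl ?mulN1r//; [move/eqP; rewrite oppr_eq0 => /eqP|exact: intgb_id_std_normal].
Qed.

Lemma normal_pdf_sqrt2E (x : R) :
  normal_pdf 0 (Num.sqrt 2) x = normal_peak (Num.sqrt 2) / normal_peak 1 * p ((Num.sqrt 2)^-1 * x).
Proof.
have s0 : Num.sqrt 2 != 0 :> R by rewrite sqrtr_eq0 -ltNge.
rewrite std_normal_pdfE mulrA divfK ?gt_eqF ?normal_peak_gt0 ?oner_neq0//.
rewrite normal_pdfE// /normal_fun subr0 exprMn exprVn sqr_sqrtr; last exact: ler0n.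
by congr (_ * expR _); rewrite -mulr_natr; field.
Qed.

(** The derivative of x p is p - x^2 p. Its decay at infinity comes from comparing [x * p x] with a
    rescaled copy of [p]. *)
Lemma Rintegral_sqr_std_normal : \int[mu]_x (x ^+ 2 * p x) = 1.
Proof.
set c := normal_peak 1 / normal_peak (Num.sqrt 2) *
  (normal_peak (Num.sqrt 2) / normal_peak (1 : R)).
have bnd x : `|x * p x| <= c * p ((Num.sqrt 2)^-1 * x).
  rewrite normrM (ger0_norm (std_normal_pdf_ge0 x)).
  by apply: le_trans (std_normal_pdf_absM_le x) _; rewrite normal_pdf_sqrt2E mulrA.
have s0 : 0 < (Num.sqrt 2)^-1 :> R by rewrite invr_gt0 sqrtr_gt0.
have h : \int[mu]_x (p x - x ^+ 2 * p x) = 0.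
  apply: (@Rintegral_setT_derive0 _ (fun x => x * p x)).
  - move=> x; have h := is_derive_std_normal_pdf x.
    by apply: is_derive_eq; rewrite /GRing.scale/=; ring.
  - move=> x; apply: cvgB; first exact: continuous_std_normal_pdf.
    by apply: cvgM; [exact: exprn_continuous|exact: continuous_std_normal_pdf].
  - by apply: intgbB; [exact: intgb_std_normal_pdf|exact: intgb_sqr_std_normal].
  - apply/norm_cvg0P; apply: (@squeeze_cvgr _ _ _ _ (cst 0) (fun x => c * p ((Num.sqrt 2)^-1 * x))).
    + by apply: nearW => x; rewrite normr_ge0 bnd.
    + exact: cvg_cst.
    + rewrite -[X in _ --> X](mulr0 c); apply: cvgM; first exact: cvg_cst.
      by apply: (cvg_comp _ _ _ std_normal_pdf_cvgy); exact: gt0_cvgMry.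
  - apply/norm_cvg0P; apply: (@squeeze_cvgr _ _ _ _ (cst 0) (fun x => c * p ((Num.sqrt 2)^-1 * x))).
    + by apply: nearW => x; rewrite normr_ge0 bnd.
    + exact: cvg_cst.
    + rewrite -[X in _ --> X](mulr0 c); apply: cvgM; first exact: cvg_cst.
      by apply: (cvg_comp _ _ _ std_normal_pdf_cvgNy); exact: gt0_cvgMrNy.
move: h; rewrite RintegralB//; last first.
- exact: intgb_sqr_std_normal.
- exact: intgb_std_normal_pdf.
by rewrite Rintegral_std_normal_pdf => /eqP; rewrite subr_eq0 => /eqP.
Qed.

Lemma Rintegral_abs_std_normal : \int[mu]_x (`|x| * p x) = 2 * normal_peak 1.
Proof.
rewrite /Rintegral ge0_symfun_integralT/=; first last.
- by move=> x; rewrite /= normrN !std_normal_pdfE sqrrN.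
- move=> x; apply: cvgM; last exact: continuous_std_normal_pdf.
  exact: norm_continuous.
- by move=> x; rewrite mulr_ge0// std_normal_pdf_ge0.
rewrite (_ : [set x | 0 <= x] = `[0, +oo[%classic); last first.
  by apply/seteqP; split => x /=; rewrite in_itv/= andbT.
rewrite (_ : (\int[mu]_(x in _) _)%E = (\int[mu]_(x in `[0%R, +oo[) (x * p x)%:E)%E); last first.
  by apply: eq_integral => x; rewrite inE/= in_itv/= andbT => x0; rewrite ger0_norm.
rewrite (@ge0_continuous_FTC2y _ _ (fun x => - p x) 0 0)//.
- by rewrite -EFinB -EFinM/= sub0r opprK std_normal_pdfE expr0n/= oppr0 mul0r expR0 mulr1.
- by move=> x x0; rewrite mulr_ge0// std_normal_pdf_ge0.
- apply: continuous_subspaceT => x; apply: cvgM; last exact: continuous_std_normal_pdf.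
  exact: cvg_id.
- by rewrite -[X in _ --> X]oppr0; apply: cvgN; exact: std_normal_pdf_cvgy.
- by move=> x _; have h := is_derive_std_normal_pdf x; apply: derivableN; case: h.
- apply: cvg_at_right_filter; apply: cvgN; exact: continuous_std_normal_pdf.
- move=> x _; have h := is_derive_std_normal_pdf x.
  have h2 : is_derive x 1 (fun x => - p x) (x * p x).
    by apply: is_derive_eq; ring.
  by rewrite derive1E; case: h2.
Qed.

Lemma normal_prob_affine (m s : R) (A : set R) : 0 < s -> measurable A ->
  normal_prob m s A = normal_prob 0 1 ((fun y => s * y + m) @^-1` A).
Proof.
move=> s0 mA; have sn0 : s != 0 by rewrite gt_eqF.
rewrite /normal_prob integral_mkcond (ge0_integral_affine m sn0); last 2 first.
- apply/(measurable_restrictT _ _).1 => //; apply/measurable_funTS/measurable_EFinP.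
  exact: measurable_normal_pdf.
- by move=> x; rewrite erestrict_ge0// => y _; rewrite lee_fin normal_pdf_ge0.
rewrite -ge0_integralZl//; last 2 first.
- apply: (@measurableT_comp _ _ _ _ _ _ ((fun x => (normal_pdf m s x)%:E) \_ A)).
    apply/(measurable_restrictT _ _).1 => //; apply/measurable_funTS/measurable_EFinP.
    exact: measurable_normal_pdf.
  by apply: measurable_funD => //; exact: measurable_funM.
- by move=> x _; rewrite erestrict_ge0// => y _; rewrite lee_fin normal_pdf_ge0.
rewrite [RHS]integral_mkcond; apply: eq_integral => x _.
rewrite !patchE.
have -> : (x \in (fun y => s * y + m) @^-1` A) = (s * x + m \in A).
  by apply/idP/idP; rewrite !inE.
case: ifPn => _; last by rewrite mule0.
rewrite -EFinM; congr EFin; rewrite gtr0_norm// std_normal_pdfE normal_pdfE// mulrA.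
congr (_ * _).
  rewrite /normal_peak expr1n mul1r -mulrnAr sqrtrM ?sqr_ge0// sqrtr_sqr gtr0_norm//.
  by rewrite invfM mulrA mulfV ?mul1r.
rewrite /normal_fun addrK; congr expR; rewrite -mulr_natr; field.
by rewrite gt_eqF.
Qed.

End normal_moments.

Section gaussian_law.
Context {d} {T : measurableType d} {R : realType} (P : probability T R).
Local Notation mu := (@lebesgue_measure R).
Local Notation p := (normal_pdf (0 : R) 1).
Variable Y : T -> R.
Hypothesis mY : measurable_fun setT Y.

Lemma normal_law_integral (m s : R) : 0 < s ->
  (forall A, measurable A -> P (Y @^-1` A) = normal_prob m s A) ->
  forall f : R -> R, measurable_fun setT f ->
  (intgb mu (fun y => f (s * y + m) * p y) -> intgb P (f \o Y)) /\
  \int[P]_w f (Y w) = \int[mu]_y (f (s * y + m) * p y).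
Proof.
move=> s0 lawY f mf.
have mphi : measurable_fun setT (fun y : R => s * y + m).
  by apply: measurable_funD => //; exact: measurable_funM.
have mfp : measurable_fun setT (fun y => f (s * y + m)) by exact: measurableT_comp.
have law2 (A : set R) : measurable A ->
    normal_prob 0 1 ((fun y => s * y + m) @^-1` A) = normal_prob m s A.
  by move=> mA; exact/esym/normal_prob_affine.
have dens (A : set R) : measurable A ->
    normal_prob 0 1 A = (\int[mu]_(x in A) (p x)%:E)%E by [].
have mp := @measurable_std_normal_pdf R; have p0 := @std_normal_pdf_ge0 R.
split.
  move/(@intgb_density _ (measurableTypeR R) R mu (normal_prob 0 1) p mp p0 dens _ mfp).
  move/(@intgb_law _ (measurableTypeR R) R _ (measurableTypeR R)
    (normal_prob 0 1) (normal_prob m s) _ mphi law2 _ mf).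
  by move/(@intgb_law _ T R _ (measurableTypeR R) P (normal_prob m s) _ mY lawY _ mf).
rewrite -(@Rintegral_law _ T R _ (measurableTypeR R) P (normal_prob m s) _ mY lawY _ mf).
rewrite (@Rintegral_law _ (measurableTypeR R) R _ (measurableTypeR R)
  (normal_prob 0 1) (normal_prob m s) _ mphi law2 _ mf).
by rewrite (@Rintegral_density _ (measurableTypeR R) R mu (normal_prob 0 1) p mp p0 dens _ mfp).
Qed.

Hypothesis gY : gaussian_rv P Y.

(** One formula covers both cases of a Gaussian law: for [s = 0] the right side is [f m] times the
    total mass of the density, which is the integral against the Dirac mass at [m]. *)
Lemma gaussian_rv_integral : exists m s : R, [/\ 0 <= s,
  (forall A, measurable A -> P (Y @^-1` A) = if s == 0 then \d_m A else normal_prob m s A) &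
  forall f : R -> R, measurable_fun setT f ->
  (intgb mu (fun y => f (s * y + m) * p y) -> intgb P (f \o Y)) /\
  \int[P]_w f (Y w) = \int[mu]_y (f (s * y + m) * p y)].
Proof.
have [m [s [s0 lawY]]] := gY; exists m, s; split => // f mf.
have [sE|sn0] := eqVneq s 0; last first.
  apply: normal_law_integral => //; first by rewrite lt_neqAle eq_sym sn0.
  by move=> A mA; rewrite lawY// (negbTE sn0).
rewrite sE eqxx in lawY; rewrite sE.
split.
  move=> _; apply/(intgb_law mY lawY mf)/integrableP; split.
    exact/measurable_EFinP.
  rewrite integral_dirac//; last by apply: measurableT_comp => //; exact/measurable_EFinP.
  by rewrite diracT mul1e ltry.
rewrite -(Rintegral_law mY lawY mf) {1}/Rintegral integral_dirac//; last exact/measurable_EFinP.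
rewrite diracT mul1e /=.
under eq_Rintegral do rewrite mul0r add0r.
by rewrite RintegralZl ?Rintegral_std_normal_pdf ?mulr1//; exact: intgb_std_normal_pdf.
Qed.

Lemma gaussian_rv_sqint : sqint P Y.
Proof.
have [m [s [s0 _ H]]] := gaussian_rv_integral; split => //.
have [+ _] := H (fun x => x ^+ 2) (measurable_funX 2 (@measurable_id _ _ setT)); apply.
rewrite (_ : (fun y => _) = fun y => s ^+ 2 * (y ^+ 2 * p y) + (2 * s * m * (y * p y) + m ^+ 2 * p y)).
  by do 2 (try apply: intgbD); apply: intgbZ; [exact: intgb_sqr_std_normal|
    exact: intgb_id_std_normal|exact: intgb_std_normal_pdf].
by apply/funext => y; ring.
Qed.

Lemma gaussian_rv_centered : \int[P]_w Y w = 0 -> exists s : R, [/\ 0 <= s,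
  (s != 0 -> forall A, measurable A -> P (Y @^-1` A) = normal_prob 0 s A),
  \int[P]_w Y w ^+ 2 = s ^+ 2,
  \int[P]_w `|Y w| = s * (2 * normal_peak 1) &
  forall t th, \int[P]_w cos (t * Y w + th) = cos th * expR (- (s ^+ 2 * t ^+ 2) / 2)].
Proof.
have [m [s [s0 law H]]] := gaussian_rv_integral => EY0.
have i0 := @intgb_std_normal_pdf R; have i1 := @intgb_id_std_normal R.
have i2 := @intgb_sqr_std_normal R.
have m0 : m = 0.
  have [_] := H idfun (@measurable_id _ _ _); rewrite EY0 /=.
  rewrite (_ : (fun y => _) = fun y => s * (y * p y) + m * p y); last first.
    by apply/funext => y; ring.
  rewrite RintegralD//; [|exact: intgbZ|exact: intgbZ].
  by rewrite !RintegralZl// Rintegral_id_std_normal Rintegral_std_normal_pdf; lra.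
rewrite m0 in law H; exists s; split => //.
- by move=> sn0 A mA; rewrite law// (negbTE sn0).
- have [_ ->] := H (fun x => x ^+ 2) (measurable_funX 2 (@measurable_id _ _ setT)).
  rewrite (_ : (fun y => _) = fun y => s ^+ 2 * (y ^+ 2 * p y)); last first.
    by apply/funext => y; ring.
  by rewrite RintegralZl// Rintegral_sqr_std_normal mulr1.
- have [_ ->] := H _ (@normr_measurable R setT).
  rewrite (_ : (fun y => _) = fun y => s * (`|y| * p y)); last first.
    by apply/funext => y; rewrite addr0 normrM (ger0_norm s0) mulrA.
  by rewrite RintegralZl ?Rintegral_abs_std_normal//; exact: intgb_abs_std_normal.
- move=> t th; have [|_ ->] := H (fun x => cos (t * x + th)).
    by apply: continuous_measurable_fun; exact: continuous_cos_affine.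
  rewrite (_ : (fun y => _) = fun y => cos (t * s * y + th) * p y); last first.
    by apply/funext => y; rewrite addr0 mulrA.
  rewrite Rintegral_cos_std_normal_pdf; congr (_ * expR _); ring.
Qed.

End gaussian_law.

(** * Signs of Gaussian variables *)

Section sine_polynomials.
Context {R : realType}.
Implicit Types f g : R -> R.

(** Odd trigonometric sums with arbitrary real frequencies. *)
Definition sinpoly f := exists c : seq (R * R),
  forall x, f x = \sum_(p <- c) p.1 * sin (p.2 * x).

Lemma sinpolyD f g : sinpoly f -> sinpoly g -> sinpoly (fun x => f x + g x).
Proof.
by move=> [c fc] [e ge]; exists (c ++ e) => x; rewrite fc ge big_cat.
Qed.

Lemma sinpolyZ k f : sinpoly f -> sinpoly (fun x => k * f x).
Proof.
move=> [c fc]; exists [seq (k * p.1, p.2) | p <- c] => x.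
by rewrite fc big_map mulr_sumr; apply: eq_bigr => p _; rewrite mulrA.
Qed.

Lemma sinpoly_sum I (s : seq I) (h : I -> R -> R) : (forall i, sinpoly (h i)) ->
  sinpoly (fun x => \sum_(i <- s) h i x).
Proof.
move=> sh; elim: s => [|i s IH].
  by exists [::] => x; rewrite !big_nil.
have [c E] := sinpolyD (sh i) IH.
by exists c => x; rewrite big_cons E.
Qed.

Lemma sinpoly_sin (a : R) : sinpoly (fun x => sin (a * x)).
Proof. by exists [:: (1, a)] => x; rewrite big_seq1 mul1r. Qed.

(** A product of three sines is again a sum of sines, whereas a product of two is a sum of cosines.
    This is why the polynomial iterated below is odd. *)
Lemma sin3E (a b c : R) : sin a * sin b * sin c =
  4^-1 * (sin (a + b - c) + sin (a - b + c) + sin (- a + b + c) - sin (a + b + c)).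
Proof.
by rewrite !(sinD, sinB, cosD, cosB, cosN, sinN); field.
Qed.

Lemma sinpoly_cube f : sinpoly f -> sinpoly (fun x => f x ^+ 3).
Proof.
move=> [c fc].
have E x : f x ^+ 3 = \sum_(p <- c) \sum_(q <- c) \sum_(s <- c)
    (p.1 * q.1 * s.1) * (sin (p.2 * x) * sin (q.2 * x) * sin (s.2 * x)).
  rewrite fc exprS expr2 mulr_suml; apply: eq_bigr => p _.
  rewrite big_distrlr/= mulr_sumr; apply: eq_bigr => q _.
  by rewrite mulr_sumr; apply: eq_bigr => s _; ring.
have [e He] : sinpoly (fun x => \sum_(p <- c) \sum_(q <- c) \sum_(s <- c)
    (p.1 * q.1 * s.1) * (sin (p.2 * x) * sin (q.2 * x) * sin (s.2 * x))).
  apply: sinpoly_sum => p; apply: sinpoly_sum => q; apply: sinpoly_sum => s.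
  apply: sinpolyZ; exists [:: (4^-1, p.2 + q.2 - s.2); (4^-1, p.2 - q.2 + s.2);
    (4^-1, - p.2 + q.2 + s.2); (- 4^-1, p.2 + q.2 + s.2)] => x.
  rewrite !big_cons big_nil /= sin3E !mulrDl !mulNr; ring.
by exists e => x; rewrite E He.
Qed.

(** The cubic of the Newton-Schulz iteration for the sign: it is odd, fixes -1, 0 and 1, and has its
    critical points at -1 and 1, which makes these two attracting. *)
Let phi (y : R) := (3 * y - y ^+ 3) / 2.

Lemma phi_iter_bounded k y : `|y| <= 1 -> `|iter k phi y| <= 1.
Proof.
move=> y1; elim: k => //= k; set z := iter _ _ _; rewrite !ler_norml => /andP[z1 z2].
rewrite /phi; apply/andP; split.
  (* The product is [2 * (1 + phi z)], with its double zero at -1; the case of 1 is symmetric. *)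
  have : 0 <= (1 + z) ^+ 2 * (2 - z) by rewrite mulr_ge0 ?sqr_ge0//; lra.
  rewrite (_ : (1 + z) ^+ 2 * (2 - z) = 2 + 3 * z - z ^+ 3); last by ring.
  lra.
have : 0 <= (1 - z) ^+ 2 * (2 + z) by rewrite mulr_ge0 ?sqr_ge0//; lra.
rewrite (_ : (1 - z) ^+ 2 * (2 + z) = 2 - 3 * z + z ^+ 3); last by ring.
lra.
Qed.

Lemma phi_iterN k y : iter k phi (- y) = - iter k phi y.
Proof. by elim: k => //= k ->; rewrite /phi; field. Qed.

(** From 1 - phi z = (1 - z) (1 - z / 2 - z^2 / 2), each iterate multiplies the distance to 1 by at
    most 1 - z / 2 <= 1 - y / 2, as the iterates never fall below [y]. *)
Lemma phi_iter_gt0 k y : 0 < y <= 1 ->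
  y <= iter k phi y <= 1 /\ 1 - iter k phi y <= (1 - y / 2) ^+ k.
Proof.
move=> /andP[y0 y1]; elim: k => [|k [/andP[]]] /=.
  by rewrite lexx y1 expr0; split => //; lra.
set z := iter _ _ _ => z1 z2 IH.
have E : 1 - phi z = (1 - z) * (1 - z / 2 - z ^+ 2 / 2) by rewrite /phi; field.
have zq : 0 <= z ^+ 2 by exact: sqr_ge0.
have F : 1 - phi z <= (1 - y / 2) * (1 - z).
  by rewrite E mulrC ler_wpM2r//; [lra|lra].
split; last by rewrite exprS; apply: le_trans F _; rewrite ler_wpM2l//; lra.
apply/andP; split; last first.
  by rewrite -subr_ge0 E; apply: mulr_ge0; nra.
rewrite (le_trans z1)// -subr_ge0 (_ : _ - _ = z * (1 - z) * (1 + z) / 2); last first.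
  by rewrite /phi; field.
by rewrite divr_ge0// !mulr_ge0//; lra.
Qed.

Lemma phi_iter_cvg_gt0 y : 0 < y <= 1 -> iter k phi y @[k --> \oo] --> (1 : R).
Proof.
move=> y01; have /andP[y0 y1] := y01.
have g0 : (1 - y / 2) ^+ k @[k --> \oo] --> (0 : R).
  by apply: cvg_expr; rewrite ltr_norml; apply/andP; split; lra.
apply: (@squeeze_cvgr _ _ _ _ (fun k => 1 - (1 - y / 2) ^+ k) (cst 1)).
- apply: nearW => k; have [/andP[_ ->] h] := phi_iter_gt0 k y01.
  by rewrite andbT lerBlDr -lerBlDl.
- by rewrite -[X in _ --> X]subr0; apply: cvgB => //; exact: cvg_cst.
- exact: cvg_cst.
Qed.

Lemma phi_iter_cvg y : `|y| <= 1 -> iter k phi y @[k --> \oo] --> (Num.sg y : R).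
Proof.
rewrite ler_norml => /andP[y1 y2]; have [->|y0|y0] := sgrP y.
- rewrite (_ : (fun k => _) = cst 0); first exact: cvg_cst.
  by apply/funext; elim => //= k ->; rewrite /phi expr0n/= mulr0 subr0 mul0r.
- by apply: phi_iter_cvg_gt0; rewrite y0.
- rewrite (_ : (fun k => _) = fun k => - iter k phi (- y)); last first.
    by apply/funext => k; rewrite phi_iterN opprK.
  by apply: cvgN; apply: phi_iter_cvg_gt0; rewrite oppr_gt0 y0 lerNl.
Qed.

(* The iterates of [y |-> (3 y - y^3) / 2] turn [sin (x / M)] into its sign,
   and are again sine polynomials. *)
Lemma sgr_sinpoly_ind (Pr : (R -> R) -> Prop) :
  (forall f, sinpoly f -> Pr f) ->
  (forall (f_ : nat -> R -> R) f, (forall n, Pr (f_ n)) ->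
    (forall n x, `|f_ n x| <= 1) ->
    (forall x, f_ n x @[n --> \oo] --> f x) -> Pr f) ->
  Pr (fun x => Num.sg x).
Proof.
move=> Psin Plim.
pose g (M : nat) x : R := Num.sg (sin (M.+1%:R^-1 * x)).
apply: (Plim g) => [M|M x|x].
- apply: (Plim (fun k x => iter k phi (sin (M.+1%:R^-1 * x)))) => [k|k x|x].
  + apply: Psin; elim: k => [|k IH]; first exact: sinpoly_sin.
    have [c E] := sinpolyD (sinpolyZ (3 / 2) IH) (sinpolyZ (- 2^-1) (sinpoly_cube IH)).
    by exists c => x; rewrite -E /= /phi; field.
  + by apply: phi_iter_bounded; rewrite ler_norml sin_geN1 sin_le1.
  + by apply: phi_iter_cvg; rewrite ler_norml sin_geN1 sin_le1.
- by rewrite /g; case: sgrP => _; rewrite ?normr0 ?normrN ?normr1.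
(* Once [M.+1] exceeds |x|, the argument of the sine lies in ]-1, 1[, where the sine has the sign of
   its argument. The outer limit is thus eventually constant. *)
- apply: cvg_near_cst; exists (Num.bound `|x|) => // M /= hM; rewrite /g.
  have xM : `|x| < M.+1%:R.
    by apply: lt_le_trans (archi_boundP (normr_ge0 x)) _; rewrite ler_nat leqW.
  have M0 : 0 < M.+1%:R :> R by rewrite ltr0n.
  have pi1 : 1 < pi :> R by have := @pi_ge2 R; lra.
  have [x0|x0|->] := ltrgt0P x; last by rewrite mulr0 sin0 sgr0.
  + rewrite gtr0_norm// in xM; rewrite (gtr0_sg x0); apply: gtr0_sg.
    apply: sin_gt0_pi; rewrite mulr_gt0 ?invr_gt0//= (lt_trans _ pi1)//.
    by rewrite mulrC ltr_pdivrMr// mul1r.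
  + rewrite ltr0_norm// in xM; rewrite (ltr0_sg x0); apply: ltr0_sg.
    rewrite -oppr_gt0 -sinN -mulrN; apply: sin_gt0_pi.
    rewrite mulr_gt0 ?invr_gt0 ?oppr_gt0//= (lt_trans _ pi1)//.
    by rewrite mulrC ltr_pdivrMr// mul1r.
Qed.

End sine_polynomials.

(** * Covariances of odd functions of a standard pair, from those of sines *)

Section sine_covariance.
Context {R : realType}.

Lemma abs_sin_le (y : R) : `|sin y| <= `|y|.
Proof.
have key (x : R) : 0 < x -> `|sin x| <= x.
  move=> x0; have [c _] := @MVT R sin cos 0 x x0 (fun z _ => is_derive_sin z)
    (continuous_subspaceT (fun z => @continuous_sin R z)).
  rewrite sin0 !subr0 => ->; rewrite normrM (gtr0_norm x0) ler_piMl ?(ltW x0)//.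
  exact: abs_cos_le1.
have [y0|y0|->] := ltrgt0P y; last by rewrite sin0 normr0.
  exact: key.
by rewrite -normrN -sinN; apply: key; rewrite oppr_gt0.
Qed.

(** Used to recover [y] as the limit of m sin (y / m), and the corresponding limit of [sinhR]. *)
Lemma is_derive0_cvg_seq (k : R -> R) (l : R) : is_derive (0 : R) (1 : R) k l ->
  k 0 = 0 -> n.+1%:R * k (n.+1%:R^-1) @[n --> \oo] --> l.
Proof.
move=> [dk kl] k0; move: dk; rewrite /derivable => /cvg_ex[l' cl'].
have l'l : l' = l by rewrite -kl /derive; apply/esym/cvg_lim.
rewrite l'l in cl'; move/cvgr_dnbhsP : cl' => /(_ (fun n => n.+1%:R^-1)) H.
have h0 n : 0 < n.+1%:R^-1 :> R by rewrite invr_gt0 ltr0n.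
have := H (conj (fun n => lt0r_neq0 (h0 n)) cvg_harmonic).
by under eq_fun do rewrite invrK /= addr0 k0 subr0 /GRing.scale/= mulr1.
Qed.

(** For a standard Gaussian pair of correlation r, sin (a U) and sin (b V) have covariance exp (-
    a^2 / 2) exp (- b^2 / 2) sinh (a b r). *)
Definition sinhR (y : R) := (expR y - expR (- y)) / 2.

Lemma is_derive_sinhR0 (a : R) : is_derive (0 : R) (1 : R) (fun b => sinhR (a * b)) a.
Proof.
have h (c : R) : is_derive (0 : R) (1 : R) (fun b => expR (c * b)) c.
  have g : is_derive (0 : R) (1 : R) (fun b : R => c * b) c.
    by apply: is_derive_eq; rewrite /GRing.scale/=; ring.
  have := @is_derive1_comp _ expR (fun b : R => c * b) 0 _ _ (is_derive_expR _) g.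
  by rewrite mulr0 expR0 mul1r.
have h1 := h a; have h2 := h (- a).
rewrite (_ : (fun b => _) = fun b => (expR (a * b) - expR (- a * b)) / 2); last first.
  by apply/funext => b; rewrite /sinhR mulNr.
by apply: is_derive_eq; rewrite /GRing.scale/=; field.
Qed.

(** The sum runs over all [k], with the even ones switched off, so that it is half the difference of
    two truncated exponential series of the same length. *)
Definition sinh_trunc n (y : R) := \sum_(k < n) (odd k)%:R * (k`!%:R^-1 * y ^+ k).

Lemma sinh_trunc_cvg y : sinh_trunc n y @[n --> \oo] --> sinhR y.
Proof.
have c1 : series (exp_coeff y) @ \oo --> expR y by exact: is_cvg_series_exp_coeff.
have c2 : series (exp_coeff (- y)) @ \oo --> expR (- y) by exact: is_cvg_series_exp_coeff.
rewrite (_ : (fun n => _) = fun n => (series (exp_coeff y) n - series (exp_coeff (- y)) n) / 2).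
  by apply: cvgM; [exact: cvgB|exact: cvg_cst].
apply/funext => n; rewrite /sinh_trunc /series/= -sumrB mulr_suml big_mkord.
apply: eq_bigr => k _; rewrite /exp_coeff/= exprNn -signr_odd.
by move: (y ^+ k) (k`!%:R^-1) => z c; case: (odd k); rewrite /= ?expr1 ?expr0; field.
Qed.

Context {d} {T : measurableType d} (P : probability T R).
Variables (U V : T -> R) (r : R).
Hypotheses (mU : measurable_fun setT U) (mV : measurable_fun setT V).
Hypotheses (sU : sqint P U) (sV : sqint P V).
Local Notation e a := (expR (- a ^+ 2 / 2)).
Hypothesis covUV : forall a b : R,
  \int[P]_w (sin (a * U w) * sin (b * V w)) = e a * e b * sinhR (a * b * r).
Hypothesis covUU : forall a b : R,
  \int[P]_w (sin (a * U w) * sin (b * U w)) = e a * e b * sinhR (a * b).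
Hypothesis r1 : `|r| <= 1.

Let msin (Y : T -> R) a : measurable_fun setT Y -> measurable_fun setT (fun w => sin (a * Y w)).
Proof.
move=> mY; apply: (@measurableT_comp _ _ _ _ _ _ (fun x => sin (a * x))) => //.
apply: continuous_measurable_fun => x.
by have := @continuous_sin_affine R a 0 x; under eq_fun do rewrite addr0.
Qed.

(** The variable [Y] is the limit of m sin (Y / m), dominated by |Y|. Here [q] plays the role of the
    correlation of [U] and [Y]: it is 1 for [Y = U] and [r] for [Y = V]. *)
Lemma Rintegral_sinM (Y : T -> R) (q : R) a : measurable_fun setT Y -> sqint P Y ->
  (forall b, \int[P]_w (sin (a * U w) * sin (b * Y w)) = e a * e b * sinhR (a * b * q)) ->
  \int[P]_w (sin (a * U w) * Y w) = a * e a * q.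
Proof.
move=> mY sY H.
pose f_ n w := n.+1%:R * (sin (a * U w) * sin (n.+1%:R^-1 * Y w)).
have [||||_ _ C] := @Rintegral_dominated_cvg _ _ _ P f_ (fun w => sin (a * U w) * Y w)
    (fun w => `|Y w|).
- by move=> n; apply: measurable_funM => //; apply: measurable_funM; exact: msin.
- by apply: intgb_norm; exact: sqint_intgb.
- move=> n w; rewrite /f_ !normrM mulrCA.
  have -> : `|Y w| = 1 * (`|n.+1%:R| * `|n.+1%:R^-1 * Y w|).
    by rewrite mul1r -normrM mulVKf ?pnatr_eq0.
  rewrite ler_pM ?mulr_ge0//; first exact: abs_sin_le1.
  by rewrite ler_wpM2l// abs_sin_le.
- move=> w; rewrite /f_; under eq_fun do rewrite mulrCA.
  apply: cvgM; first exact: cvg_cst.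
  under eq_fun do rewrite (mulrC _ (Y w)) -[Y w * _]addr0.
  apply: (@is_derive0_cvg_seq (fun b => sin (Y w * b + 0))); last by rewrite mulr0 addr0 sin0.
  have := is_derive_sin_affine (Y w) 0 0.
  by rewrite mulr0 addr0 cos0 mulr1.
apply/esym/(cvg_unique _ _ C) => //.
rewrite (_ : (fun n => _) = fun n => e a * (e (n.+1%:R^-1 : R) *
    (n.+1%:R * sinhR (a * q * n.+1%:R^-1)))); last first.
  apply/funext => n; rewrite /f_ RintegralZl//; last first.
    apply: (@intgb_bounded _ _ _ _ _ 1); first by apply: measurable_funM; exact: msin.
    by move=> w; rewrite normrM mulr_ile1// abs_sin_le1.
  by rewrite H [a * _ * q]mulrAC; ring.
rewrite (_ : a * e a * q = e a * (1 * (a * q))); last by ring.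
apply: cvgM; first exact: cvg_cst.
apply: cvgM; last first.
  have := @is_derive0_cvg_seq (fun b => sinhR (a * q * b)) _ (is_derive_sinhR0 (a * q)).
  by rewrite mulr0 /sinhR oppr0 subrr mul0r; apply.
have c : {for 0, continuous (fun x : R => e x)}.
  rewrite (_ : (fun x : R => e x) = fun x : R => (normal_peak 1)^-1 * normal_pdf 0 1 x).
    by apply: cvgM; [exact: cvg_cst|exact: continuous_std_normal_pdf].
  apply/funext => x; rewrite std_normal_pdfE mulKf//.
  by rewrite gt_eqF// normal_peak_gt0 ?oner_neq0.
have := cvg_comp _ _ cvg_harmonic c; rewrite /= expr0n oppr0 mul0r expR0; apply.
Qed.

Lemma sinpoly_measurable (f : R -> R) : sinpoly f -> measurable_fun setT f.
Proof.
move=> [c fc]; rewrite (_ : f = fun x : R => \sum_(p <- c) p.1 * sin (p.2 * x + 0)).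
  apply: measurable_sum => p; apply: measurable_funM => //.
  by apply: continuous_measurable_fun; exact: continuous_sin_affine.
by apply/funext => x; rewrite fc; apply: eq_bigr => p _; rewrite addr0.
Qed.

Lemma intgb_sinM (Y : T -> R) a : sqint P Y -> intgb P (fun w => sin (a * U w) * Y w).
Proof.
move=> sY; apply: sqintM => //; apply: (@sqint_bounded _ _ _ _ _ 1).
  exact: msin.
by move=> w; exact: abs_sin_le1.
Qed.

Lemma intgb_sin_sin (Y : T -> R) a b : measurable_fun setT Y ->
  intgb P (fun w => sin (a * U w) * sin (b * Y w)).
Proof.
move=> mY; apply: intgb_sinM; apply: (@sqint_bounded _ _ _ _ _ 1); first exact: msin.
by move=> w; exact: abs_sin_le1.
Qed.

Lemma Rintegral_sinpolyM c (Y : T -> R) q : measurable_fun setT Y -> sqint P Y ->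
  (forall a b, \int[P]_w (sin (a * U w) * sin (b * Y w)) = e a * e b * sinhR (a * b * q)) ->
  \int[P]_w ((\sum_(p <- c) p.1 * sin (p.2 * U w)) * Y w) =
  q * \sum_(p <- c) p.1 * (p.2 * e p.2).
Proof.
move=> mY sY H; under eq_Rintegral do rewrite mulr_suml.
rewrite Rintegral_sum; last first.
  move=> p; under [X in intgb _ X]eq_fun do rewrite -mulrA.
  by apply: intgbZ; exact: intgb_sinM.
rewrite mulr_sumr; apply: eq_bigr => p _.
under eq_Rintegral do rewrite -mulrA.
rewrite RintegralZl//; last exact: intgb_sinM.
by rewrite (Rintegral_sinM mY sY (H p.2)); ring.
Qed.

Lemma Rintegral_sinpoly2 c (Y : T -> R) q : measurable_fun setT Y ->
  (forall a b, \int[P]_w (sin (a * U w) * sin (b * Y w)) = e a * e b * sinhR (a * b * q)) ->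
  \int[P]_w ((\sum_(p <- c) p.1 * sin (p.2 * U w)) * (\sum_(p <- c) p.1 * sin (p.2 * Y w))) =
  \sum_(p <- c) \sum_(s <- c) p.1 * s.1 * (e p.2 * e s.2 * sinhR (p.2 * s.2 * q)).
Proof.
move=> mY H; under eq_Rintegral do rewrite big_distrlr/=.
have ii (p s : R * R) : intgb P
    (fun w => p.1 * sin (p.2 * U w) * (s.1 * sin (s.2 * Y w))).
  under [X in intgb _ X]eq_fun do rewrite mulrACA.
  by apply: intgbZ; exact: intgb_sin_sin.
rewrite Rintegral_sum; last by move=> p; apply: intgb_sum => s.
apply: eq_bigr => p _; rewrite Rintegral_sum//; apply: eq_bigr => s _.
under eq_Rintegral do rewrite mulrACA.
by rewrite RintegralZl ?H//; exact: intgb_sin_sin.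
Qed.

(** In Hermite terms, an odd [f] has no component of degree 0 or 2, so beyond the linear part the
    covariance is of order |r|^3. The three clauses are grouped because together they are stable
    under bounded pointwise limits. *)
Let cov_le (f : R -> R) := [/\ measurable_fun setT f,
  \int[P]_w (f (U w) * V w) = r * \int[P]_w (f (U w) * U w) &
  `|\int[P]_w (f (U w) * f (V w)) - r * (\int[P]_w (f (U w) * U w)) ^+ 2| <=
    `|r| ^+ 3 * \int[P]_w (f (U w) * f (U w))].

Lemma cvg_sum_seq I (s : seq I) (h : nat -> I -> R) (l : I -> R) :
  (forall i, h n i @[n --> \oo] --> l i) ->
  \sum_(i <- s) h n i @[n --> \oo] --> \sum_(i <- s) l i.
Proof.
move=> hl; elim: s => [|i s IH].
  by rewrite big_nil; under eq_fun do rewrite big_nil; exact: cvg_cst.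
by rewrite big_cons; under eq_fun do rewrite big_cons; exact: cvgD.
Qed.

(** Expanding [sinhR] writes the covariance as the sum over odd k of r^k S_k^2 / k!. The term k = 1
    is the one subtracted. For k >= 3 one has |r|^k <= |r|^3, and the remaining terms are dominated
    by those of the same series at r = 1, which are nonnegative and sum to the second moment of
    f(U). *)
Lemma sinpoly_cov_le f : sinpoly f -> cov_le f.
Proof.
move=> sf; have mf := sinpoly_measurable sf; have [c fc] := sf.
have {}fc : f = fun x => \sum_(p <- c) p.1 * sin (p.2 * x) by apply/funext.
(* For odd k this is, up to sign, the k-th Hermite coefficient of [f]. *)
pose S k := \sum_(p <- c) p.1 * (e p.2 * p.2 ^+ k).
have covUU1 a b : \int[P]_w (sin (a * U w) * sin (b * U w)) =
    e a * e b * sinhR (a * b * 1) by rewrite mulr1.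
have EU : \int[P]_w (f (U w) * U w) = S 1%N.
  rewrite fc (Rintegral_sinpolyM c mU sU covUU1) mul1r.
  by apply: eq_bigr => p _; rewrite expr1 (mulrC p.2).
have EV : \int[P]_w (f (U w) * V w) = r * S 1%N.
  rewrite fc (Rintegral_sinpolyM c mV sV covUV); congr (_ * _).
  by apply: eq_bigr => p _; rewrite expr1 (mulrC p.2).
pose Q n (q : R) := \sum_(p <- c) \sum_(s <- c)
  p.1 * s.1 * (e p.2 * e s.2 * sinh_trunc n (p.2 * s.2 * q)).
have QE n q : Q n q = \sum_(k < n) (odd k)%:R * (k`!%:R^-1 * q ^+ k * S k ^+ 2).
  under [RHS]eq_bigr => k _.
    rewrite expr2 /S big_distrlr/= mulrA mulr_sumr.
    under eq_bigr => p _ do rewrite mulr_sumr.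
    over.
  rewrite exchange_big; apply: eq_bigr => p _; rewrite exchange_big; apply: eq_bigr => s _.
  rewrite /sinh_trunc !mulr_sumr; apply: eq_bigr => k _; rewrite !exprMn; ring.
have Qc q : Q n q @[n --> \oo] --> \sum_(p <- c) \sum_(s <- c)
    p.1 * s.1 * (e p.2 * e s.2 * sinhR (p.2 * s.2 * q)).
  apply: cvg_sum_seq => p; apply: cvg_sum_seq => s.
  apply: cvgM; first exact: cvg_cst.
  by apply: cvgM; [exact: cvg_cst|exact: sinh_trunc_cvg].
have := Qc r; rewrite -(Rintegral_sinpoly2 c mV covUV) => cV.
have := Qc 1; rewrite -(Rintegral_sinpoly2 c mU covUU1) => cU.
split => //; first by rewrite EV EU.
rewrite EU.
have cL : `|Q n r - r * S 1%N ^+ 2| @[n --> \oo] -->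
    `|\int[P]_w (f (U w) * f (V w)) - r * S 1%N ^+ 2|.
  by apply: cvg_norm; apply: cvgB; [rewrite fc|exact: cvg_cst].
have cR : `|r| ^+ 3 * Q n 1 @[n --> \oo] --> `|r| ^+ 3 * \int[P]_w (f (U w) * f (U w)).
  by apply: cvgM; [exact: cvg_cst|rewrite fc].
(* From two terms on, the truncation contains k = 1, the term that has to cancel. *)
apply: (ler_cvg_to cL cR); exists 2%N => // n /= n2.
case: n n2 => // -[//|n] _; rewrite !QE !big_ord_recl/=.
rewrite !mul0r !add0r !mul1r (_ : bump 0 0 = 1%N)// factS fact0 mul1n invr1 !mul1r !expr1.
rewrite addrAC subrr add0r mulrDr.
apply: le_trans (ler_norm_sum _ _ _) _; apply: ler_wpDl.
  by apply: mulr_ge0; [exact: exprn_ge0|exact: sqr_ge0].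
rewrite mulr_sumr; apply: ler_sum => k _; rewrite add0n negbK /bump/= !add1n.
case ok : (odd _); last by rewrite !mul0r normr0 mulr0.
rewrite !mul1r expr1n mulr1; move: (sqr_ge0 (S k.+2)) => /=.
move: (S k.+2 ^+ 2) => z z0; have c0 : 0 <= k.+2`!%:R^-1 :> R by rewrite invr_ge0.
move: (k.+2`!%:R^-1) c0 => c0' c0; rewrite normrM normrM normrX (ger0_norm c0) (ger0_norm z0) mulrAC [leRHS]mulrC.
rewrite ler_wpM2l ?mulr_ge0//.
have k1 : (0 < k)%N by move: ok; case: (nat_of_ord k).
rewrite -(subnK (_ : 3 <= k.+2)%N)// exprD ler_piMl ?exprn_ge0//.
by rewrite exprn_ile1.
Qed.

(** The clauses pass to the limit by dominated convergence, with |Y| as dominating function when one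
    factor is unbounded and 1 otherwise. *)
Lemma sgr_cov_le : cov_le (fun x => Num.sg x).
Proof.
apply: sgr_sinpoly_ind; first exact: sinpoly_cov_le.
move=> f_ f Hf f1 fc.
have mf_ n : measurable_fun setT (f_ n) by case: (Hf n).
have mf : measurable_fun setT f by apply: (measurable_fun_cvg mf_) => x _; exact: fc.
have mfU n : measurable_fun setT (fun w => f_ n (U w)).
  by apply: (@measurableT_comp _ _ _ _ _ _ (f_ n)).
have mfV n : measurable_fun setT (fun w => f_ n (V w)).
  by apply: (@measurableT_comp _ _ _ _ _ _ (f_ n)).
have c1 (Y : T -> R) : sqint P Y -> measurable_fun setT Y ->
    \int[P]_w (f_ n (U w) * Y w) @[n --> \oo] --> \int[P]_w (f (U w) * Y w).
  move=> sY mY.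
  have [||||//] := @Rintegral_dominated_cvg _ _ _ P (fun n w => f_ n (U w) * Y w)
      (fun w => f (U w) * Y w) (fun w => `|Y w|).
  - by move=> n; exact: measurable_funM.
  - by apply: intgb_norm; exact: sqint_intgb.
  - by move=> n w; rewrite normrM ler_piMl.
  - by move=> w; apply: cvgM; [exact: fc|exact: cvg_cst].
have c2 (Y : T -> R) : measurable_fun setT Y ->
    \int[P]_w (f_ n (U w) * f_ n (Y w)) @[n --> \oo] --> \int[P]_w (f (U w) * f (Y w)).
  move=> mY.
  have [||||//] := @Rintegral_dominated_cvg _ _ _ P (fun n w => f_ n (U w) * f_ n (Y w))
      (fun w => f (U w) * f (Y w)) (fun _ => 1).
  - move=> n; apply: measurable_funM => //.
    by apply: (@measurableT_comp _ _ _ _ _ _ (f_ n)).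
  - exact: intgb_cst.
  - by move=> n w; rewrite normrM mulr_ile1.
  - by move=> w; apply: cvgM; exact: fc.
split => //.
  apply: (cvg_unique _ (c1 V sV mV)) => //.
  rewrite (_ : (fun n => _) = fun n => r * \int[P]_w (f_ n (U w) * U w)); last first.
    by apply/funext => n; case: (Hf n).
  by apply: cvgM; [exact: cvg_cst|exact: c1].
have cL : `|\int[P]_w (f_ n (U w) * f_ n (V w)) - r * (\int[P]_w (f_ n (U w) * U w)) ^+ 2|
    @[n --> \oo] --> `|\int[P]_w (f (U w) * f (V w)) - r * (\int[P]_w (f (U w) * U w)) ^+ 2|.
  apply: cvg_norm; apply: cvgB; first exact: c2.
  apply: cvgM; first exact: cvg_cst.
  by apply: cvgM; exact: c1.
have cR : `|r| ^+ 3 * \int[P]_w (f_ n (U w) * f_ n (U w)) @[n --> \oo] -->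
    `|r| ^+ 3 * \int[P]_w (f (U w) * f (U w)).
  by apply: cvgM; [exact: cvg_cst|exact: c2].
by apply: (ler_cvg_to cL cR); apply: nearW => n; case: (Hf n).
Qed.

(** For the sign, f(U) U is |U| and f(U)^2 is at most 1. The cubic bound is weakened to the square,
    which suffices below. *)
Lemma sgr_cov : \int[P]_w (Num.sg (U w) * V w) = r * \int[P]_w `|U w| /\
  `|\int[P]_w (Num.sg (U w) * Num.sg (V w)) - r * (\int[P]_w `|U w|) ^+ 2| <= r ^+ 2.
Proof.
have [msg E1 E2] := sgr_cov_le.
have EU : \int[P]_w (Num.sg (U w) * U w) = \int[P]_w `|U w|.
  by apply: eq_Rintegral => w _; rewrite -normrEsg.
rewrite E1 EU; split => //; rewrite EU in E2; apply: le_trans E2 _.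
have h : \int[P]_w (Num.sg (U w) * Num.sg (U w)) <= 1.
  rewrite -[leRHS](Rintegral_prob_cst P); apply: le_Rintegral => //.
  - apply: (@intgb_bounded _ _ _ _ _ 1).
      by apply: measurable_funM; apply: measurableT_comp.
    by move=> w; rewrite normrM; case: sgrP => _; rewrite ?normr0 ?normrN ?normr1 ?mulr0 ?mulr1.
  - exact: intgb_cst.
  - by move=> w _; case: sgrP => _; rewrite ?mulr0 ?mulrNN ?mulr1.
have -> : r ^+ 2 = `|r| ^+ 2 * 1 by rewrite real_normK ?num_real// mulr1.
apply: ler_pM => //; rewrite ?exprn_ge0//.
  by apply: Rintegral_ge0 => w _; case: sgrP => _; rewrite ?mulr0 ?mulrNN ?mulr1.
by rewrite exprSr ler_piMr// exprn_ge0.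
Qed.

End sine_covariance.

Lemma measurable_sgr {R : realType} : measurable_fun setT (@Num.sg R).
Proof.
apply: (@sgr_sinpoly_ind R (fun f => measurable_fun setT f)).
  by move=> f; exact: sinpoly_measurable.
by move=> f_ f mf _ ff; apply: (measurable_fun_cvg mf) => x _; exact: ff.
Qed.

Section gaussian_pairs.
Context {d} {T : measurableType d} {R : realType} (P : probability T R).

(** Only the laws of a W + b W' enter: their cosine integrals are known from the variances, and a
    product of sines is half a difference of cosines. Dividing by [t] and [t'] reduces to a standard
    pair. Correlations 1 and -1 are allowed. *)
Lemma gaussian_pair_sgr (W W' : T -> R) (t t' : R) :
  measurable_fun setT W -> measurable_fun setT W' ->
  (forall a b, gaussian_rv P (fun w => a * W w + b * W' w)) ->
  \int[P]_w W w = 0 -> \int[P]_w W' w = 0 -> 0 < t -> 0 < t' ->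
  \int[P]_w W w ^+ 2 = t ^+ 2 -> \int[P]_w W' w ^+ 2 = t' ^+ 2 ->
  let k : R := 2 * normal_peak 1 in let c := \int[P]_w (W w * W' w) in
  \int[P]_w (Num.sg (W w) * W' w) = k * (c / t) /\
  `|\int[P]_w (Num.sg (W w) * Num.sg (W' w)) - k ^+ 2 * (c / (t * t'))| <=
    (c / (t * t')) ^+ 2.
Proof.
move=> mW mW' G W0 W'0 t0 t'0 Wt W't' k c.
have tn : t != 0 by rewrite gt_eqF.
have t'n : t' != 0 by rewrite gt_eqF.
have gW : gaussian_rv P W.
  have := G 1 0; rewrite (_ : (fun w => _) = W)//.
  by apply/funext => w; rewrite mul1r mul0r addr0.
have gW' : gaussian_rv P W'.
  have := G 0 1; rewrite (_ : (fun w => _) = W')//.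
  by apply/funext => w; rewrite mul1r mul0r add0r.
have sW := gaussian_rv_sqint mW gW; have sW' := gaussian_rv_sqint mW' gW'.
have [s [s0 _ Ws Wabs _]] := gaussian_rv_centered mW gW W0.
have st : s = t by apply/eqP; rewrite -(@eqrXn2 _ 2)// ?ltW// -Ws Wt.
have iW := sqint_intgb sW; have iW' := sqint_intgb sW'; have iWW' := sqintM sW sW'.
have lincos a b : \int[P]_w cos (a * W w + b * W' w) =
    expR (- (a ^+ 2 * t ^+ 2 + 2 * a * b * c + b ^+ 2 * t' ^+ 2) / 2).
  have mY : measurable_fun setT (fun w => a * W w + b * W' w).
    by apply: measurable_funD; exact: measurable_funM.
  have EY : \int[P]_w (a * W w + b * W' w) = 0.
    rewrite RintegralD//; [|exact: intgbZ|exact: intgbZ].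
    by rewrite !RintegralZl// W0 W'0 !mulr0 addr0.
  have [s' [_ _ + _ /(_ 1 0)]] := gaussian_rv_centered mY (G a b) EY.
  have -> : \int[P]_w (a * W w + b * W' w) ^+ 2 =
      a ^+ 2 * t ^+ 2 + 2 * a * b * c + b ^+ 2 * t' ^+ 2.
    rewrite (_ : (fun w => _) = fun w => a ^+ 2 * W w ^+ 2 +
       (2 * a * b * (W w * W' w) + b ^+ 2 * W' w ^+ 2)); last first.
      by apply/funext => w; ring.
    have [_ i1] := sW; have [_ i2] := sW'.
    rewrite RintegralD//; [|exact: intgbZ|by apply: intgbD; exact: intgbZ].
    rewrite RintegralD//; [|exact: intgbZ|exact: intgbZ].
    by rewrite !RintegralZl// Wt W't' addrA.
  move=> ->; rewrite cos0 mul1r expr1n mulr1 => <-.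
  by apply: eq_Rintegral => w _; rewrite mul1r addr0.
pose U w := t^-1 * W w; pose V w := t'^-1 * W' w; pose r := c / (t * t').
have mU : measurable_fun setT U by exact: measurable_funM.
have mV : measurable_fun setT V by exact: measurable_funM.
have sU : sqint P U by exact: sqintZ.
have sV : sqint P V by exact: sqintZ.
have mcos a b : measurable_fun setT (fun w => cos (a * W w + b * W' w)).
  apply: (@measurableT_comp _ _ _ _ _ _ cos); first by apply: continuous_measurable_fun; exact: continuous_cos.
  by apply: measurable_funD; exact: measurable_funM.
have icos a b : intgb P (fun w => cos (a * W w + b * W' w)).
  by apply: (@intgb_bounded _ _ _ _ _ 1) => // w; exact: abs_cos_le1.
have prodE (a b : R) (x y : R) : sin x * sin y = 2^-1 * (cos (x - y) - cos (x + y)).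
  by rewrite cosB cosD; field.
have cUV a b : \int[P]_w (sin (a * U w) * sin (b * V w)) =
    expR (- a ^+ 2 / 2) * expR (- b ^+ 2 / 2) * sinhR (a * b * r).
  rewrite (_ : (fun w => _) = fun w => 2^-1 *
      (cos (a / t * W w + - (b / t') * W' w) - cos (a / t * W w + b / t' * W' w))); last first.
    by apply/funext => w; rewrite prodE// /U /V mulNr !mulrA.
  rewrite RintegralZl ?RintegralB ?lincos//; last exact: intgbB.
  rewrite /sinhR -expRD [LHS]mulrC [RHS]mulrA; congr (_ / 2).
    rewrite mulrBr -!expRD; congr (expR _ - expR _); rewrite /r; field; rewrite tn t'n//.
have cUU a b : \int[P]_w (sin (a * U w) * sin (b * U w)) =
    expR (- a ^+ 2 / 2) * expR (- b ^+ 2 / 2) * sinhR (a * b).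
  rewrite (_ : (fun w => _) = fun w => 2^-1 *
      (cos ((a - b) / t * W w + 0 * W' w) - cos ((a + b) / t * W w + 0 * W' w))); last first.
    apply/funext => w; rewrite prodE// /U !mul0r !addr0.
    by congr (_ * (cos _ - cos _)); ring.
  rewrite RintegralZl ?RintegralB ?lincos//; last exact: intgbB.
  rewrite /sinhR -expRD [LHS]mulrC [RHS]mulrA; congr (_ / 2).
    by rewrite mulrBr -!expRD; congr (expR _ - expR _); field.
have r1 : `|r| <= 1.
  (* This is the variance of [U + e V]; the values 1 and -1 of [e] give the two bounds on [r]. *)
  have key e : 0 <= 1 + e * r *+ 2 + e ^+ 2.
    have : 0 <= \int[P]_w (U w + e * V w) ^+ 2 by apply: Rintegral_ge0 => w _; exact: sqr_ge0.
    rewrite (_ : (fun w => _) = fun w => (t^-1) ^+ 2 * W w ^+ 2 +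
        (2 * e / (t * t') * (W w * W' w) + (e / t') ^+ 2 * W' w ^+ 2)); last first.
      by apply/funext => w; rewrite /U /V; field; rewrite tn t'n.
    have [_ i1] := sW; have [_ i2] := sW'.
    rewrite RintegralD//; [|exact: intgbZ|by apply: intgbD; exact: intgbZ].
    rewrite RintegralD//; [|exact: intgbZ|exact: intgbZ].
    rewrite !RintegralZl// Wt W't' => h; apply: le_trans h _.
    by rewrite le_eqVlt; apply/orP; left; apply/eqP; rewrite /r -/c; field; rewrite tn t'n.
  rewrite ler_norml; have := key 1; have := key (-1); rewrite sqrrN expr1n !mulr2n => *.
  by apply/andP; split; lra.
have Uabs : \int[P]_w `|U w| = k.
  rewrite (_ : (fun w => _) = fun w => t^-1 * `|W w|); last first.
    by apply/funext => w; rewrite normrM gtr0_norm ?invr_gt0.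
  rewrite RintegralZl//; last exact: intgb_norm.
  by rewrite Wabs st mulKf.
have [E1 E2] := sgr_cov mU mV sU sV cUV cUU r1.
rewrite Uabs in E1 E2.
have sgU w : Num.sg (U w) = Num.sg (W w) by rewrite /U sgrM gtr0_sg ?mul1r// invr_gt0.
have sgV w : Num.sg (V w) = Num.sg (W' w) by rewrite /V sgrM gtr0_sg ?mul1r// invr_gt0.
split.
  transitivity (t' * \int[P]_w (Num.sg (U w) * V w)).
    rewrite -RintegralZl//.
      by apply: eq_Rintegral => w _; rewrite sgU /V mulrCA mulVKf.
    apply: sqintM => //; apply: (@sqint_bounded _ _ _ _ _ 1).
      by apply: (@measurableT_comp _ _ _ _ _ _ (@Num.sg R)); first exact: measurable_sgr.
    by move=> w; case: sgrP => _; rewrite ?normr0 ?normrN ?normr1.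
  by rewrite E1 /r; field; rewrite tn t'n.
rewrite (_ : k ^+ 2 * (c / (t * t')) = r * k ^+ 2); last by rewrite mulrC.
rewrite (_ : \int[P]_w (Num.sg (W w) * Num.sg (W' w)) = \int[P]_w (Num.sg (U w) * Num.sg (V w)))//.
by apply: eq_Rintegral => w _; rewrite sgU sgV.
Qed.

End gaussian_pairs.

(** * Wiener integrals *)

Section law_of_cos.
Context {R : realType}.
Context {d} {T : measurableType d} (P : probability T R).
Context {d'} {T' : measurableType d'} (Q : probability T' R).
Variables (Y : T -> R) (Z : T' -> R).
Hypotheses (mY : measurable_fun setT Y) (mZ : measurable_fun setT Z).
Hypothesis cosYZ : forall t th : R,
  \int[P]_w cos (t * Y w + th) = \int[Q]_w cos (t * Z w + th).

Let Pr (f : R -> R) := measurable_fun setT f /\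
  forall r, \int[P]_w f (Y w - r) = \int[Q]_w f (Z w - r).

Let mshift d0 (T0 : measurableType d0) (V : T0 -> R) (f : R -> R) r :
  measurable_fun setT V -> measurable_fun setT f ->
  measurable_fun setT (fun w => f (V w - r)).
Proof.
move=> mV mf; apply: (@measurableT_comp _ _ _ _ _ _ f) => //.
exact: measurable_funB.
Qed.

Let icos d0 (T0 : measurableType d0) (P0 : probability T0 R) (V : T0 -> R) a b :
  measurable_fun setT V -> intgb P0 (fun w => cos (a * V w + b)).
Proof.
move=> mV; apply: (@intgb_bounded _ _ _ _ _ 1); last by move=> w; exact: abs_cos_le1.
apply: (@measurableT_comp _ _ _ _ _ _ (fun x => cos (a * x + b))) => //.
by apply: continuous_measurable_fun; exact: continuous_cos_affine.
Qed.

(** The shift by [r] is part of [Pr] because a shifted sine is a cosine of another phase, so that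
    the hypothesis on [Y] and [Z] applies to it directly. *)
Let sg_shift : Pr (fun x => Num.sg x).
Proof.
apply: sgr_sinpoly_ind => [f sf|f_ f Hf f1 fc].
  split; first exact: sinpoly_measurable.
  have [c fc] := sf => r.
  have E (x : R) : f (x - r) = \sum_(p <- c) p.1 * cos (p.2 * x + (- p.2 * r - pi / 2)).
    by rewrite fc; apply: eq_bigr => p _; rewrite addrA cosBpihalf mulrBr mulNr.
  transitivity (\int[P]_w (\sum_(p <- c) p.1 * cos (p.2 * Y w + (- p.2 * r - pi / 2)))).
    by apply: eq_Rintegral => w _.
  transitivity (\int[Q]_w (\sum_(p <- c) p.1 * cos (p.2 * Z w + (- p.2 * r - pi / 2)))); last first.
    by apply: eq_Rintegral => w _.
  rewrite !Rintegral_sum; [|by move=> p; apply: intgbZ; exact: icos..].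
  by apply: eq_bigr => p _; rewrite !RintegralZl ?cosYZ//; exact: icos.
have mf_ n : measurable_fun setT (f_ n) by case: (Hf n).
have mf : measurable_fun setT f by apply: (measurable_fun_cvg mf_) => x _; exact: fc.
split => // r.
have [||||_ _ C1] := @Rintegral_dominated_cvg _ _ _ P (fun n w => f_ n (Y w - r))
  (fun w => f (Y w - r)) (fun=> 1) => //.
- by move=> n; exact: mshift.
- exact: intgb_cst.
have [||||_ _ C2] := @Rintegral_dominated_cvg _ _ _ Q (fun n w => f_ n (Z w - r))
  (fun w => f (Z w - r)) (fun=> 1) => //.
- by move=> n; exact: mshift.
- exact: intgb_cst.
apply: (cvg_unique _ C1) => //.
by rewrite (_ : (fun n => _) = fun n => \int[Q]_w f_ n (Z w - r))//; apply/funext => n; case: (Hf n).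
Qed.

(** Moving the threshold to the left of [r] by [n.+1%:R^-1] gives the limit 0 at [x = r], where the
    unshifted expression would be 1 / 2. *)
Let sg_indic (x r : R) : (1 - Num.sg (x - (r - n.+1%:R^-1))) / 2 @[n --> \oo] -->
  (\1_(`]-oo, r[) x : R).
Proof.
rewrite indicE; have [xr|rx] := ltP x r; last first.
  rewrite memNset ?mulr0n; last by rewrite /= in_itv/=; apply/negP; rewrite -leNgt.
  apply: cvg_near_cst; apply: nearW => n; have : 0 < n.+1%:R^-1 :> R by rewrite invr_gt0 ltr0n.
  by move: (n.+1%:R^-1) => e e0; rewrite gtr0_sg ?subrr ?mul0r//; lra.
rewrite mem_set ?mulr1n; last by rewrite /= in_itv.
apply: cvg_near_cst.
have e0 : 0 < r - x by rewrite subr_gt0.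
have := @cvg_harmonic R => /cvgr0Pnorm_lt/(_ _ e0); apply: filterS => n /=.
by rewrite ger0_norm//; move: (n.+1%:R^-1) => e h; rewrite ltr0_sg; lra.
Qed.

(** Shifted signs give the half-lines []-oo, r[], which form a family stable under intersection that
    generates the Borel sets. *)
Lemma eq_law_of_cos (A : set R) : measurable A -> P (Y @^-1` A) = Q (Z @^-1` A).
Proof.
have mind (V : R) : measurable_fun setT (fun x : R => \1_(`]-oo, V[) x : R).
  exact: measurable_indic.
have cdfE (d0 : measure_display) (T0 : measurableType d0) (P0 : probability T0 R)
    (V : T0 -> R) (r : R) : measurable_fun setT V ->
    P0 (V @^-1` `]-oo, r[) = (\int[P0]_w (\1_(`]-oo, r[) (V w) : R))%:E.
  move=> mV; have mS : measurable (V @^-1` `]-oo, r[).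
    by rewrite -[X in measurable X]setTI; exact: mV.
  rewrite /Rintegral fineK.
    by rewrite -(setIT (V @^-1` _)) -integral_indic.
  apply: integrable_fin_num => //; apply: (@intgb_bounded _ _ _ _ _ 1).
    exact: (@measurableT_comp _ _ _ _ _ _ (fun x : R => \1_(`]-oo, r[) x : R)).
  by move=> w; rewrite indicE ger0_norm// lern1 leq_b1.
have key r : P (Y @^-1` `]-oo, r[) = Q (Z @^-1` `]-oo, r[).
  rewrite !cdfE//; congr EFin.
  have bnd (x y : R) : `|(1 - Num.sg (x - y)) / 2| <= 1.
    by case: sgrP => _; rewrite ler_norml; apply/andP; split; lra.
  have msg (d0 : measure_display) (T0 : measurableType d0) (V : T0 -> R) y :
      measurable_fun setT V -> measurable_fun setT (fun w => (1 - Num.sg (V w - y)) / 2).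
    move=> mV; apply: (mshift (f := fun x => (1 - Num.sg x) / 2)) => //.
    by apply: measurable_funM => //; apply: measurable_funB => //; exact: measurable_sgr.
  have [||||_ _ C1] := @Rintegral_dominated_cvg _ _ _ P
    (fun n w => (1 - Num.sg (Y w - (r - n.+1%:R^-1))) / 2)
    (fun w => \1_(`]-oo, r[) (Y w) : R) (fun=> 1) => //.
  - by move=> n; exact: msg.
  - exact: intgb_cst.
  have [||||_ _ C2] := @Rintegral_dominated_cvg _ _ _ Q
    (fun n w => (1 - Num.sg (Z w - (r - n.+1%:R^-1))) / 2)
    (fun w => \1_(`]-oo, r[) (Z w) : R) (fun=> 1) => //.
  - by move=> n; exact: msg.
  - exact: intgb_cst.
  suff E : (fun n => \int[P]_w ((1 - Num.sg (Y w - (r - n.+1%:R^-1))) / 2)) =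
      (fun n => \int[Q]_w ((1 - Num.sg (Z w - (r - n.+1%:R^-1))) / 2)).
    by rewrite E in C1; exact: (cvg_unique _ C1 C2).
  apply/funext => n; have [_ sgE] := sg_shift.
  have isg (d0 : measure_display) (T0 : measurableType d0) (P0 : probability T0 R)
      (V : T0 -> R) y : measurable_fun setT V -> intgb P0 (fun w => Num.sg (V w - y)).
    move=> mV; apply: (@intgb_bounded _ _ _ _ _ 1); first exact: mshift measurable_sgr.
    by move=> w; case: sgrP => _; rewrite ?normr0 ?normrN ?normr1.
  rewrite !RintegralZr//; last 2 first.
  - by apply: intgbB; [exact: intgb_cst|exact: isg].
  - by apply: intgbB; [exact: intgb_cst|exact: isg].
  rewrite !RintegralB//; [|exact: intgb_cst|exact: isg|exact: intgb_cst|exact: isg].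
  by rewrite sgE !Rintegral_prob_cst.
pose YR := (Y : T -> measurableTypeR R); pose ZR := (Z : T' -> measurableTypeR R).
pose m1 : {measure set (measurableTypeR R) -> \bar R} := pushforward P YR.
pose m2 : {measure set (measurableTypeR R) -> \bar R} := pushforward Q ZR.
have H := @measure_unique _ R (measurableTypeR R) [set A | exists x : R, A = `]-oo, x[%classic]
  (fun n => `]-oo, (n%:R : R)[%classic) (RGenInftyO.measurableE R) _ _ _ (m1 mY) (m2 mZ).
move=> mA; apply: H mA.
- move=> _ _ [x ->] [y ->]; exists (Num.min x y).
  by apply/seteqP; split => z /=; rewrite !in_itv/= lt_min => /andP.
- by move=> n; exists n%:R.
- apply/seteqP; split => // x _; exists (Num.bound `|x|) => //=.
  by rewrite in_itv/=; apply: le_lt_trans (ler_norm x) (archi_boundP (normr_ge0 x)).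
- by move=> _ [x ->]; exact: key.
- move=> n; rewrite -[X in (X < _)%E]/(P (Y @^-1` `]-oo, n%:R[)).
  by rewrite cdfE// ltry.
Qed.

End law_of_cos.

(** * From the events of a variable to its functions, under a weight *)

Section weighted_law.
Context {d} {T : measurableType d} {R : realType} (P : probability T R).

Section density_measure.
Variables (f : T -> R) (mf : measurable_fun setT f) (f0 : forall x, 0 <= f x).

Definition density_measure (A : set T) : \bar R := (\int[P]_(x in A) (f x)%:E)%E.

Let density0 : density_measure set0 = 0%E.
Proof. by rewrite /density_measure integral_set0. Qed.

Let density_ge0 A : (0 <= density_measure A)%E.
Proof. by apply: integral_ge0 => x _; rewrite lee_fin. Qed.

Let density_sigma_additive : semi_sigma_additive density_measure.
Proof.
move=> F mF tF mUF; rewrite /density_measure ge0_integral_bigcup//=; last 2 first.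
- by apply: measurable_funTS; exact/measurable_EFinP.
- by move=> x _; rewrite lee_fin.
apply: is_cvg_ereal_nneg_natsum_cond => n _ _.
by apply: integral_ge0 => x _; rewrite lee_fin.
Qed.

HB.instance Definition _ := isMeasure.Build _ _ _ density_measure
  density0 density_ge0 density_sigma_additive.

End density_measure.

(** By hypothesis the measures with densities [Y] and [m] have the same image under [xi];
    integrating [h] against this image gives the claim. *)
Lemma Rintegral_weighted_law (Y xi : T -> R) (m : R) :
  measurable_fun setT Y -> measurable_fun setT xi ->
  intgb P Y -> (forall w, 0 <= Y w) -> 0 <= m ->
  (forall A, measurable A ->
    \int[P]_w (Y w * \1_A (xi w)) = m * \int[P]_w (\1_A (xi w) : R)) ->
  forall h : R -> R, measurable_fun setT h -> intgb P (h \o xi) ->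
  \int[P]_w (h (xi w) * Y w) = m * \int[P]_w h (xi w).
Proof.
move=> mY mxi iY Y0 m0 H h mh ih.
have mc : measurable_fun setT (fun _ : T => m) by exact: measurable_cst.
pose n1 : {measure set T -> \bar R} := density_measure Y.
pose n2 : {measure set T -> \bar R} := density_measure (fun _ => m).
pose xiR := (xi : T -> measurableTypeR R).
pose n3 : {measure set (measurableTypeR R) -> \bar R} := pushforward (n2 mc (fun=> m0)) xiR.
have nE (f : T -> R) (mf : measurable_fun setT f) (f0 : forall x, 0 <= f x) A :
    measurable A -> intgb P f ->
    (\int[P]_(w in xi @^-1` A) (f w)%:E)%E = (\int[P]_w (f w * \1_A (xi w)))%:E.
  move=> mA iF; have mxA : measurable (xi @^-1` A).
    by rewrite -[X in measurable X]setTI; exact: mxi.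
  rewrite integral_mkcond /Rintegral fineK; last first.
    apply: integrable_fin_num => //; apply: (intgb_le _ _ iF).
      apply: measurable_funM => //.
      by apply: (@measurableT_comp _ _ _ _ _ _ (fun x => \1_A x : R)); [exact: measurable_indic|].
    move=> w; rewrite normrM (ger0_norm (f0 w)) ler_piMr// indicE.
    by rewrite ger0_norm ?ler0n// lern1 leq_b1.
  apply: eq_integral => w _; rewrite patchE indicE.
  have -> : (w \in xi @^-1` A) = (xi w \in A) by apply/idP/idP; rewrite !inE.
  by case: (xi w \in A); rewrite ?mulr1 ?mulr0.
have law1 (A : set R) : measurable A -> n1 mY Y0 (xi @^-1` A) = n3 mxi A.
  move=> mA; rewrite -[LHS]/(\int[P]_(w in xi @^-1` A) (Y w)%:E)%E.
  rewrite -[RHS]/(\int[P]_(w in xi @^-1` A) m%:E)%E !nE//; last exact: intgb_cst.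
  rewrite H// RintegralZl//; apply: (@intgb_bounded _ _ _ _ _ 1).
    by apply: (@measurableT_comp _ _ _ _ _ _ (fun x => \1_A x : R)); [exact: measurable_indic|].
  by move=> w; rewrite indicE ger0_norm ?ler0n// lern1 leq_b1.
have mhx : measurable_fun setT (fun w => h (xi w)) by exact: (@measurableT_comp _ _ _ _ _ _ h).
rewrite -(@Rintegral_density _ T R P (n1 mY Y0) Y mY Y0 (fun A mA => erefl) _ mhx).
rewrite -(@Rintegral_law _ T R _ (measurableTypeR R) (n1 mY Y0) (n3 mxi) xi mxi law1 h mh).
rewrite (@Rintegral_law _ T R _ (measurableTypeR R) (n2 mc (fun=> m0)) (n3 mxi) xi mxi
  (fun A mA => erefl) h mh).
rewrite (@Rintegral_density _ T R P (n2 mc (fun=> m0)) _ mc (fun=> m0) (fun A mA => erefl) _ mhx).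
by rewrite RintegralZr// mulrC.
Qed.

End weighted_law.

Section independent_gaussian_sum.
Context {d} {T : measurableType d} {R : realType} (Q : probability T R).
Variables (xi : nat -> T -> R) (v a : nat -> R) (n : nat).
Hypotheses (mxi : forall i, measurable_fun setT (xi i)) (v0 : forall i, 0 <= v i).
Hypothesis xi_cos : forall i t th,
  \int[Q]_w cos (t * xi i w + th) = cos th * expR (- (v i * t ^+ 2) / 2).
Local Notation I A w := (\1_A w : R).
Hypothesis xi_indep : forall A : nat -> set R, (forall i, measurable (A i)) ->
  \int[Q]_w (\prod_(i < n) I (A i) (xi i w)) = \prod_(i < n) \int[Q]_w I (A i) (xi i w).

Let S k w := \sum_(i < k) a i * xi i w.
Let e k := \prod_(i < k) expR (- (v i * a i ^+ 2) / 2).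

Let mI (A : set R) i : measurable A -> measurable_fun setT (fun w => I A (xi i w)).
Proof.
move=> mA; apply: (@measurableT_comp _ _ _ _ _ _ (fun x => I A x)) => //.
exact: measurable_indic.
Qed.

Let I01 (A : set R) x : 0 <= I A x <= 1.
Proof. by rewrite indicE ler0n lern1 leq_b1. Qed.

Let mF (A : nat -> set R) : (forall i, measurable (A i)) ->
  measurable_fun setT (fun w => \prod_(i < n) I (A i) (xi i w)).
Proof. by move=> mA; apply: measurable_prod => i _; exact: mI. Qed.

Let F01 (A : nat -> set R) w : 0 <= \prod_(i < n) I (A i) (xi i w) <= 1.
Proof.
apply/andP; split.
  by apply: prodr_ge0 => i _; case/andP: (I01 (A i) (xi i w)).
by apply: prodr_ile1 => i _.
Qed.

Let mcosS k th : measurable_fun setT (fun w => cos (th + S k w)).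
Proof.
apply: (@measurableT_comp _ _ _ _ _ _ cos).
  by apply: continuous_measurable_fun; exact: continuous_cos.
apply: measurable_funD => //; apply: measurable_sum => i.
exact: measurable_funM.
Qed.

Let e01 k : 0 <= e k <= 1.
Proof.
apply/andP; split; first by apply: prodr_ge0 => i _; exact: expR_ge0.
apply: prodr_ile1 => i _; rewrite expR_ge0/= -expR0 ler_expR.
by rewrite mulNr oppr_le0 divr_ge0// mulr_ge0 ?sqr_ge0.
Qed.

(** Independence is given for events only, so the induction carries indicators along: the first [k]
    variables are already inside the cosine and have the trivial event, while the others still have
    arbitrary ones. Each step trades the event of one more variable for a function of it. *)
Lemma indep_sum_cos_indic k : (k <= n)%N -> forall (A : nat -> set R) th,
  (forall i, measurable (A i)) -> (forall i, (i < k)%N -> A i = setT) ->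
  \int[Q]_w (cos (th + S k w) * \prod_(i < n) I (A i) (xi i w)) =
  cos th * e k * \prod_(i < n) \int[Q]_w I (A i) (xi i w).
Proof.
elim: k => [|k IH] kn A th mA AT.
  rewrite /e big_ord0 mulr1 -xi_indep// -RintegralZl//; last first.
    by apply: (@intgb_bounded _ _ _ _ _ 1); [exact: mF|move=> w; case/andP: (F01 A w) => *; rewrite ger0_norm].
  by apply: eq_Rintegral => w _; rewrite /S big_ord0 addr0.
pose F w := \prod_(i < n) I (A i) (xi i w).
pose p := \prod_(i < n) \int[Q]_w I (A i) (xi i w).
have FE w : F w = \prod_(i < n) I (A i) (xi i w) by [].
pose k' := Ordinal kn.
(* The event of index [k], trivial by assumption, becomes an arbitrary [C], so that the induction
   hypothesis speaks about the law of [xi k]. *)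
pose A' (C : set R) i := if i == k then C else A i.
have mA' C i : measurable C -> measurable (A' C i) by rewrite /A'; case: ifP.
have AkT : A k = setT by apply: AT.
have indT : \int[Q]_w I (A k) (xi k w) = 1.
  by rewrite AkT; under eq_Rintegral do rewrite indicT; rewrite Rintegral_prob_cst.
have prodA' C w : \prod_(i < n) I (A' C i) (xi i w) = F w * I C (xi k w).
  rewrite /F (bigD1 k')//= [X in _ = X * _](bigD1 k')//= /A' eqxx AkT indicT mul1r mulrC.
  by congr (_ * _); apply: eq_bigr => i ik; rewrite (negbTE (_ : i != k :> nat)).
have prodIA' C : \prod_(i < n) \int[Q]_w I (A' C i) (xi i w) = p * \int[Q]_w I C (xi k w).
  rewrite /p (bigD1 k')//= [X in _ = X * _](bigD1 k')//= /A' eqxx indT mul1r mulrC.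
  by congr (_ * _); apply: eq_bigr => i ik; rewrite (negbTE (_ : i != k :> nat)).
have p0 : 0 <= p.
  apply: prodr_ge0 => i _; apply: Rintegral_ge0 => w _; by case/andP: (I01 (A i) (xi i w)).
have F1 w : `|F w| <= 1 by case/andP: (F01 A w) => *; rewrite ger0_norm.
have mFA : measurable_fun setT F by exact: mF.
have bnd (x y : R) : `|x| <= 1 -> `|y| <= 1 -> `|x * y| <= 1.
  by move=> *; rewrite normrM mulr_ile1.
have iF : intgb Q F by exact: (@intgb_bounded _ _ _ _ _ 1).
have step (h : R -> R) ph : measurable_fun setT h -> (forall x, `|h x| <= 1) ->
    \int[Q]_w (h (xi k w) * (cos (ph + S k w) * F w)) =
    cos ph * e k * p * \int[Q]_w h (xi k w).
  move=> mh h1.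
  have mhx : measurable_fun setT (fun w => h (xi k w)).
    exact: (@measurableT_comp _ _ _ _ _ _ h).
  have ih : intgb Q (h \o xi k).
    by apply: (@intgb_bounded _ _ _ _ _ 1) => // w; exact: h1.
  have icF : intgb Q (fun w => cos (ph + S k w) * F w).
    apply: (@intgb_bounded _ _ _ _ _ 1); first exact: measurable_funM.
    by move=> w; apply: (bnd) => //; exact: abs_cos_le1.
  have H1 := @Rintegral_weighted_law _ _ _ Q F (xi k) p mFA (mxi k) iF
    (fun w => proj1 (andP (F01 A w))) p0.
  have ce : -1 <= cos ph * e k <= 1.
    rewrite -ler_norml; apply: (bnd); first exact: abs_cos_le1.
    by case/andP: (e01 k) => *; rewrite ger0_norm.
  (* A weight has to be nonnegative, which the cosine is not. So [F] is added to it, and the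
     identity [E1] for [F] alone is subtracted afterwards. *)
  have H2 := @Rintegral_weighted_law _ _ _ Q (fun w => F w + cos (ph + S k w) * F w)
    (xi k) (p + cos ph * e k * p).
  have {}H2 := H2 (measurable_funD mFA (measurable_funM (mcosS k ph) mFA)) (mxi k)
    (intgbD iF icF).
  have E1 : \int[Q]_w (h (xi k w) * F w) = p * \int[Q]_w h (xi k w).
    apply: H1 => // C mC.
    rewrite -prodIA' -xi_indep; last by move=> i; exact: mA'.
    by apply: eq_Rintegral => w _; rewrite prodA'.
  have E2 : \int[Q]_w (h (xi k w) * (F w + cos (ph + S k w) * F w)) =
      (p + cos ph * e k * p) * \int[Q]_w h (xi k w).
    apply: H2 => //.
    - move=> w; have /andP[F0 _] := F01 A w; have := cos_geN1 (ph + S k w).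
      by rewrite -/(F w) in F0 *; nra.
    - by move/andP: ce => [? _]; nra.
    - move=> C mC; have /andP[_ _] := ce.
      under eq_Rintegral do rewrite mulrDl -mulrA -prodA'.
      have mA'C i : measurable (A' C i) by exact: mA'.
      rewrite RintegralD//; last 2 first.
      + by apply: (@intgb_bounded _ _ _ _ _ 1); [exact: mF|move=> w; case/andP: (F01 (A' C) w) => *; rewrite ger0_norm].
      + apply: (@intgb_bounded _ _ _ _ _ 1); first by apply: measurable_funM => //; exact: mF.
        by move=> w; apply: (bnd); [exact: abs_cos_le1|case/andP: (F01 (A' C) w) => *; rewrite ger0_norm].
      rewrite xi_indep// IH//; first by rewrite prodIA'; ring.
        exact: ltnW.
      by move=> i ik; rewrite /A' (ltn_eqF ik) AT// (leq_trans ik).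
  move: E2; under eq_Rintegral do rewrite mulrDr.
  have ihF : intgb Q (fun w => h (xi k w) * F w).
    by apply: (@intgb_bounded _ _ _ _ _ 1); [exact: measurable_funM|move=> w; exact: bnd].
  have ihcF : intgb Q (fun w => h (xi k w) * (cos (ph + S k w) * F w)).
    apply: (@intgb_bounded _ _ _ _ _ 1); first by do 2 apply: measurable_funM => //.
    by move=> w; apply: (bnd) => //; apply: (bnd) => //; exact: abs_cos_le1.
  rewrite RintegralD// E1 mulrDl => /eqP; rewrite (can_eq (addKr _)) => /eqP ->.
  by [].
have sinE x : sin x = cos (- (pi / 2) + x) by rewrite addrC cosBpihalf.
have mcos (t : R) th' : measurable_fun setT (fun x => cos (t * x + th')).
  by apply: continuous_measurable_fun; exact: continuous_cos_affine.
have C1 := step (fun x => cos (a k * x + 0)) th (mcos _ _) (fun x => abs_cos_le1 _).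
have C2 := step (fun x => cos (a k * x - pi / 2)) (- (pi / 2) + th) (mcos _ _) (fun x => abs_cos_le1 _).
(* The addition formula, with each sine written as a cosine of shifted phase. The second product
   integrates to 0: the cosine integral of the centered [xi k] at phase - pi / 2 has the factor
   [cos (- (pi / 2))]. *)
rewrite (_ : (fun w => _) = fun w =>
   cos (a k * xi k w + 0) * (cos (th + S k w) * F w) -
   cos (a k * xi k w - pi / 2) * (cos (- (pi / 2) + th + S k w) * F w)); last first.
  apply/funext => w; rewrite addr0 cosBpihalf -addrA -sinE -FE /S big_ord_recr/= addrA cosD; ring.
have ih t th' ph : intgb Q (fun w => cos (t * xi k w + th') * (cos (ph + S k w) * F w)).
  apply: (@intgb_bounded _ _ _ _ _ 1).
    apply: measurable_funM; last exact: measurable_funM.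
    exact: (@measurableT_comp _ _ _ _ _ _ (fun x => cos (t * x + th'))).
  by move=> w; do 2 (apply: (bnd) => //; first exact: abs_cos_le1).
rewrite RintegralB//= C1 C2 !xi_cos cos0 cosN cos_pihalf mul0r mulr0 subr0.
rewrite /e big_ord_recr/= -/p; ring.
Qed.

Lemma indep_sum_cos th :
  \int[Q]_w cos (\sum_(i < n) a i * xi i w + th) =
  cos th * expR (- (\sum_(i < n) a i ^+ 2 * v i) / 2).
Proof.
have := @indep_sum_cos_indic n (leqnn n) (fun=> setT) th (fun=> measurableT) (fun _ _ => erefl).
rewrite (_ : (fun w => _) = fun w => cos (\sum_(i < n) a i * xi i w + th)); last first.
  apply/funext => w; rewrite big1 ?mulr1 ?(addrC th)// => i _.
  by rewrite indicT.
rewrite [X in _ * X]big1 ?mulr1; last first.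
  by move=> i _; under eq_Rintegral do rewrite indicT; rewrite Rintegral_prob_cst.
move=> ->; congr (_ * _); rewrite /e -expR_sum; congr expR.
rewrite -sumrN mulr_suml; apply: eq_bigr => i _; ring.
Qed.

End independent_gaussian_sum.

(** * Step functions on the grid of their endpoints *)

Section grid.
Context {R : realType}.
Implicit Types (s : seq (R * (R * R))).

Definition grid_points s := sort <=%R (flatten [seq [:: p.2.1; p.2.2] | p <- s]).
(** Past the end the sequence stays at the last point. It is thus nondecreasing on all of [nat], as
    the independence clause of [brownian_motion] requires. *)
Definition grid s i := nth (last 0 (grid_points s)) (grid_points s) i.
(** The intervals of [s] may overlap and share endpoints. Cell [i] belongs to an interval when [i]
    lies between the positions of its endpoints; repeated endpoints only produce cells of length
    zero. *)
Definition grid_coef s (i : nat) := \sum_(p <- s)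
  p.1 * ((index p.2.1 (grid_points s) <= i < index p.2.2 (grid_points s))%N)%:R.

Lemma grid_sorted s : sorted <=%R (grid_points s).
Proof. exact: sort_le_sorted. Qed.

Lemma grid_le s i : grid s i <= grid s i.+1.
Proof.
rewrite /grid; have [h|h] := ltnP i.+1 (size (grid_points s)).
  by apply: (sorted_leq_nth le_trans lexx _ (grid_sorted s)); rewrite ?inE// ltnW.
rewrite [leRHS]nth_default//; have [h2|h2] := ltnP i (size (grid_points s)).
  have -> : i = (size (grid_points s)).-1.
    by apply/eqP; rewrite eqn_leq; case: (size _) h h2 => //= m; rewrite !ltnS => -> ->.
  by rewrite nth_last; case: (grid_points s).
by rewrite nth_default.
Qed.

Lemma mem_grid s p : p \in s ->
  (p.2.1 \in grid_points s) && (p.2.2 \in grid_points s).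
Proof.
move=> ps; rewrite !mem_sort; apply/andP; split; apply/flattenP;
by exists [:: p.2.1; p.2.2]; rewrite ?inE ?eqxx ?orbT//; apply/mapP; exists p.
Qed.

Lemma grid_index s (x y : R) : x \in grid_points s -> y \in grid_points s -> x <= y ->
  (index x (grid_points s) <= index y (grid_points s))%N.
Proof.
move=> xs ys xy; rewrite leqNgt; apply/negP => h.
have : y <= x.
  rewrite -(nth_index 0 xs) -(nth_index 0 ys).
  by apply: (sorted_leq_nth le_trans lexx _ (grid_sorted s)); rewrite ?inE ?index_mem// ltnW.
move=> yx; have E : x = y by apply/le_anti; rewrite xy yx.
by move: h; rewrite E ltnn.
Qed.

(** Each increment of [F] telescopes over the cells of its interval. An arbitrary [F] serves two
    ends: a Brownian path gives the step integral, and the function y |-> (x <= y) gives the step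
    function at [x]. *)
Lemma grid_refine s (F : R -> R) : (forall p, p \in s -> p.2.1 <= p.2.2) ->
  \sum_(p <- s) p.1 * (F p.2.2 - F p.2.1) =
  \sum_(i < size (grid_points s)) grid_coef s i * (F (grid s i.+1) - F (grid s i)).
Proof.
move=> hs; under [RHS]eq_bigr do rewrite /grid_coef mulr_suml.
rewrite exchange_big; apply: eq_big_seq => p ps /=.
under eq_bigr do rewrite -mulrA.
rewrite -mulr_sumr; congr (_ * _).
have /andP[p1 p2] := mem_grid ps; have h := grid_index p1 p2 (hs _ ps).
set j := index p.2.1 _ in h *; set k := index p.2.2 _ in h *.
have kn : (k < size (grid_points s))%N by rewrite index_mem.
transitivity (\sum_(j <= i < k) (F (grid s i.+1) - F (grid s i))).
  rewrite telescope_sumr// /grid.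
  by rewrite !(set_nth_default 0) ?index_mem// /j /k !nth_index.
rewrite -[RHS](big_mkord xpredT (fun i =>
  ((j <= i < k)%N)%:R * (F (grid s i.+1) - F (grid s i)))).
rewrite (big_cat_nat (leq0n j) (leq_trans h (ltnW kn)))/=.
rewrite (big_cat_nat h (ltnW kn))/=.
have -> : \sum_(0 <= i < j) ((j <= i < k)%N)%:R * (F (grid s i.+1) - F (grid s i)) = 0.
  by rewrite big_nat_cond; apply: big1 => i /andP[/andP[_ ij] _]; rewrite leqNgt ij mul0r.
have -> : \sum_(k <= i < size (grid_points s))
    ((j <= i < k)%N)%:R * (F (grid s i.+1) - F (grid s i)) = 0.
  rewrite big_nat_cond; apply: big1 => i /andP[/andP[ki _] _].
  by rewrite [(i < k)%N]ltnNge ki andbF mul0r.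
rewrite add0r addr0 big_nat_cond [RHS]big_nat_cond.
by apply: eq_bigr => i /andP[-> _]; rewrite mul1r.
Qed.

Lemma indic_ocE (a b x : R) : a <= b ->
  \1_(`]a, b]) x = ((x <= b)%R%:R - (x <= a)%R%:R : R).
Proof.
move=> ab; rewrite indicE; have [xa|ax] := leP x a.
  by rewrite (le_trans xa ab) subrr memNset// /= in_itv/= ltNge xa.
have [xb|bx] := leP x b; rewrite subr0.
  by rewrite mem_set// /= in_itv/= ax xb.
by rewrite memNset// /= in_itv/= ax/= leNgt bx.
Qed.

Lemma step_fun_grid s x : (forall p, p \in s -> p.2.1 <= p.2.2) ->
  step_fun s x = \sum_(i < size (grid_points s))
    grid_coef s i * \1_(`]grid s i, grid s i.+1]) x.
Proof.
move=> hs; rewrite /step_fun.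
transitivity (\sum_(p <- s) p.1 * ((x <= p.2.2)%R%:R - (x <= p.2.1)%R%:R)).
  by apply: eq_big_seq => p ps; rewrite indic_ocE// hs.
rewrite (grid_refine (fun y => (x <= y)%R%:R) hs).
by apply: eq_bigr => i _; rewrite indic_ocE// grid_le.
Qed.

Lemma grid_mono s i j : (i <= j)%N -> grid s i <= grid s j.
Proof.
move=> /subnK <-; elim: (j - i)%N => // k IH; rewrite addSn.
exact: le_trans IH (grid_le _ _).
Qed.

Lemma sqint_indic_itv (a b : R) : sqint lebesgue_measure (\1_(`]a, b]) : R -> R).
Proof.
split; first exact: measurable_indic.
rewrite (_ : (fun x => _) = \1_(`]a, b])); first exact: integrable_indic_itv.
by apply/funext => x; rewrite indicE; case: (_ \in _); rewrite ?expr1n ?expr0n.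
Qed.

Lemma Rintegral_indic_oc (a b : R) : a <= b ->
  \int[lebesgue_measure]_x (\1_(`]a, b]) x : R) = b - a.
Proof.
move=> ab; rewrite /Rintegral integral_indic// setIT.
have H := @lebesgue_measure_itv R `]a, b]%R.
transitivity (fine (b%:E - a%:E)%E) => //; apply: (congr1 fine); apply: (etrans H).
rewrite /= lte_fin; case: ltP => //= ba; rewrite -EFinB; congr EFin.
by apply/esym/eqP; rewrite subr_eq0 eq_le ab ba.
Qed.

Lemma step_fun_sqint s : sqint lebesgue_measure (step_fun s).
Proof.
by apply: sqint_sum => p; apply: sqintZ; exact: sqint_indic_itv.
Qed.

Lemma step_fun_sqr s : (forall p, p \in s -> p.2.1 <= p.2.2) ->
  \int[lebesgue_measure]_x step_fun s x ^+ 2 =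
  \sum_(i < size (grid_points s)) grid_coef s i ^+ 2 * (grid s i.+1 - grid s i).
Proof.
move=> hs.
under eq_Rintegral do rewrite step_fun_grid//.
have sq (i : 'I_(size (grid_points s))) : sqint lebesgue_measure
    (fun x => grid_coef s i * \1_(`]grid s i, grid s i.+1]) x).
  by apply: sqintZ; exact: sqint_indic_itv.
rewrite Rintegral_sqr_sum//; apply: eq_bigr => i _.
rewrite (bigD1 i)//= big1 ?addr0.
  rewrite -Rintegral_indic_oc ?grid_le// -RintegralZl//; last exact: integrable_indic_itv.
  apply: eq_Rintegral => x _; rewrite indicE; case: (_ \in _); last by rewrite !mulr0.
  by rewrite !mulr1 expr2.
move=> j ji; rewrite -[RHS](Rintegral_set0 lebesgue_measure (fun=> 0)) Rintegral_set0.
rewrite (_ : (fun x => _) = fun=> 0) ?Rintegral_cst ?mul0r//.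
apply/funext => x; rewrite !indicE.
have [xi|] := boolP (x \in _); last by rewrite mulr0 mul0r.
have [xj|] := boolP (x \in _); last by rewrite !mulr0.
exfalso; move: xi xj; rewrite !inE/= !in_itv/= => /andP[i1 i2] /andP[j1 j2].
have : (nat_of_ord j < i)%N || (i < j)%N by rewrite -neq_ltn.
case/orP => ij.
  by have := lt_le_trans i1 (le_trans j2 (grid_mono s ij)); rewrite ltxx.
by have := lt_le_trans j1 (le_trans i2 (grid_mono s ij)); rewrite ltxx.
Qed.

End grid.

Section brownian_step.
Context {d} {T : measurableType d} {R : realType} (Q : probability T R).
Variable B : R -> {RV Q >-> R}.
Hypothesis bB : brownian_motion B.

(** On the grid the integral is a combination of independent centered Gaussian increments, whose
    variance is the integral of the squared step function because the cells are disjoint. *)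
Lemma step_integral_cos s (t th : R) : (forall p, p \in s -> p.2.1 <= p.2.2) ->
  \int[Q]_w cos (t * step_integral B s w + th) =
  cos th * expR (- (t ^+ 2 * \int[lebesgue_measure]_x step_fun s x ^+ 2) / 2).
Proof.
move=> hs; have [_ law indep _] := bB.
pose n := size (grid_points s).
pose xi i w := B (grid s i.+1) w - B (grid s i) w.
have mxi i : measurable_fun setT (xi i) by apply: measurable_funB.
have E w : t * step_integral B s w = \sum_(i < n) (t * grid_coef s i) * xi i w.
  rewrite /step_integral (grid_refine (fun y => B y w) hs) mulr_sumr.
  by apply: eq_bigr => i _; rewrite mulrA.
under eq_Rintegral do rewrite E.
rewrite (@indep_sum_cos _ _ _ Q xi (fun i => grid s i.+1 - grid s i)
  (fun i => t * grid_coef s i) n)//.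
- rewrite step_fun_sqr// mulr_sumr; congr (_ * expR (- _ / 2)).
  by apply: eq_bigr => i _; rewrite exprMn mulrA.
- by move=> i; rewrite subr_ge0 grid_le.
(* A repeated grid point gives the increment 0. The increment clause of [brownian_motion] speaks of
   distinct times only. *)
- move=> i u ph; have := grid_le s i; rewrite le_eqVlt => /predU1P[gE|glt].
    rewrite /xi -gE subrr mul0r oppr0 mul0r expR0 mulr1.
    under eq_Rintegral do rewrite subrr mulr0 add0r.
    by rewrite Rintegral_prob_cst.
  have sp : 0 < grid s i.+1 - grid s i by rewrite subr_gt0.
  have s0 : 0 < Num.sqrt (grid s i.+1 - grid s i) by rewrite sqrtr_gt0.
  have [_ ->] := normal_law_integral (mxi i) s0 (fun A mA => law _ _ glt A mA)
    (f := fun x => cos (u * x + ph))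
    (continuous_measurable_fun (@continuous_cos_affine R u ph)).
  rewrite (_ : (fun y => _) = fun y => cos (u * Num.sqrt (grid s i.+1 - grid s i) * y + ph)
      * normal_pdf 0 1 y); last by apply/funext => y; rewrite addr0 mulrA.
  rewrite Rintegral_cos_std_normal_pdf exprMn sqr_sqrtr ?ltW//.
  by congr (_ * expR (- _ / 2)); rewrite mulrC.
- move=> A mA.
  have mE i : measurable (xi i @^-1` A i).
    by rewrite -[X in measurable X]setTI; exact: mxi.
  have ind1 i : \int[Q]_w (\1_(A i) (xi i w) : R) = fine (Q (xi i @^-1` A i)).
    rewrite -[in RHS](setIT (xi i @^-1` A i)) -integral_indic//; congr fine.
  under [RHS]eq_bigr do rewrite ind1.
  have mcap : measurable (\bigcap_(i < n) (xi i @^-1` A i)).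
    by apply: bigcap_measurableType => i _.
  transitivity (fine (Q (\bigcap_(i < n) (xi i @^-1` A i)))).
    rewrite -[in RHS](setIT (\bigcap_(i < n) _)) -integral_indic//; congr fine.
    apply: eq_integral => w _; congr EFin; rewrite indicE.
    have [wI|wI] := boolP (w \in _).
      move: wI; rewrite inE => wI; apply: big1 => i _.
      by rewrite indicE mem_set//; exact: (wI i (ltn_ord i)).
    move: wI; rewrite notin_setE => /existsNP[i /not_implyP[/= ilt nA]].
    by rewrite (bigD1 (Ordinal ilt))//= indicE memNset// mul0r.
  rewrite (indep n (grid s) A (grid_le s) mA).
  have fQ i : Q (xi i @^-1` A i) \is a fin_num by exact: fin_num_measure.
  elim: n {E mcap} => [|m IH]; first by rewrite !big_ord0.
  rewrite !big_ord_recr/= fineM ?IH//; last exact: fQ.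
  elim: m {IH} => [|m IH]; first by rewrite big_ord0.
  rewrite big_ord_recr/=; apply: fin_numM; last exact: fQ.
  by apply: IH.
Qed.

End brownian_step.

Section wiener_law.
Context {R : realType}.

Lemma abs_cosB_le (x y : R) : `|cos x - cos y| <= `|x - y|.
Proof.
have -> : cos x - cos y = - (2 * (sin ((x + y) / 2) * sin ((x - y) / 2))).
  have -> : cos x = cos ((x + y) / 2 + (x - y) / 2) by congr cos; field.
  have -> : cos y = cos ((x + y) / 2 - (x - y) / 2) by congr cos; field.
  by rewrite cosD cosB; ring.
rewrite normrN !normrM (ger0_norm (ler0n _ 2)).
have h : `|sin ((x - y) / 2)| <= `|x - y| / 2.
  apply: le_trans (abs_sin_le _) _.
  by rewrite normrM (ger0_norm (_ : 0 <= 2^-1)).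
have h1 := abs_sin_le1 ((x + y) / 2); have h2 := normr_ge0 (sin ((x + y) / 2)).
have h3 := normr_ge0 (sin ((x - y) / 2)); nra.
Qed.

Lemma Lnorm2_le d (T : measurableType d) (mu : {measure set T -> \bar R})
    (g : T -> R) (e : R) : measurable_fun setT g -> 0 <= e ->
  ('N[mu]_2%:E[EFin \o g] <= e%:E)%E ->
  sqint mu g /\ \int[mu]_x g x ^+ 2 <= e ^+ 2.
Proof.
move=> mg e0 ge.
have E : (\int[mu]_x (g x ^+ 2)%:E = 'N[mu]_2%:E[EFin \o g] `^ 2)%E.
  rewrite poweR_Lnorm ?pnatr_eq0//; apply: eq_integral => x _ /=.
  by rewrite ?poweR_EFin powR_mulrn// real_normK ?num_real.
have le2 : (\int[mu]_x (g x ^+ 2)%:E <= (e ^+ 2)%:E)%E.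
  rewrite E -[in leRHS]powR_mulrn// -poweR_EFin.
  by apply: gt0_ler_poweR => //; rewrite in_itv/= leey andbT ?lee_fin// Lnorm_ge0.
have i2 : intgb mu (fun x => g x ^+ 2).
  apply/integrableP; split; first by apply/measurable_EFinP; exact: measurable_funX.
  under eq_integral do rewrite /= ger0_norm ?sqr_ge0//.
  by apply: le_lt_trans le2 _; exact: ltry.
split; first by split.
rewrite -lee_fin; apply: le_trans le2; rewrite /Rintegral fineK//.
exact: integrable_fin_num.
Qed.

(** The norms converge in the extended reals and may be infinite for finitely many indices, so
    square integrability is obtained only eventually. *)
Lemma Lnorm2_cvg0 d (T : measurableType d) (mu : {measure set T -> \bar R})
    (g : nat -> T -> R) : (forall n, measurable_fun setT (g n)) ->
  ('N[mu]_2%:E[EFin \o g n])%E @[n --> \oo] --> 0%E ->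
  \int[mu]_x g n x ^+ 2 @[n --> \oo] --> (0 : R) /\
  \forall n \near \oo, sqint mu (g n).
Proof.
move=> mg N0.
have key e : 0 < e -> \forall n \near \oo, sqint mu (g n) /\ \int[mu]_x g n x ^+ 2 <= e ^+ 2.
  move=> e0; move/fine_cvgP: N0 => [Nfin /cvgr0Pnorm_le/(_ _ e0)].
  apply: filterS2 Nfin => n Nn /= Ne; apply: Lnorm2_le => //; first exact: ltW.
  by rewrite -(fineK Nn) lee_fin (le_trans _ Ne)// ler_norm.
split; last by apply: filterS (key 1 ltr01) => n [].
apply/cvgr0Pnorm_le => e e0.
have s0 : 0 < Num.sqrt e by rewrite sqrtr_gt0.
apply: filterS (key _ s0) => n [_]; rewrite (sqr_sqrtr (ltW e0)) => h.
by rewrite ger0_norm//; apply: Rintegral_ge0 => x _; exact: sqr_ge0.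
Qed.

Context {d} {T : measurableType d} (Q : probability T R).
Variable B : R -> {RV Q >-> R}.
Hypothesis bB : brownian_motion B.

(** Both sides pass to the limit from step functions: the left one because the cosine is 1-Lipschitz
    and the integrals converge in mean square, the right one by convergence of the square norms. *)
Lemma wiener_integral_cos (f : R -> R) (Z : {RV Q >-> R}) (t th : R) :
  sqint lebesgue_measure f -> wiener_integral B f Z ->
  \int[Q]_w cos (t * Z w + th) =
  cos th * expR (- (t ^+ 2 * \int[lebesgue_measure]_x f x ^+ 2) / 2).
Proof.
move=> sf [s [hs fs Zs]].
have sstep m : sqint lebesgue_measure (step_fun (s m)) by exact: step_fun_sqint.
have mZ : measurable_fun setT Z by [].
have mS m : measurable_fun setT (step_integral B (s m)).
  apply: measurable_sum => p; apply: measurable_funM => //.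
  exact: measurable_funB.
have [f0 _] := Lnorm2_cvg0 (fun m => (sqintB sf (sstep m)).1) fs.
have {f0} := Rintegral_sqr_cvg sf sstep f0 => cI.
have [Z0 sZ] := Lnorm2_cvg0 (fun m => measurable_funB mZ (mS m)) Zs.
have mcosA (Y : T -> R) : measurable_fun setT Y -> measurable_fun setT (fun w => cos (t * Y w + th)).
  move=> mY; apply: (@measurableT_comp _ _ _ _ _ _ (fun x => cos (t * x + th))) => //.
  by apply: continuous_measurable_fun; exact: continuous_cos_affine.
have icosA (Y : T -> R) : measurable_fun setT Y -> intgb Q (fun w => cos (t * Y w + th)).
  by move=> mY; apply: (@intgb_bounded _ _ _ _ _ 1); [exact: mcosA|move=> w; exact: abs_cos_le1].
have c1 : \int[Q]_w cos (t * step_integral B (s m) w + th) @[m --> \oo] -->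
    cos th * expR (- (t ^+ 2 * \int[lebesgue_measure]_x f x ^+ 2) / 2).
  rewrite (_ : (fun m => _) = fun m => cos th *
     expR (- (t ^+ 2 * \int[lebesgue_measure]_x step_fun (s m) x ^+ 2) / 2)); last first.
    by apply/funext => m; rewrite (step_integral_cos bB)//; exact: hs.
  apply: cvgM; first exact: cvg_cst.
  apply: continuous_cvg; first exact: continuous_expR.
  by apply: cvgM; [apply: cvgN; apply: cvgM => //; exact: cvg_cst|exact: cvg_cst].
suff c2 : \int[Q]_w cos (t * step_integral B (s m) w + th) @[m --> \oo] -->
    \int[Q]_w cos (t * Z w + th) by exact: (cvg_unique _ c2 c1).
apply/cvgrPdist_le => e e0.
pose k := `|t| + 1; have k0 : 0 < k by rewrite ltr_wpDl.
pose h := e / (2 * k); have h0 : 0 < h by rewrite divr_gt0// mulr_gt0.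
have b0 : 0 < h ^+ 2 by rewrite exprn_gt0.
move/cvgr0Pnorm_le : Z0 => /(_ _ b0) Z0.
apply: filterS2 Z0 sZ => m; set D := fun w => Z w - step_integral B (s m) w.
move=> Dm sD.
have [mD iD2] := sD.
rewrite -RintegralB//; [|exact: icosA|exact: icosA].
apply: le_trans (le_normr_Rintegral _ _) _ => //; first by apply: intgbB; exact: icosA.
have iD : intgb Q D by exact: sqint_intgb.
(* The bound |D| <= h + D^2 / h passes from mean square to mean. With the integral of D^2 at most
   h^2, the total is 2 k h = e. *)
apply: (@le_trans _ _ (\int[Q]_w (k * (h + h^-1 * D w ^+ 2)))).
  apply: le_Rintegral => //.
  - by apply: intgb_norm; apply: intgbB; exact: icosA.
  - by apply: intgbZ; apply: intgbD; [exact: intgb_cst|exact: intgbZ].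
  move=> w _; apply: le_trans (abs_cosB_le _ _) _.
  have -> : t * Z w + th - (t * step_integral B (s m) w + th) = t * D w by rewrite /D; ring.
  rewrite normrM; apply: ler_pM => //; first by rewrite lerDl.
  have : 0 <= h^-1 * (`|D w| - h / 2) ^+ 2 by rewrite mulr_ge0 ?sqr_ge0// invr_ge0 ltW.
  have -> : h^-1 * (`|D w| - h / 2) ^+ 2 = h^-1 * `|D w| ^+ 2 - `|D w| + h / 4.
    by field; rewrite gt_eqF.
  rewrite real_normK ?num_real//; move: (h^-1 * D w ^+ 2) => z; lra.
rewrite RintegralZl//; last by apply: intgbD; [exact: intgb_cst|exact: intgbZ].
rewrite RintegralD//; [|exact: intgb_cst|exact: intgbZ].
rewrite Rintegral_prob_cst RintegralZl//.
have : \int[Q]_w D w ^+ 2 <= h ^+ 2 by apply: le_trans Dm; exact: ler_norm.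
rewrite -(ler_pM2l (_ : 0 < h^-1)) ?invr_gt0//.
have -> : h^-1 * h ^+ 2 = h by rewrite expr2 mulKf// gt_eqF.
move=> H; apply: (@le_trans _ _ (k * (h + h))); first by apply: ler_wpM2l; [exact: ltW|rewrite lerD2l].
by rewrite /h le_eqVlt; apply/orP; left; apply/eqP; field; rewrite gt_eqF.
Qed.

(** The cosine integrals of [c Z] are those of the identity under the normal law, and they determine
    the law. *)
Lemma wiener_integral_law (f : R -> R) (Z : {RV Q >-> R}) (c : R) :
  sqint lebesgue_measure f -> wiener_integral B f Z -> 0 < c ->
  0 < \int[lebesgue_measure]_x f x ^+ 2 ->
  forall A, measurable A -> Q ((fun w => Z w * c) @^-1` A) =
    normal_prob 0 (c * Num.sqrt (\int[lebesgue_measure]_x f x ^+ 2)) A.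
Proof.
move=> sf wZ c0 I0 A mA; set s := c * _.
have s0 : 0 < s by rewrite mulr_gt0// sqrtr_gt0.
have mid : measurable_fun setT (idfun : measurableTypeR R -> measurableTypeR R).
  exact: measurable_id.
have := @eq_law_of_cos R _ T Q _ (measurableTypeR R) (normal_prob 0 s)
  (fun w => Z w * c) idfun _ mid _ A mA; apply.
  exact: measurable_funM.
move=> t th.
have [_ ->] := @normal_law_integral _ (measurableTypeR R) R (normal_prob 0 s) idfun mid 0 s s0
  (fun A _ => erefl) (fun x => cos (t * x + th))
  (continuous_measurable_fun (@continuous_cos_affine R t th)).
rewrite (_ : (fun y => _) = fun y => cos (t * s * y + th) * normal_pdf 0 1 y); last first.
  by apply/funext => y; rewrite addr0 mulrA.
rewrite Rintegral_cos_std_normal_pdf.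
rewrite (_ : (fun w => _) = fun w => cos (t * c * Z w + th)); last first.
  by apply/funext => w; congr (cos (_ + _)); ring.
rewrite (wiener_integral_cos _ _ sf wZ); congr (_ * expR (- _ / 2)).
by rewrite /s !exprMn sqr_sqrtr ?ltW//; ring.
Qed.

End wiener_law.

(** * Slowly varying covariances *)

Section uniform_convergence.
Context {R : realType}.
Local Notation mu := (@lebesgue_measure R).
Variable h : R -> R.
Hypothesis mh : measurable_fun setT h.
Hypothesis hB : forall a, h (x + a) - h x @[x --> +oo] --> (0 : R).

(** The truncation at 1 provides a dominating function and keeps the subadditivity of the absolute
    value. *)
Let g (z : R) : R := Num.min `|z| 1.

Let g_ge0 z : 0 <= g z.
Proof. by rewrite /g le_min normr_ge0 ler01. Qed.

Let g_le1 z : g z <= 1.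
Proof. by rewrite /g ge_min lexx orbT. Qed.

Let g_subadd x y : g (x - y) <= g x + g y.
Proof.
rewrite /g; have := ler_normB x y; have := normr_ge0 x; have := normr_ge0 y.
by rewrite !minEle; case: ifP; case: ifP; case: ifP => /=; lra.
Qed.

Let mg u : measurable_fun setT (fun y : R => g (h (u + y) - h u)).
Proof.
apply: measurable_minr => //; apply: measurableT_comp => //.
apply: measurable_funB => //.
by apply: (@measurableT_comp _ _ _ _ _ _ h) => //; exact: measurable_funD.
Qed.

(** The interval [[0, 2]] contains [y + a] for all [y] and [a] in [[0, 1]]. *)
Let G (u : R) := \int[mu]_y (\1_(`[0, 2]) y * g (h (u + y) - h u)).

Let ind01 (a b y : R) : 0 <= (\1_(`[a, b]) y : R) <= 1.
Proof. by rewrite indicE ler0n lern1 leq_b1. Qed.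

Let iind (a b : R) : intgb mu (\1_(`[a, b]) : R -> R).
Proof. exact: integrable_indic_itv. Qed.

Let iG (a b : R) (k : R -> R) : measurable_fun setT k -> (forall y, 0 <= g (k y)) ->
  intgb mu (fun y => \1_(`[a, b]) y * g (k y)).
Proof.
move=> mk _; apply: (intgb_le _ _ (iind a b)).
  apply: measurable_funM; first exact: measurable_indic.
  by apply: measurable_minr => //; apply: measurableT_comp.
move=> y; have /andP[i0 i1] := ind01 a b y.
by rewrite normrM (ger0_norm i0) (ger0_norm (g_ge0 _)) ler_piMr.
Qed.

Let mhu u c : measurable_fun setT (fun y : R => h (u + y) - c).
Proof.
apply: measurable_funB => //.
by apply: (@measurableT_comp _ _ _ _ _ _ h) => //; exact: measurable_funD.
Qed.

Let G_cvg0 : G u @[u --> +oo] --> (0 : R).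
Proof.
apply/cvg_pinftyP => u uy.
have [||||_ _] := @Rintegral_dominated_cvg _ _ R mu
  (fun n y => \1_(`[0, 2]) y * g (h (u n + y) - h (u n))) (fun=> 0) (\1_(`[0, 2]) : R -> R).
- by move=> n; apply: measurable_funM; [exact: measurable_indic|exact: mg].
- exact: iind.
- move=> n y; have /andP[i0 i1] := ind01 0 2 y.
  by rewrite normrM (ger0_norm i0) (ger0_norm (g_ge0 _)) ler_piMr.
- move=> y; rewrite -[X in _ --> X](mulr0 (\1_(`[0, 2]) y : R)).
  apply: cvgM; first exact: cvg_cst.
  apply: (@squeeze_cvgr _ _ _ _ (cst 0) (fun n => `|h (u n + y) - h (u n)|)).
  + by apply: nearW => n; rewrite g_ge0 /g ge_min lexx.
  + exact: cvg_cst.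
  + by apply/norm_cvg0P; apply: (cvg_comp _ _ uy (hB y)).
by rewrite Rintegral_cst// mul0r.
Qed.

(** For each y in [0, 1], pass from u to u + a through the point u + a + y and average over y. The
    right side involves only values of [G], which tends to 0 by dominated convergence; this is the
    source of the uniformity in [a]. *)
Let G_bound u a : 0 <= a <= 1 -> g (h (u + a) - h u) <= G (u + a) + G u.
Proof.
move=> /andP[a0 a1].
pose k y := \1_(`[0, 1]) y * g (h (u + a + y) - h (u + a)).
pose l y := \1_(`[0, 1]) y * g (h (u + (1 * y + a)) - h u).
have ik : intgb mu k by apply: iG.
have il : intgb mu l.
  apply: (@iG 0 1 (fun y => h (u + (1 * y + a)) - h u)) => //.
  apply: measurable_funB => //; apply: (@measurableT_comp _ _ _ _ _ _ h) => //.
  by apply: measurable_funD => //; apply: measurable_funD => //; exact: measurable_funM.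
have -> : g (h (u + a) - h u) = \int[mu]_y (\1_(`[0, 1]) y * g (h (u + a) - h u)).
  rewrite RintegralZr//.
  rewrite /Rintegral integral_indic// setIT.
  have -> : fine (mu `[0, 1]) = 1.
    transitivity (fine (1%:E - 0%:E : \bar R)%E); last by rewrite /= subr0.
    apply: (congr1 fine); apply: (etrans (@lebesgue_measure_itv R `[0, 1]%R)).
    by rewrite /= lte_fin ltr01.
  by rewrite mul1r.
apply: (@le_trans _ _ (\int[mu]_y (k y + l y))).
  apply: le_Rintegral => //.
  - by under [X in intgb _ X]eq_fun do rewrite mulrC; apply: intgbZ; exact: iind.
  - exact: intgbD.
  move=> y _; rewrite /k /l -mulrDr ler_wpM2l//.
  have -> : h (u + a) - h u = (h (u + (1 * y + a)) - h u) - (h (u + a + y) - h (u + a)).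
    by rewrite mul1r (_ : u + a + y = u + (y + a)); [ring|rewrite -addrA (addrC a)].
  by rewrite [leRHS]addrC; exact: g_subadd.
rewrite RintegralD//; apply: lerD.
  apply: le_Rintegral => //; first exact: iG.
  move=> y _; rewrite /k ler_wpM2r// !indicE ler_nat.
  have [|//] := boolP (y \in `[0, 1]%classic); rewrite inE/= in_itv/= => /andP[y0 y1].
  by rewrite mem_set// /= in_itv/= y0 (le_trans y1)// ler1n.
have mk2c : measurable_fun setT
    ((fun y : R => \1_(`[0, 2]) y * g (h (u + y) - h u)) \o (fun y : R => 1 * y + a)).
  apply: measurableT_comp.
    by apply: measurable_funM; [exact: measurable_indic|exact: mg].
  by apply: measurable_funD => //; exact: measurable_funM.
rewrite /G {2}/Rintegral (@ge0_integral_affine _ 1 a); first last.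
- by move=> y; rewrite lee_fin mulr_ge0//; case/andP: (ind01 0 2 y).
- by apply/measurable_EFinP; apply: measurable_funM; [exact: measurable_indic|exact: mg].
- exact: oner_neq0.
rewrite normr1 mul1e; apply: le_Rintegral => //.
  apply: (@intgb_le _ _ _ mu _ (fun y => \1_(`[- a, 2 - a]) y)) => //.
  move=> y; have /andP[i0 i1] := ind01 0 2 (1 * y + a).
    rewrite normrM (ger0_norm i0) (ger0_norm (g_ge0 _)); apply: le_trans (ler_piMr i0 (g_le1 _)) _.
    rewrite !indicE ler_nat; have [|//] := boolP (1 * y + a \in _).
    rewrite inE/= in_itv/= mul1r => /andP[y0 y1].
    by rewrite mem_set// /= in_itv/=; apply/andP; split; lra.
move=> y _; rewrite /l ler_wpM2r// !indicE ler_nat.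
have [|//] := boolP (y \in `[0, 1]%classic); rewrite inE/= in_itv/= => /andP[y0 y1].
by rewrite mem_set// /= in_itv/= mul1r; apply/andP; split; lra.
Qed.

Lemma uniform_convergence_theorem e : 0 < e ->
  \forall u \near +oo, forall a, 0 <= a <= 1 -> `|h (u + a) - h u| <= e.
Proof.
(* Below 1 the truncation in [g] is inactive, so a bound on [g] becomes one on the absolute
   value. *)
move=> e0; pose e' := Num.min e 2^-1.
have e'0 : 0 < e' by rewrite lt_min e0 invr_gt0 ltr0n.
have e2 : 0 < e' / 2 by rewrite divr_gt0.
have := G_cvg0 => /cvgr0Pnorm_le/(_ _ e2)[U [_ HU]].
exists U; split; first exact: num_real.
move=> u Uu a a01.
have h1 := HU _ Uu; have h2 : `|G (u + a)| <= e' / 2.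
  by apply: HU; case/andP: a01 => a0 _; rewrite (lt_le_trans Uu)// lerDl.
have h3 := G_bound u a01.
have h4 : g (h (u + a) - h u) <= e'.
  apply: le_trans h3 _; have := ler_norm (G u); have := ler_norm (G (u + a)); lra.
have e'h : e' <= 2^-1 by rewrite /e' ge_min lexx orbT.
have e'e : e' <= e by rewrite /e' ge_min lexx.
move: h4; rewrite /g ge_min => /orP[h4|]; first exact: le_trans h4 e'e.
by move=> ?; exfalso; lra.
Qed.

(** The segment from u to u + t is cut into unit steps and a last shorter one, each costing at most
    [e] by uniform convergence. *)
Lemma potter_additive e : 0 < e ->
  \forall u \near +oo, forall t, 0 <= t -> `|h (u + t) - h u| <= e * (t + 1).
Proof.
move=> e0; have [U [_ HU]] := uniform_convergence_theorem e0.
exists U; split; first exact: num_real.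
suff key (n : nat) (u t : R) : U < u -> 0 <= t <= n%:R -> `|h (u + t) - h u| <= e * (t + 1).
  move=> u Uu t t0; apply: (key (Num.bound t)) => //.
  by rewrite t0/=; apply: ltW; exact: archi_boundP.
elim: n u t => [|n IH] u t Uu /andP[t0 tn].
  have -> : t = 0 by apply/le_anti; rewrite t0 tn.
  by rewrite addr0 subrr normr0 add0r mulr1 ltW.
have [t1|t1] := leP t 1.
  apply: le_trans (HU u Uu t _) _; first by rewrite t0 t1.
  by rewrite ler_peMr ?(ltW e0)// lerDr.
have -> : h (u + t) - h u = (h (u + 1 + (t - 1)) - h (u + 1)) + (h (u + 1) - h u).
  by rewrite addrA subrK; congr (h _ - _); ring.
apply: le_trans (ler_normD _ _) _.
have h1 := HU u Uu 1; rewrite ler01 lexx in h1.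
have h2 : `|h (u + 1 + (t - 1)) - h (u + 1)| <= e * (t - 1 + 1).
  apply: IH; first by rewrite (lt_trans Uu)// ltrDl.
  by move: tn; rewrite -natr1 => tn; apply/andP; split; lra.
have := h1 isT; nra.
Qed.

End uniform_convergence.

Section potter.
Context {R : realType}.
Variable L : R -> R.
Hypothesis L_slow : slowly_varying L.
Hypothesis L_gt0 : \forall k \near \oo, 0 < L k%:R.

(** The absolute value is taken because [L] is assumed positive at large integers only; ratios of
    [L] tend to 1, hence are eventually positive. Cutting [h] off at [U0] makes it measurable
    everywhere, while [L] is measurable on a half-line. *)
Lemma slowly_varying_additive : exists (U0 : R) (h : R -> R),
  [/\ measurable_fun setT h, forall a, h (x + a) - h x @[x --> +oo] --> (0 : R) &
    forall u, U0 <= u -> h u = ln `|L (expR u)|].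
Proof.
have [[M mL] Lc] := L_slow.
pose M1 := Num.max M 1; have M1_gt0 : 0 < M1 by rewrite lt_max ltr01 orbT.
pose U0 := ln M1; pose f u := ln `|L (expR u)|.
pose h := f \_ (`[U0, +oo[ : set R).
have hE u : U0 <= u -> h u = f u by move=> Uu; rewrite /h patchE mem_set//= in_itv/= Uu.
exists U0, h; split => //.
  apply/(measurable_restrictT _ _).1 => //.
  apply: measurableT_comp => //; apply: measurableT_comp => //.
  apply: (@measurable_comp _ _ _ _ _ _ (`[M, +oo[ : set R)) => //; last exact: measurable_funTS.
  move=> _ [u /= + <-]; rewrite !in_itv/= !andbT => Uu.
  apply: (@le_trans _ _ M1); first by rewrite le_max lexx.
  by rewrite -[M1]lnK ?posrE// ler_expR.
move=> a.
have ey : @expR R x @[x --> +oo%R] --> +oo%R.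
  apply/cvgryPge => A; near=> x.
  apply: (@le_trans _ _ (1 + x)); last exact: expR_ge1Dx.
  by rewrite -lerBlDl; near: x; apply: nbhs_pinfty_ge; exact: num_real.
have qc : L (expR a * expR x) / L (expR x) @[x --> +oo] --> (1 : R).
  by apply: (cvg_comp _ _ ey (Lc _ (expR_gt0 a))).
have lc : ln (L (expR a * expR x) / L (expR x)) @[x --> +oo] --> (0 : R).
  rewrite -[X in _ --> X](@ln1 R).
  by apply: (cvg_comp _ _ qc); exact: continuous_ln.
apply: cvg_trans lc; apply: near_eq_cvg.
have q0 : \forall x \near +oo, 0 < L (expR a * expR x) / L (expR x).
  by apply: (cvgr_gt _ qc); exact: ltr01.
near=> x.
have xU : U0 <= x by near: x; apply: nbhs_pinfty_ge; exact: num_real.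
have xaU : U0 <= x + a.
  by rewrite -lerBlDr; near: x; apply: nbhs_pinfty_ge; exact: num_real.
have qx : 0 < L (expR a * expR x) / L (expR x) by near: x.
rewrite (hE _ xU) (hE _ xaU) /f expRD (mulrC (expR x)).
have B0 : L (expR x) != 0 by apply/negP => /eqP B0; move: qx; rewrite B0 invr0 mulr0 ltxx.
have A0 : L (expR a * expR x) != 0 by apply/negP => /eqP A0; move: qx; rewrite A0 mul0r ltxx.
rewrite -ln_div ?posrE ?normr_gt0// -normf_div gtr0_norm//.
Unshelve. all: by end_near. Qed.

Lemma slowly_varying_potter e : 0 < e -> exists K : nat, (0 < K)%N /\
  forall k n : nat, (K <= k <= n)%N ->
  [/\ 0 < L k%:R, 0 < L n%:R,
    L k%:R <= expR (e * (ln (n%:R / k%:R) + 1)) * L n%:R &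
    L n%:R <= expR (e * (ln (n%:R / k%:R) + 1)) * L k%:R].
Proof.
move=> e0; have [U0 [h [mh hB hE]]] := slowly_varying_additive.
have [U [_ HU]] := potter_additive mh hB e0.
have [K1 _ HK1] := L_gt0.
(* The [+ 1] yields the strict inequality [U < ln k%:R]. *)
pose V := Num.max U0 (U + 1).
pose K := maxn (maxn K1 1) (Num.bound (expR V)).
exists K; split; first by rewrite /K !leq_max/= orbT.
move=> k n /andP[Kk kn].
have K1k : (K1 <= k)%N by apply: leq_trans Kk; rewrite /K !leq_max leqnn.
have k1 : (0 < k)%N by apply: leq_trans Kk; rewrite /K !leq_max/= orbT.
have Vk : V <= ln k%:R.
  rewrite -[V]expRK ler_ln ?posrE ?expR_gt0 ?ltr0n//; apply: ltW.
  apply: lt_le_trans (archi_boundP (expR_ge0 _)) _.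
  by rewrite ler_nat (leq_trans _ Kk)// /K leq_max leqnn orbT.
have k0 : 0 < k%:R :> R by rewrite ltr0n.
have n0 : 0 < n%:R :> R by rewrite ltr0n (leq_trans k1).
have Lk : 0 < L k%:R by apply: HK1.
have Ln : 0 < L n%:R by apply: HK1; exact: leq_trans kn.
have t0 : 0 <= ln (n%:R / k%:R) :> R.
  by rewrite ln_ge0// ler_pdivlMr// mul1r ler_nat.
have lE : ln k%:R + ln (n%:R / k%:R) = ln n%:R :> R.
  by rewrite ln_div ?posrE// addrC subrK.
have UV : U0 <= ln k%:R by apply: le_trans Vk; rewrite /V le_max lexx.
have Uk : U < ln k%:R by apply: lt_le_trans Vk; rewrite /V lt_max ltrDl ltr01 orbT.
have := HU _ Uk _ t0; rewrite lE !hE//; last by rewrite -lE (le_trans UV)// lerDl.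
rewrite !lnK ?posrE// (gtr0_norm Lk) (gtr0_norm Ln).
set c := e * _; rewrite ler_norml => /andP[h1 h2]; split => //.
- rewrite -ler_ln ?posrE ?mulr_gt0 ?expR_gt0// lnM ?posrE ?expR_gt0// expRK; lra.
- rewrite -ler_ln ?posrE ?mulr_gt0 ?expR_gt0// lnM ?posrE ?expR_gt0// expRK; lra.
Qed.

End potter.

(** * Sums of powers compared with integrals *)

Section power_sums.
Context {R : realType}.
Implicit Types q : R.

Lemma powR_mean_value q (x : R) : 0 < x ->
  exists2 c, x < c < x + 1 & (x + 1) `^ q - x `^ q = q * c `^ (q - 1).
Proof.
move=> x0; have xx : x < x + 1 by rewrite ltrDl.
have dq (z : R) : 0 < z -> is_derive z (1 : R) (@powR R ^~ q) (q * z `^ (q - 1)).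
  by move=> z0; exact: (@is_derive1_powR R q z z0).
have [z||c cI ->] := @MVT R (@powR R ^~ q) (fun c => q * c `^ (q - 1)) x (x + 1) xx.
- by rewrite in_itv/= => /andP[xz _]; apply: dq; exact: lt_trans xz.
- apply: derivable_within_continuous => z; rewrite in_itv/= => /andP[xz _].
  by have h := dq z (lt_le_trans x0 xz); case: h.
by exists c; [move: cI; rewrite in_itv|rewrite addrAC subrr add0r mulr1].
Qed.

Lemma powR_succ_concave q (m : nat) : 0 < q < 1 -> (0 < m)%N ->
  q * m.+1%:R `^ (q - 1) <= m.+1%:R `^ q - m%:R `^ q <= q * m%:R `^ (q - 1).
Proof.
move=> /andP[q0 q1] m0; have m0R : 0 < m%:R :> R by rewrite ltr0n.
have [c /andP[c1 c2]] := powR_mean_value q m0R.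
rewrite natr1 => ->; have c0 := lt_trans m0R c1.
have mono (x y : R) : 0 < x -> x <= y -> y `^ (q - 1) <= x `^ (q - 1).
  move=> x0 xy; rewrite -(opprB 1 q) !powRN lef_pV2 ?posrE ?powR_gt0//; last exact: lt_le_trans xy.
  by apply: ge0_ler_powR; rewrite ?nnegrE ?subr_ge0 ?(ltW q1) ?(ltW x0)// (le_trans (ltW x0)).
rewrite !ler_pM2l//; apply/andP; split; apply: mono => //; last exact: ltW.
by rewrite -natr1; apply: ltW.
Qed.

Lemma powR_succ_convex q (m : nat) : 0 < q ->
  (1 + q) * m%:R `^ q <= m.+1%:R `^ (1 + q) - m%:R `^ (1 + q) <= (1 + q) * m.+1%:R `^ q.
Proof.
move=> q0; case: m => [|m].
  by rewrite !powR0 ?powR1 ?mulr0 ?subr0 ?gt_eqF ?ler01 ?mulr1/= ?lerDl ?ltW// addr_gt0.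
have m0R : 0 < m.+1%:R :> R by rewrite ltr0n.
have [c /andP[c1 c2]] := powR_mean_value (1 + q) m0R.
rewrite natr1 => ->; rewrite addrAC subrr add0r.
have c0 := lt_trans m0R c1.
have q10 : 0 < 1 + q by rewrite addr_gt0.
have mono (x y : R) : 0 < x -> x <= y -> x `^ q <= y `^ q.
  by move=> x0 xy; apply: ge0_ler_powR; rewrite ?nnegrE ?(ltW q0) ?(ltW x0)// (le_trans (ltW x0)).
rewrite !ler_pM2l//; apply/andP; split; apply: mono => //; first exact: ltW.
by apply: ltW; rewrite natr1 in c2.
Qed.

Lemma sum_powR_bounds q (n : nat) : 0 < q < 1 ->
  (n.+1%:R `^ q - 1) / q <= \sum_(1 <= k < n.+1) k%:R `^ (q - 1) <= n%:R `^ q / q.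
Proof.
move=> q01; have /andP[q0 q1] := q01.
elim: n => [|n IH].
  by rewrite big_geq// powR0 ?gt_eqF// powR1 subrr !mul0r lexx.
rewrite big_nat_recr//=; move: IH => /andP[IH1 IH2].
have /andP[_ h2] := powR_succ_concave q01 (ltn0Sn n).
rewrite ler_pdivrMr// in IH1; rewrite ler_pdivlMr// in IH2.
rewrite ler_pdivrMr// ler_pdivlMr// mulrDl.
apply/andP; split; first by move: IH1 h2; rewrite (mulrC q); lra.
(* The increment bound needs a positive base point; the first term 1 is compared with 1 / q
   directly. *)
case: n {IH1 h2} IH2 => [|n] IH2.
  by rewrite big_geq// !powR1 mul0r add0r mul1r ltW.
have /andP[h1 _] := powR_succ_concave q01 (ltn0Sn n).
by move: IH2 h1; rewrite (mulrC q); lra.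
Qed.

Lemma sum_powRN_bounds (E : R) (n : nat) : 0 < E < 1 ->
  (n.+1%:R `^ (1 - E) - 1) / (1 - E) <= \sum_(1 <= k < n.+1) k%:R `^ (- E) <=
  n%:R `^ (1 - E) / (1 - E).
Proof.
move=> /andP[E0 E1]; have := @sum_powR_bounds (1 - E) n.
by rewrite (_ : 1 - E - 1 = - E) => [-> //|]; lra.
Qed.

(** Summation by parts: [f k] occurs in n - k of the partial sums. *)
Lemma sum_convE (f : nat -> R) (n : nat) :
  \sum_(1 <= k < n) (n%:R - k%:R) * f k = \sum_(1 <= m < n) \sum_(1 <= k < m.+1) f k.
Proof.
elim: n => [|n IH]; first by rewrite !big_geq.
case: n IH => [|n] IH; first by rewrite !big_geq.
rewrite [RHS]big_nat_recr//= -IH [in RHS](big_nat_recr n.+1)//= big_nat_recr//=.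
rewrite addrA -big_split/=; congr (_ + _); last by rewrite -[n.+2%:R]natr1; ring.
by apply: eq_bigr => k _; rewrite -[n.+2%:R]natr1; ring.
Qed.

(** By [sum_convE] this is a sum of partial sums, each enclosed by [sum_powRN_bounds]; summing the
    enclosing powers once more gives the exponent 2 - E. The term n / (1 - E) accumulates the 1 / (1
    - E) lost at each step of the lower bound. *)
Lemma conv_powRN_bounds (E : R) (n : nat) : 0 < E < 1 ->
  n%:R `^ (2 - E) / ((1 - E) * (2 - E)) - n%:R / (1 - E) <=
  \sum_(1 <= k < n) (n%:R - k%:R) * k%:R `^ (- E) <=
  n%:R `^ (2 - E) / ((1 - E) * (2 - E)).
Proof.
move=> E01; have /andP[E0 E1] := E01; rewrite sum_convE.
have q0 : 0 < 1 - E by lra.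
have p0 : 0 < 2 - E by lra.
have pq : 2 - E = 1 + (1 - E) by ring.
case: n => [|n].
  by rewrite big_geq// powR0 ?gt_eqF// !mul0r subrr lexx.
elim: n => [|n IH].
  rewrite big_geq// powR1 subr_le0; apply/andP; split; last by rewrite divr_ge0// mulr_ge0// ltW.
  by rewrite ler_pM2l// lef_pV2 ?posrE ?mulr_gt0// ler_pMr//; lra.
rewrite big_nat_recr//=; move: IH; set S := \sum_(1 <= m < _) _.
have := sum_powRN_bounds n.+1 E01; set H := \sum_(1 <= k < _) _.
have := powR_succ_convex n.+1 q0; rewrite -pq -[in X in _ - X / _ <= S + H](natr1 n.+1).
move: (n.+1%:R `^ (2 - E)) (n.+2%:R `^ (2 - E)) => a b.
move: (n.+1%:R `^ (1 - E)) (n.+2%:R `^ (1 - E)) => x y; move: (n.+1%:R) => N.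
move: (S) (H) => {}S {}H /andP[c1 c2] /andP[h1 h2] /andP[IH1 IH2].
have ne : (1 - E != 0) && (2 - E != 0) by rewrite !gt_eqF.
have e0 : (b - a) / ((1 - E) * (2 - E)) = (b - a) / (2 - E) / (1 - E).
  by field; case/andP: ne => -> ->.
have e1 : x / (1 - E) <= (b - a) / ((1 - E) * (2 - E)).
  by rewrite e0 ler_pM2r ?invr_gt0// ler_pdivlMr// mulrC.
have e2 : (b - a) / ((1 - E) * (2 - E)) <= y / (1 - E).
  by rewrite e0 ler_pM2r ?invr_gt0// ler_pdivrMr// mulrC.
clear e0; move: e1 e2 h1 h2 IH1 IH2.
move: (((1 - E) * (2 - E))^-1) ((1 - E)^-1) => u v e1 e2 h1 h2 IH1 IH2.
by apply/andP; split; lra.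
Qed.

End power_sums.

Section regularly_varying_covariance.
Context {R : realType}.
Variables (L : R -> R) (D : R) (rho : nat -> R).
Hypotheses (D_gt0 : 0 < D) (D_lt1 : D < 1).
Hypothesis L_slow : slowly_varying L.
Hypothesis L_gt0 : \forall k \near \oo, 0 < L k%:R.
Hypothesis rhoE : forall k : nat, (0 < k)%N -> rho k = k%:R `^ (- D) * L k%:R.

Lemma powRDpos (x a b : R) : 0 < x -> x `^ (a + b) = x `^ a * x `^ b.
Proof. by move=> x0; rewrite powRD// (gt_eqF x0) implybT. Qed.

Lemma powRN_cvg0 (a : R) : 0 < a -> n%:R `^ (- a) @[n --> \oo] --> (0 : R).
Proof.
move=> a0; apply/cvgr0Pnorm_le => e e0.
have c0 : 0 < e `^ (- a^-1) by rewrite powR_gt0.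
exists (Num.bound (e `^ (- a^-1))) => // n /= hn.
have cn : e `^ (- a^-1) <= n%:R.
  by apply: le_trans (ltW (archi_boundP (ltW c0))) _; rewrite ler_nat.
have n0 : 0 < n%:R :> R by apply: lt_le_trans cn.
rewrite ger0_norm ?powR_ge0// powRN.
have -> : e = ((e `^ (- a^-1)) `^ a)^-1.
  by rewrite -powRrM mulNr mulVf ?gt_eqF// powRN powRr1 ?invrK// ltW.
rewrite lef_pV2 ?posrE ?powR_gt0//.
by apply: ge0_ler_powR; rewrite ?nnegrE ?(ltW a0) ?(ltW c0) ?(ltW n0).
Qed.

(** Potter's bounds written for [rho]: relative to [rho n], the covariance at a smaller lag lies
    between powers of n / k with exponents D - e and D + e. *)
Lemma covariance_ratio e : 0 < e -> exists K : nat, (0 < K)%N /\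
  forall k n : nat, (K <= k <= n)%N ->
  [/\ 0 < rho k, 0 < rho n,
   rho k <= expR e * (n%:R `^ (D + e) * k%:R `^ (- (D + e))) * rho n &
   expR (- e) * (n%:R `^ (D - e) * k%:R `^ (- (D - e))) * rho n <= rho k].
Proof.
move=> e0; have [K [K0 H]] := slowly_varying_potter L_slow L_gt0 e0.
exists K; split => // k n /andP[Kk kn].
have k1 : (0 < k)%N by apply: leq_trans Kk.
have n1 : (0 < n)%N by apply: leq_trans kn.
have k0 : 0 < k%:R :> R by rewrite ltr0n.
have n0 : 0 < n%:R :> R by rewrite ltr0n.
have /H[Lk Ln] : (K <= k <= n)%N by rewrite Kk kn.
have -> : expR (e * (ln (n%:R / k%:R) + 1)) = expR e * (n%:R `^ e * k%:R `^ (- e)) :> R.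
  rewrite mulrDr mulr1 expRD mulrC ln_div ?posrE// mulrBr expRD.
  by rewrite /powR !gt_eqF//= mulNr.
have nD : n%:R `^ D * n%:R `^ (- D) = 1 :> R by rewrite -powRDpos// subrr powRr0.
have ne : n%:R `^ e * n%:R `^ (- e) = 1 :> R by rewrite -powRDpos// subrr powRr0.
have ke : k%:R `^ e * k%:R `^ (- e) = 1 :> R by rewrite -powRDpos// subrr powRr0.
have ee : expR e * expR (- e) = 1 :> R by rewrite -expRD subrr expR0.
have kD0 : 0 < k%:R `^ (- D) by rewrite powR_gt0.
have nD0 : 0 < n%:R `^ (- D) by rewrite powR_gt0.
rewrite !rhoE// (opprD D) (opprB D) (addrC e) !powRDpos// => h1 h2; split.
- by rewrite mulr_gt0.
- by rewrite mulr_gt0.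
- rewrite -(ler_pM2l kD0) in h1; apply: le_trans h1 _.
  rewrite le_eqVlt; apply/orP; left; apply/eqP.
  transitivity (k%:R `^ (- D) * (expR e * (n%:R `^ e * k%:R `^ (- e)) * L n%:R) *
     (n%:R `^ D * n%:R `^ (- D))); first by rewrite nD mulr1.
  ring.
- have p0 : 0 <= expR (- e) * (n%:R `^ (- e) * k%:R `^ e) * k%:R `^ (- D).
    by rewrite !mulr_ge0 ?expR_ge0 ?powR_ge0.
  have := ler_wpM2l p0 h2 => h3; apply: le_trans (le_trans _ h3) _.
    rewrite le_eqVlt; apply/orP; left; apply/eqP.
    transitivity (expR (- e) * (n%:R `^ (- e) * k%:R `^ e) * k%:R `^ (- D) * L n%:R *
     (n%:R `^ D * n%:R `^ (- D))); last by rewrite nD mulr1.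
    ring.
  rewrite le_eqVlt; apply/orP; left; apply/eqP.
  transitivity (k%:R `^ (- D) * L k%:R * (expR e * expR (- e)) *
    (n%:R `^ e * n%:R `^ (- e)) * (k%:R `^ e * k%:R `^ (- e))); last by rewrite ee ne ke !mulr1.
  ring.
Qed.

Lemma covariance_gt0 : \forall n \near \oo, 0 < rho n.
Proof.
have [K [K0 H]] := covariance_ratio ltr01.
by exists K => // n /= Kn; have [] := H n n; rewrite ?Kn ?leqnn.
Qed.

(** Comparison of [rho n] with the fixed value [rho K], with e = D / 2, gives O(n^(-D/2)). *)
Lemma covariance_cvg0 : rho n @[n --> \oo] --> (0 : R).
Proof.
have e0 : 0 < D / 2 by rewrite divr_gt0.
have [K [K0 H]] := covariance_ratio e0.
pose c := expR (- (D / 2)) * K%:R `^ (- (D - D / 2)).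
have c0 : 0 < c by rewrite mulr_gt0 ?expR_gt0// powR_gt0// ltr0n.
apply: (@squeeze_cvgr _ _ _ _ (cst 0) (fun n => c^-1 * rho K * n%:R `^ (- (D / 2)))).
- exists K => // n /= Kn; have /H[_ rn _ h] : (K <= K <= n)%N by rewrite leqnn Kn.
  have n0 : 0 < n%:R :> R by rewrite ltr0n (leq_trans K0).
  rewrite (ltW rn)/=.
  rewrite powRN ler_pdivlMr ?powR_gt0// mulrC ler_pdivlMl//.
  apply: le_trans h; rewrite le_eqVlt; apply/orP; left; apply/eqP.
  have Dh : D - D / 2 = D / 2 by field.
  by rewrite /c Dh; ring.
- exact: cvg_cst.
- rewrite -[X in _ --> X](mulr0 (c^-1 * rho K)); apply: cvgM; first exact: cvg_cst.
  exact: powRN_cvg0.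
Qed.

(** The exponent D + e is placed halfway between D and 1, so that n rho(n) grows at least like
    n^((1-D)/2). *)
Lemma covariance_inv_cvg0 : (n%:R * rho n)^-1 @[n --> \oo] --> (0 : R).
Proof.
have e0 : 0 < (1 - D) / 2 by rewrite divr_gt0// subr_gt0.
have [K [K0 H]] := covariance_ratio e0.
pose E := D + (1 - D) / 2.
pose c := expR ((1 - D) / 2) * K%:R `^ (- E).
have c0 : 0 < c by rewrite mulr_gt0 ?expR_gt0// powR_gt0// ltr0n.
have rK : 0 < rho K by have /H[] : (K <= K <= K)%N by rewrite leqnn.
apply: (@squeeze_cvgr _ _ _ _ (cst 0) (fun n => c / rho K * n%:R `^ (- ((1 - D) / 2)))).
- exists K => // n /= Kn; have /H[_ rn h _] : (K <= K <= n)%N by rewrite leqnn Kn.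
  have n0 : 0 < n%:R :> R by rewrite ltr0n (leq_trans K0).
  apply/andP; split; first by rewrite invr_ge0 mulr_ge0//; exact: ltW.
  have E2 : c / rho K * n%:R `^ (- ((1 - D) / 2)) * (n%:R * rho n) =
      c * n%:R `^ (- ((1 - D) / 2)) * (n%:R * rho n) / rho K by ring.
  rewrite -[leLHS]mul1r ler_pdivrMr ?mulr_gt0// E2 ler_pdivlMr// mul1r.
  apply: le_trans h _; rewrite le_eqVlt; apply/orP; left; apply/eqP.
  have -> : n%:R `^ E = n%:R `^ (- ((1 - D) / 2)) * n%:R.
    by rewrite -[X in _ = _ * X]powRr1 ?ltW// -powRDpos//; congr (_ `^ _); rewrite /E; field.
  by rewrite /c -/E; ring.
- exact: cvg_cst.
- rewrite -[X in _ --> X](mulr0 (c / rho K)); apply: cvgM; first exact: cvg_cst.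
  exact: powRN_cvg0.
Qed.

(** Lags below [K] contribute a constant, absorbed because n rho(n) tends to infinity. For the
    others [covariance_ratio], with an exponent [E < 1], reduces to a sum of powers. *)
Lemma covariance_abs_sum_le : exists2 C : R, 0 < C &
  \forall n \near \oo, \sum_(0 <= k < n) `|rho k| <= C * (n%:R * rho n).
Proof.
have e0 : 0 < (1 - D) / 2 by rewrite divr_gt0// subr_gt0.
have [K [K0 H]] := covariance_ratio e0.
pose E := D + (1 - D) / 2; have E01 : 0 < E < 1 by move: D_gt0 D_lt1 => *; rewrite /E; apply/andP; split; lra.
have q0 : 0 < 1 - E by case/andP: E01 => *; rewrite subr_gt0.
pose C0 := \sum_(0 <= k < K) `|rho k|.
have C00 : 0 <= C0 by apply: sumr_ge0.
pose C1 := expR ((1 - D) / 2) / (1 - E).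
have C10 : 0 < C1 by rewrite divr_gt0// expR_gt0.
exists (1 + C1); first by rewrite addr_gt0.
have lim : C0 * (n%:R * rho n)^-1 @[n --> \oo] --> (0 : R).
  rewrite -[X in _ --> X](mulr0 C0); apply: cvgM; first exact: cvg_cst.
  exact: covariance_inv_cvg0.
have near1 : \forall n \near \oo, C0 * (n%:R * rho n)^-1 <= 1.
  by move/cvgr0Pnorm_le : lim => /(_ 1 ltr01); apply: filterS => n; apply: le_trans; exact: ler_norm.
near=> n.
have Kn : (K <= n)%N by near: n; exact: nbhs_infty_ge.
have n0N : (0 < n)%N by apply: leq_trans Kn.
have n0 : 0 < n%:R :> R by rewrite ltr0n.
have rn : 0 < rho n by have /H[] : (K <= n <= n)%N by rewrite Kn leqnn.
have nr : 0 < n%:R * rho n by rewrite mulr_gt0.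
rewrite (big_cat_nat (leq0n K) Kn)/= -/C0 mulrDl mul1r; apply: lerD.
  have : C0 * (n%:R * rho n)^-1 <= 1 by near: n.
  by rewrite ler_pdivrMr// mul1r.
apply: (@le_trans _ _ (\sum_(K <= k < n) expR ((1 - D) / 2) *
    (n%:R `^ E * k%:R `^ (- E)) * rho n)).
  rewrite big_nat_cond [leRHS]big_nat_cond; apply: ler_sum => k /andP[/andP[Kk kn] _].
  have /H[rk _ h _] : (K <= k <= n)%N by rewrite Kk ltnW.
  by rewrite gtr0_norm.
under eq_bigr do rewrite mulrA mulrAC.
rewrite -mulr_sumr.
have S : \sum_(K <= k < n) k%:R `^ (- E) <= n%:R `^ (1 - E) / (1 - E) :> R.
  apply: (@le_trans _ _ (\sum_(1 <= k < n.+1) k%:R `^ (- E))); last first.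
    by have /andP[] := sum_powRN_bounds n E01.
  rewrite (big_cat_nat K0 (leqW Kn))/=.
  rewrite (big_cat_nat Kn (leqnSn n))/= addrC -addrA lerDl.
  by rewrite addr_ge0// sumr_ge0// => *; exact: powR_ge0.
have p0 : 0 <= expR ((1 - D) / 2) * n%:R `^ E * rho n.
  by rewrite !mulr_ge0 ?expR_ge0 ?powR_ge0// ltW.
apply: le_trans (ler_wpM2l p0 S) _.
rewrite le_eqVlt; apply/orP; left; apply/eqP.
have nE : n%:R `^ E * n%:R `^ (1 - E) = n%:R :> R.
  by rewrite -powRDpos// addrC subrK powRr1// ltW.
transitivity (C1 * (n%:R `^ E * n%:R `^ (1 - E)) * rho n); first by rewrite /C1; ring.
by rewrite nE mulrA.
Unshelve. all: by end_near. Qed.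

End regularly_varying_covariance.

Section covariance_convolution.
Context {R : realType}.
Variables (L : R -> R) (D : R) (rho : nat -> R).
Hypotheses (D_gt0 : 0 < D) (D_lt1 : D < 1).
Hypothesis L_slow : slowly_varying L.
Hypothesis L_gt0 : \forall k \near \oo, 0 < L k%:R.
Hypothesis rhoE : forall k : nat, (0 < k)%N -> rho k = k%:R `^ (- D) * L k%:R.

Let T n := (\sum_(1 <= k < n) (n%:R - k%:R) * rho k) / (n%:R ^+ 2 * rho n).

(** The lags below [K] contribute O(n), negligible against n^2 rho(n). On the others [rho] is
    enclosed between multiples of k^(-E) and k^(-E'), whose convolutions are known. *)
Let conv_bounds e eta : 0 < e -> e < D -> e < 1 - D -> 0 < eta ->
  \forall n \near \oo,
    expR (- e) / ((1 - (D - e)) * (2 - (D - e))) - eta <= T n <=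
    expR e / ((1 - (D + e)) * (2 - (D + e))) + eta.
Proof.
move=> e0 eD e1D eta0; move: D_gt0 D_lt1 => D0 D1.
have [K [K0 H]] := covariance_ratio L_slow L_gt0 rhoE e0.
pose E := D + e; pose E' := D - e.
have E01 : 0 < E < 1 by rewrite /E; apply/andP; split; lra.
have E'01 : 0 < E' < 1 by rewrite /E'; apply/andP; split; lra.
have q'0 : 0 < 1 - E' by case/andP: E'01 => *; lra.
pose C0 := \sum_(1 <= k < K) `|rho k|.
have lim1 : C0 * (n%:R * rho n)^-1 @[n --> \oo] --> (0 : R).
  rewrite -[X in _ --> X](mulr0 C0); apply: cvgM; first exact: cvg_cst.
  by apply: (@covariance_inv_cvg0 R L D rho).
(* Collects the two errors of order n in the lower bound: the one of [conv_powRN_bounds] and the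
   omitted lags below [K]. *)
pose C2 := expR (- e) * ((1 - E')^-1 + K%:R).
have C20 : 0 <= C2 by rewrite mulr_ge0 ?expR_ge0// addr_ge0// invr_ge0 ltW.
have lim2 : C2 * n%:R `^ (- (1 - E')) @[n --> \oo] --> (0 : R).
  rewrite -[X in _ --> X](mulr0 C2); apply: cvgM; first exact: cvg_cst.
  exact: powRN_cvg0.
have h0 : 0 < eta / 2 by rewrite divr_gt0.
move/cvgr0Pnorm_le : lim1 => /(_ _ h0) near1.
move/cvgr0Pnorm_le : lim2 => /(_ _ h0) near2.
near=> n.
have n1 : `|C0 * (n%:R * rho n)^-1| <= eta / 2 by near: n.
have n2 : `|C2 * n%:R `^ (- (1 - E'))| <= eta / 2 by near: n.
have Kn : (K <= n)%N by near: n; exact: nbhs_infty_ge.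
have n0 : 0 < n%:R :> R by rewrite ltr0n (leq_trans K0).
have rn : 0 < rho n by have /H[] : (K <= n <= n)%N by rewrite Kn leqnn.
have N0 : 0 < n%:R ^+ 2 * rho n by rewrite mulr_gt0// exprn_gt0.
have nEp (F : R) : n%:R `^ F * n%:R `^ (2 - F) = n%:R ^+ 2 :> R.
  by rewrite -powRDpos// addrC subrK powR_mulrn// ltW.
set A := \sum_(1 <= k < K) (n%:R - k%:R) * rho k.
set M := \sum_(K <= k < n) (n%:R - k%:R) * rho k.
have TE : T n = A / (n%:R ^+ 2 * rho n) + M / (n%:R ^+ 2 * rho n).
  by rewrite /T (big_cat_nat K0 Kn)/= mulrDl.
have Ab : `|A / (n%:R ^+ 2 * rho n)| <= eta / 2.
  apply: le_trans n1; rewrite normrM (ger0_norm (_ : 0 <= _^-1)); last first.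
    by rewrite invr_ge0; exact: ltW.
  apply: le_trans (ler_norm _); rewrite ler_pdivrMr//.
  have -> : C0 * (n%:R * rho n)^-1 * (n%:R ^+ 2 * rho n) = n%:R * C0.
    by field; rewrite !gt_eqF.
  rewrite /A mulr_sumr; apply: le_trans (ler_norm_sum _ _ _) _.
  rewrite big_nat_cond [leRHS]big_nat_cond; apply: ler_sum => k /andP[/andP[_ kK] _].
  have kn : k%:R <= n%:R :> R by rewrite ler_nat ltnW// (leq_trans kK).
  rewrite normrM ler_wpM2r// ger0_norm ?subr_ge0//.
  by rewrite lerBlDr lerDl.
have nk k : (K <= k < n)%N -> [/\ 0 <= n%:R - k%:R :> R,
    rho k <= expR e * (n%:R `^ E * k%:R `^ (- E)) * rho n &
    expR (- e) * (n%:R `^ E' * k%:R `^ (- E')) * rho n <= rho k].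
  move=> /andP[Kk kn]; have /H[_ _ h1 h2] : (K <= k <= n)%N by rewrite Kk ltnW.
  by split => //; rewrite subr_ge0 ler_nat ltnW.
have Mup : M <= expR e * n%:R `^ E * rho n * \sum_(1 <= k < n) (n%:R - k%:R) * k%:R `^ (- E).
  rewrite (big_cat_nat K0 Kn)/= mulrDr; apply: ler_wpDl.
    apply: mulr_ge0; first by rewrite !mulr_ge0 ?expR_ge0 ?powR_ge0//; exact: ltW.
    rewrite big_nat_cond; apply: sumr_ge0 => k /andP[/andP[_ kK] _].
    by rewrite mulr_ge0 ?powR_ge0// subr_ge0 ler_nat ltnW// (leq_trans kK).
  rewrite mulr_sumr /M big_nat_cond [leRHS]big_nat_cond; apply: ler_sum => k /andP[/nk[k1 k2 _] _].
  apply: le_trans (ler_wpM2l k1 k2) _.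
  by rewrite le_eqVlt; apply/orP; left; apply/eqP; ring.
have Mlow : expR (- e) * n%:R `^ E' * rho n *
    (\sum_(1 <= k < n) (n%:R - k%:R) * k%:R `^ (- E') - n%:R * K%:R) <= M.
  apply: (@le_trans _ _ (expR (- e) * n%:R `^ E' * rho n *
      \sum_(K <= k < n) (n%:R - k%:R) * k%:R `^ (- E'))).
    apply: ler_wpM2l; first by rewrite !mulr_ge0 ?expR_ge0 ?powR_ge0//; exact: ltW.
    rewrite (big_cat_nat K0 Kn)/= addrAC gerDr subr_le0.
    apply: (@le_trans _ _ (\sum_(1 <= k < K) n%:R)).
      rewrite big_nat_cond [leRHS]big_nat_cond; apply: ler_sum => k /andP[/andP[k1 kK] _].
      have k1R : 1 <= k%:R :> R by rewrite ler1n.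
      rewrite -[leRHS]mulr1; apply: ler_pM; rewrite ?powR_ge0//.
      - by rewrite subr_ge0 ler_nat ltnW// (leq_trans kK).
      - by rewrite lerBlDr lerDl.
      - rewrite powRN invf_le1 ?powR_gt0 ?(lt_le_trans ltr01)//.
        by case/andP: E'01 => /ltW E'0 _; have := ler_powR k1R E'0; rewrite powRr0.
    rewrite sumr_const_nat -[n%:R *+ _]mulr_natr ler_wpM2l ?ler_nat ?leq_subr//.
  rewrite mulr_sumr /M big_nat_cond [leRHS]big_nat_cond; apply: ler_sum => k /andP[/nk[k1 _ k2] _].
  apply: le_trans (ler_wpM2l k1 k2).
  by rewrite le_eqVlt; apply/orP; left; apply/eqP; ring.
have /andP[_ cu] := conv_powRN_bounds n E01.
have /andP[cl _] := conv_powRN_bounds n E'01.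
have Mup' : M / (n%:R ^+ 2 * rho n) <= expR e / ((1 - E) * (2 - E)).
  rewrite ler_pdivrMr//; apply: le_trans Mup _.
  have p0 : 0 <= expR e * n%:R `^ E * rho n.
    by rewrite !mulr_ge0 ?expR_ge0 ?powR_ge0//; exact: ltW.
  apply: le_trans (ler_wpM2l p0 cu) _; rewrite -(nEp E).
  by rewrite le_eqVlt; apply/orP; left; apply/eqP; ring.
have Mlow' : expR (- e) / ((1 - E') * (2 - E')) - eta / 2 <= M / (n%:R ^+ 2 * rho n).
  rewrite ler_pdivlMr//; apply: le_trans Mlow.
  have p0 : 0 <= expR (- e) * n%:R `^ E' * rho n.
    by rewrite !mulr_ge0 ?expR_ge0 ?powR_ge0//; exact: ltW.
  apply: le_trans (ler_wpM2l p0 (lerB cl (lexx _))).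
  have nn : n%:R `^ E' * n%:R = n%:R ^+ 2 * n%:R `^ (- (1 - E')) :> R.
    rewrite -(nEp E') -mulrA -powRDpos// -[X in _ * X = _](powRr1 (ltW n0)).
    by congr (_ * _ `^ _); ring.
  have -> : expR (- e) * n%:R `^ E' * rho n *
     (n%:R `^ (2 - E') / ((1 - E') * (2 - E')) - n%:R / (1 - E') - n%:R * K%:R) =
     (expR (- e) / ((1 - E') * (2 - E')) * (n%:R `^ E' * n%:R `^ (2 - E')) -
      C2 * (n%:R `^ E' * n%:R)) * rho n by rewrite /C2; ring.
  rewrite nEp nn.
  set X := expR (- e) / _; set y := n%:R `^ _ in n2 *.
  have -> : (X * n%:R ^+ 2 - C2 * (n%:R ^+ 2 * y)) * rho n = (X - C2 * y) * (n%:R ^+ 2 * rho n).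
    by ring.
  apply: ler_wpM2r; first exact: ltW.
  apply: lerB => //.
  by apply: le_trans n2; exact: ler_norm.
rewrite TE; move: Ab Mup' Mlow'; rewrite ler_norml -/E -/E'.
set a := A / _; set m := M / _; set l := expR (- e) / _; set u := expR e / _.
move: a m l u => a m l u /andP[a1 a2] m1 m2.
by apply/andP; split; lra.
Unshelve. all: by end_near. Qed.

(** The two bounds of [conv_bounds] are the values at e and - e of one function [u], continuous at
    0. *)
Lemma covariance_conv_cvg : T n @[n --> \oo] --> ((1 - D) * (2 - D))^-1.
Proof.
move: D_gt0 D_lt1 => D0 D1.
pose u (e : R) := expR e / ((1 - (D + e)) * (2 - (D + e))).
have uE : u 0 = ((1 - D) * (2 - D))^-1 by rewrite /u expR0 mul1r !addr0.
have cu : {for 0, continuous u}.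
  rewrite /u; apply: cvgM; first exact: continuous_expR.
  have cl (c : R) : {for 0, continuous (fun e : R => c - (D + e))}.
    by apply: cvgB; [exact: cvg_cst|apply: cvgD; [exact: cvg_cst|exact: cvg_id]].
  apply: cvgV; first by rewrite addr0 gt_eqF// mulr_gt0//; lra.
  by apply: cvgM; exact: cl.
apply/cvgrPdist_le => eta eta0.
have h0 : 0 < eta / 2 by rewrite divr_gt0.
move/cvgrPdist_le : cu => /(_ _ h0) [r /= r0 Hr].
(* Small enough for the continuity of [u], and such that D - e and D + e stay in ]0, 1[. *)
pose e := Num.min (r / 2) (Num.min (D / 2) ((1 - D) / 2)).
have e0 : 0 < e by rewrite !lt_min !divr_gt0//= subr_gt0.
have er : e < r.
  apply: (@le_lt_trans _ _ (r / 2)); last by lra.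
  by rewrite /e ge_min lexx.
have eD : e < D.
  apply: (@le_lt_trans _ _ (D / 2)); last by lra.
  by rewrite /e !ge_min lexx !orbT.
have e1D : e < 1 - D.
  apply: (@le_lt_trans _ _ ((1 - D) / 2)); last by lra.
  by rewrite /e !ge_min lexx !orbT.
have H1 : `|u 0 - u e| <= eta / 2 by apply: Hr; rewrite /ball/= sub0r normrN gtr0_norm.
have H2 : `|u 0 - u (- e)| <= eta / 2.
  by apply: Hr; rewrite /ball/= sub0r opprK gtr0_norm.
apply: filterS (conv_bounds e0 eD e1D h0) => n; rewrite -uE.
rewrite -[X in _ <= T n <= X + _]/(u e) -[X in X - _ <= T n <= _]/(u (- e)).
move: H1 H2; rewrite !ler_norml => /andP[? ?] /andP[? ?] /andP[? ?].
by apply/andP; split; lra.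
Qed.

End covariance_convolution.

(** * The kernel of the Hermite process *)

Section truncated_powers.
Context {R : realType}.
Local Notation mu := (@lebesgue_measure R).

(** The truncated power of y_+. Integrals over half-lines become integrals over the line, so affine
    substitutions carry no bounds. Since 0 to the power 0 is 1, it vanishes on the negatives only
    for a nonzero exponent. *)
Definition ppow (a y : R) : R := Num.max y 0 `^ a.

Lemma ppow_ge0 a y : 0 <= ppow a y. Proof. exact: powR_ge0. Qed.

Lemma ppow_gt0E a y : 0 < y -> ppow a y = y `^ a.
Proof. by move=> y0; rewrite /ppow max_l// ltW. Qed.

Lemma ppow_le0E a y : a != 0 -> y <= 0 -> ppow a y = 0.
Proof. by move=> a0 y0; rewrite /ppow max_r// powR0. Qed.

Lemma measurable_ppow a : measurable_fun setT (ppow a).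
Proof.
apply: (@measurableT_comp _ _ _ _ _ _ (fun y : R => y `^ a)) => //.
exact: measurable_maxr.
Qed.

Lemma ppowM a c y : 0 < c -> ppow a (c * y) = c `^ a * ppow a y.
Proof.
move=> c0; have -> : ppow a (c * y) = (c * Num.max y 0) `^ a.
  by rewrite maxr_pMr ?(ltW c0)// mulr0.
by rewrite powRM ?(ltW c0)// le_max lexx orbT.
Qed.

(** For q < 1 the integrand is singular at 0: the fundamental theorem is applied on
    [1 / (n + 1), c], and monotone convergence closes the gap. *)
Lemma integral_ppow (q c : R) : 0 < q -> q != 1 -> 0 <= c ->
  (\int[mu]_(y in `]-oo, c]) (ppow (q - 1) y)%:E = (c `^ q / q)%:E)%E.
Proof.
move=> q0 q1 c0; have qn : q - 1 != 0 by rewrite subr_eq0.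
have mp := measurable_ppow (q - 1).
have [c0'|cp] := leP c 0.
  have -> : c = 0 by apply/le_anti; rewrite c0 c0'.
  rewrite powR0 ?gt_eqF// mul0r; apply: integral0_eq => y /=.
  by rewrite in_itv/= => y0; rewrite ppow_le0E.
pose f_ n (y : R) : \bar R := ((fun y => (ppow (q - 1) y)%:E) \_ (`[n.+1%:R^-1, c] : set R)) y.
have ind (n : nat) : 0 < n.+1%:R^-1 :> R by rewrite invr_gt0 ltr0n.
have mE D : measurable D -> measurable_fun D (fun y => (ppow (q - 1) y)%:E).
  by move=> mD; apply/measurable_EFinP; exact: measurable_funTS.
have mf_ n : measurable_fun setT (f_ n).
  by apply/(measurable_restrictT _ _).1 => //; exact: mE.
have f0 n y : (0 <= f_ n y)%E.
  by rewrite /f_ patchE; case: ifP => // _; rewrite lee_fin ppow_ge0.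
have limf y : f_ n y @[n --> \oo] --> ((fun y => (ppow (q - 1) y)%:E) \_ (`]-oo, c] : set R)) y.
  apply: cvg_near_cst; have [y0|y0] := leP y 0.
    apply: nearW => n; rewrite /f_ !patchE; case: ifPn => [|_]; case: ifPn => //= *; rewrite ?ppow_le0E//.
  have := @cvg_harmonic R => /cvgr0Pnorm_lt/(_ _ y0); apply: filterS => n /=.
  rewrite ger0_norm// => ny; rewrite /f_ !patchE.
  have -> : (y \in `[n.+1%:R^-1, c]%classic) = (y \in `]-oo, c]%classic).
    by apply/idP/idP; rewrite !inE/= !in_itv/= ?(ltW ny)// => /andP[].
  by [].
rewrite integral_mkcond.
transitivity (limn (fun n => \int[mu]_y f_ n y)%E).
  rewrite -monotone_convergence//.
  - by apply: eq_integral => y _; apply/esym/cvg_lim => //; exact: limf.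
  - move=> y _ m n mn; rewrite /f_ !patchE.
    case: ifPn => [|_]; last by case: ifPn => // _; rewrite lee_fin ppow_ge0.
    rewrite inE/= in_itv/= => /andP[y1 y2]; rewrite mem_set//= in_itv/= y2 andbT.
    by apply: le_trans y1; rewrite lef_pV2 ?posrE ?ltr0n// ler_nat.
apply/cvg_lim => //.
have near1 : \forall n \near \oo, n.+1%:R^-1 < c.
  by have := @cvg_harmonic R => /cvgr0Pnorm_lt/(_ _ cp); apply: filterS => n /=; rewrite ger0_norm.
have lim2 : (c `^ q / q - n.+1%:R^-1 `^ q / q)%:E @[n --> \oo] --> (c `^ q / q)%:E.
  apply: cvg_EFin; first by apply: nearW.
  rewrite -[X in _ --> X]subr0; apply: cvgB; first exact: cvg_cst.
  rewrite -(mul0r q^-1); apply: cvgM; last exact: cvg_cst.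
  have := powRN_cvg0 q0; rewrite -(cvg_shiftS (fun n => n%:R `^ (- q) : R)).
  rewrite (_ : (fun n => n.+1%:R `^ (- q) : R) = (fun n => n.+1%:R^-1 `^ q))//.
  by apply/funext => n; rewrite -[n.+1%:R^-1]powR_inv1 ?ler0n// -powRrM mulN1r.
apply: cvg_trans lim2; apply: near_eq_cvg.
apply: filterS near1 => n nc; rewrite /f_ -integral_mkcond.
rewrite (_ : (\int[mu]_(y in _) _)%E = (\int[mu]_(y in `[(n.+1%:R^-1)%R, c]) (y `^ (q - 1))%:E)%E); last first.
  apply: eq_integral => y; rewrite inE/= in_itv/= => /andP[y1 _].
  by rewrite ppow_gt0E// (lt_le_trans (ind n)).
have dF (y : R) : 0 < y -> is_derive y (1 : R) (fun y => y `^ q / q) (y `^ (q - 1)).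
  move=> y0; have h : is_derive y (1 : R) (@powR R ^~ q) (q * y `^ (q - 1)).
    exact: is_derive1_powR.
  by apply: is_derive_eq; rewrite /GRing.scale/=; field; rewrite gt_eqF.
have cF (y : R) : 0 < y -> {for y, continuous (fun y : R => y `^ q / q)}.
  by move=> y0; apply: differentiable_continuous; apply/derivable1_diffP; case: (dF y y0).
rewrite (@continuous_FTC2 _ _ (fun y => y `^ q / q))//.
- apply: derivable_within_continuous => y; rewrite in_itv/= => /andP[y1 _].
  have y0 := lt_le_trans (ind n) y1.
  have h : is_derive y (1 : R) (@powR R ^~ (q - 1)) ((q - 1) * y `^ (q - 1 - 1)).
    exact: is_derive1_powR.
  by case: h.
- split.
  + by move=> y; rewrite in_itv/= => /andP[y1 _]; case: (dF y (lt_trans (ind n) y1)).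
  + by apply: cvg_at_right_filter; apply: cF.
  + by apply: cvg_at_left_filter; apply: cF.
- move=> y; rewrite in_itv/= => /andP[y1 _]; rewrite derive1E.
  by case: (dF y (lt_trans (ind n) y1)).
Qed.

(* [Gamma a] as an integral over the whole line, for [0 < a < 1]. *)
Definition egamma (a : R) : \bar R := (\int[mu]_s (ppow (a - 1) s * expR (- s))%:E)%E.

Let mEF (f : R -> R) D : measurable D -> measurable_fun setT f ->
  measurable_fun D (fun x => (f x)%:E).
Proof. by move=> mD mf; apply/measurable_EFinP; exact: measurable_funTS. Qed.

Let mexp (c : R) : measurable_fun setT (fun s : R => expR (- (c * s))).
Proof. by apply: measurableT_comp => //; apply: measurableT_comp => //; exact: measurable_funM. Qed.

Let mgam (a c : R) : measurable_fun setT (fun s : R => ppow (a - 1) s * expR (- (c * s))).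
Proof. by apply: measurable_funM; [exact: measurable_ppow|exact: mexp]. Qed.

(** Positivity comes from the part s <= 1, where exp (- s) >= exp (-1). For finiteness the
    exponential is dropped when s <= 1 and the power, at most 1, when s > 1. *)
Lemma egamma_bounds a : 0 < a < 1 -> exists2 g : R, 0 < g & egamma a = g%:E.
Proof.
move=> /andP[a0 a1]; have an : a - 1 != 0 by rewrite lt_eqF// subr_lt0.
have m1 : measurable_fun setT (fun s : R => ppow (a - 1) s * expR (- s)).
  by have := mgam a 1; under eq_fun do rewrite mul1r.
have pos s : 0 <= ppow (a - 1) s * expR (- s) by rewrite mulr_ge0 ?ppow_ge0 ?expR_ge0.
have lowb : ((expR (-1) * (1 `^ a / a))%:E <= egamma a)%E.
  rewrite EFinM -(integral_ppow a0 (negbT (lt_eqF a1)) ler01) -ge0_integralZl//; last 2 first.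
  - by apply: mEF => //; exact: measurable_ppow.
  - by move=> s _; rewrite lee_fin ppow_ge0.
  apply: (@le_trans _ _ (\int[mu]_(s in `]-oo, 1%R]) (ppow (a - 1) s * expR (- s))%:E)%E).
    apply: ge0_le_integral => //.
    - by move=> s _; rewrite mule_ge0 ?lee_fin ?expR_ge0 ?ppow_ge0.
    - by apply: measurable_funeM; apply: mEF => //; exact: measurable_ppow.
    - exact: (mEF _ m1).
    - move=> s /=; rewrite in_itv/= => s1; rewrite -EFinM lee_fin mulrC ler_wpM2l ?ppow_ge0//.
      by rewrite ler_expR lerN2.
  by apply: ge0_subset_integral => //; [exact: (mEF _ m1)|move=> s _; rewrite lee_fin].
have upb : (egamma a <= (1 `^ a / a)%:E + 1)%E.
  have e1 : (\int[mu]_s (exponential_pdf 1 s)%:E = 1 :> \bar R)%E.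
    by apply: integral_exponential_pdf.
  rewrite -(integral_ppow a0 (negbT (lt_eqF a1)) ler01) -[X in (_ + X)%E]e1 [X in (X + _)%E]integral_mkcond.
  rewrite -ge0_integralD//; last 4 first.
  - by move=> s _; rewrite erestrict_ge0// => y _; rewrite lee_fin ppow_ge0.
  - by apply/(measurable_restrictT _ _).1 => //; apply: mEF => //; exact: measurable_ppow.
  - by move=> s _; rewrite lee_fin exponential_pdf_ge0.
  - by apply: mEF => //; exact: measurable_exponential_pdf.
  apply: ge0_le_integral => //.
  - by move=> s _; rewrite lee_fin.
  - exact: (mEF _ m1).
  - apply: emeasurable_funD.
      by apply/(measurable_restrictT _ _).1 => //; apply: mEF => //; exact: measurable_ppow.
    by apply: mEF => //; exact: measurable_exponential_pdf.
  move=> s _; rewrite patchE; case: ifPn => [_|].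
    rewrite -EFinD lee_fin; apply: ler_wpDr; first exact: exponential_pdf_ge0.
    have [s0|s0] := leP s 0; first by rewrite ppow_le0E// mul0r.
    by rewrite ler_piMr ?ppow_ge0// -expR0 ler_expR oppr_le0 ltW.
  rewrite notin_setE/= in_itv/= => /negP; rewrite -ltNge => s1.
  have s0 : 0 < s by apply: lt_trans s1.
  rewrite add0e lee_fin (exponential_pdfE _ (ltW s0)) mul1r mulN1r ler_piMl ?expR_ge0//.
  have am : a - 1 <= 0 by rewrite subr_le0 ltW.
  by rewrite ppow_gt0E//; have := ler_powR (ltW s1) am; rewrite powRr0.
have fin : egamma a \is a fin_num.
  rewrite ge0_fin_numE; first by apply: le_lt_trans upb _; rewrite -EFinD ltry.
  by apply: integral_ge0 => s _; rewrite lee_fin.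
exists (fine (egamma a)); last by rewrite fineK.
rewrite -lte_fin fineK//; apply: lt_le_trans lowb; rewrite lte_fin.
by rewrite powR1 mulr_gt0 ?expR_gt0// divr_gt0.
Qed.

Lemma Gamma_egamma a : 0 < a < 1 -> (Gamma a)%:E = egamma a.
Proof.
move=> a01; have [g _ gE] := egamma_bounds a01; have /andP[a0 a1] := a01.
have an : a - 1 != 0 by rewrite lt_eqF// subr_lt0.
rewrite /Gamma /Rintegral.
have E : (\int[mu]_(x in `]0%R, +oo[) (x `^ (a - 1) * expR (- x))%:E = egamma a)%E.
  rewrite integral_mkcond; apply: eq_integral => x _; rewrite patchE.
  case: ifPn => [|].
    by rewrite inE/= in_itv/= andbT => x0; rewrite ppow_gt0E.
  rewrite notin_setE/= in_itv/= andbT => /negP; rewrite -leNgt => x0.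
  by rewrite ppow_le0E ?mul0r.
by rewrite gE; congr EFin; rewrite gE in E; exact: (congr1 fine E).
Qed.

Lemma egamma_scale a c : 0 < a < 1 -> 0 < c ->
  (\int[mu]_s (ppow (a - 1) s * expR (- (c * s)))%:E = (c `^ (- a))%:E * egamma a)%E.
Proof.
move=> /andP[a0 a1] c0; have ci : 0 < c^-1 by rewrite invr_gt0.
rewrite (@ge0_integral_affine _ (c^-1) 0); last 3 first.
- by rewrite gt_eqF.
- by apply: mEF.
- by move=> s; rewrite lee_fin mulr_ge0 ?ppow_ge0 ?expR_ge0.
rewrite gtr0_norm//.
under eq_integral => s _.
  rewrite addr0 ppowM// mulVKf ?gt_eqF// -mulrA EFinM; over.
rewrite ge0_integralZl//; last 3 first.
- by apply: mEF => //; have := mgam a 1; under eq_fun do rewrite mul1r.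
- by move=> s _; rewrite lee_fin mulr_ge0 ?ppow_ge0 ?expR_ge0.
- by rewrite lee_fin powR_ge0.
rewrite muleA -EFinM; congr (_%:E * _)%E.
rewrite -{1}(powRr1 (ltW ci)) -powRDpos// addrCA subrr addr0.
by rewrite -powR_inv1 ?(ltW c0)// -powRrM mulN1r.
Qed.

Lemma tonelli (f : R -> R -> \bar R) :
  measurable_fun setT (fun z : measurableTypeR R * measurableTypeR R => f z.1 z.2) ->
  (forall x y, 0 <= f x y)%E ->
  (\int[mu]_x \int[mu]_y f x y = \int[mu]_y \int[mu]_x f x y)%E.
Proof.
move=> mf f0.
by have := @fubini_tonelli _ _ (measurableTypeR R) (measurableTypeR R) R mu mu
  (fun z => f z.1 z.2) mf (fun z => f0 z.1 z.2).
Qed.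

Lemma measurable_tonelli (f : R -> R -> \bar R) :
  measurable_fun setT (fun z : measurableTypeR R * measurableTypeR R => f z.1 z.2) ->
  (forall x y, 0 <= f x y)%E ->
  measurable_fun setT (fun x => (\int[mu]_y f x y)%E).
Proof.
move=> mf f0.
by have := @measurable_fun_fubini_tonelli_F _ _ (measurableTypeR R) (measurableTypeR R) R mu
  (fun z => f z.1 z.2) mf (fun z => f0 z.1 z.2).
Qed.

End truncated_powers.

Section kernel_norm.
Context {R : realType}.
Local Notation mu := (@lebesgue_measure R).
Variable D : R.
Hypotheses (D_gt0 : 0 < D) (D_lt1 : D < 1).
(** The kernel has exponent q - 1 = - a, and q + D = a; these two relations make the Beta function
    appear with arguments q and D. *)
Let q : R := (1 - D) / 2.
Let a : R := (1 + D) / 2.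

Let q01 : 0 < q < 1.
Proof. by move: D_gt0 D_lt1 => *; rewrite /q; apply/andP; split; lra. Qed.

Let a01 : 0 < a < 1.
Proof. by move: D_gt0 D_lt1 => *; rewrite /a; apply/andP; split; lra. Qed.

Let qn : q - 1 != 0.
Proof. by case/andP: q01 => _ q1; rewrite lt_eqF// subr_lt0. Qed.

Let mEF (f : R -> R) (S : set R) : measurable S -> measurable_fun setT f ->
  measurable_fun S (fun x => (f x)%:E).
Proof. by move=> mS mf; apply/measurable_EFinP; exact: measurable_funTS. Qed.

Let mp1 b : measurable_fun setT
  (fun z : measurableTypeR R * measurableTypeR R => ppow b z.1).
Proof. exact: (measurableT_comp (measurable_ppow b) measurable_fst). Qed.

Let mp2 b : measurable_fun setT
  (fun z : measurableTypeR R * measurableTypeR R => ppow b z.2).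
Proof. exact: (measurableT_comp (measurable_ppow b) measurable_snd). Qed.

(** The Beta integral of the second kind. Gamma (a) (1 + y)^(-a) is the integral of s^(a-1) exp (-
    (1 + y) s); after exchanging the integrals, y gives Gamma (q) s^(-q) and s gives Gamma (D). *)
Lemma beta_integral :
  (\int[mu]_y (ppow (q - 1) y * ppow (q - 1) (1 + y))%:E = (kD D)%:E)%E /\ 0 < kD D.
Proof.
have [gq gq0 Eq] := egamma_bounds q01; have [ga ga0 Ea] := egamma_bounds a01.
have D01 : 0 < D < 1 by rewrite D_gt0 D_lt1.
have [gD gD0 ED] := egamma_bounds D01.
have kE : kD D = gq * gD / ga.
  rewrite /kD /Beta (_ : (1 - D) / 2 + D = a); last by rewrite /a; field.
  have GE (b g : R) : 0 < b < 1 -> egamma b = g%:E -> Gamma b = g.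
    by move=> b01 bE; apply: EFin_inj; rewrite Gamma_egamma.
  by rewrite (GE _ _ q01 Eq) (GE _ _ a01 Ea) (GE _ _ D01 ED).
split; last by rewrite kE divr_gt0// mulr_gt0.
set b := (\int[mu]_y _)%E.
have mpp : measurable_fun setT (fun y : R => ppow (q - 1) y * ppow (q - 1) (1 + y)).
  apply: measurable_funM; first exact: measurable_ppow.
  by apply: (measurableT_comp (measurable_ppow _)); exact: measurable_funD.
(* The finiteness of [b] is not yet known; it follows from this identity in the extended reals, as
   [ga] is positive. *)
suff H : (ga%:E * b = (gq * gD)%:E)%E.
  have b0 : (0 <= b)%E by apply: integral_ge0 => y _; rewrite lee_fin mulr_ge0 ?ppow_ge0.
  move: H b0; case: b => [r| |] //=.
    by move=> [H] _; rewrite kE -H mulrAC mulfV ?mul1r// gt_eqF.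
  by rewrite gt0_muley ?lte_fin.
rewrite -ge0_integralZl//; last 3 first.
- exact: mEF.
- by move=> y _; rewrite lee_fin mulr_ge0 ?ppow_ge0.
- by rewrite lee_fin ltW.
pose f y s := ppow (q - 1) y * (ppow (a - 1) s * expR (- ((1 + y) * s))).
have f0 y s : 0 <= f y s by rewrite !mulr_ge0 ?ppow_ge0 ?expR_ge0.
have mf : measurable_fun setT
    (fun z : measurableTypeR R * measurableTypeR R => (f z.1 z.2)%:E).
  apply/measurable_EFinP; apply: measurable_funM; first exact: mp1.
  apply: measurable_funM; first exact: mp2.
  apply: measurableT_comp => //; apply: measurableT_comp => //.
  by apply: measurable_funM => //; apply: measurable_funD.
transitivity (\int[mu]_y \int[mu]_s (f y s)%:E)%E.
  apply: eq_integral => y _; have [y0|y0] := leP y 0.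
    rewrite ppow_le0E// mul0r mule0; apply/esym/integral0_eq => s _.
    by rewrite /f ppow_le0E// mul0r.
  have y1 : 0 < 1 + y by rewrite addr_gt0.
  rewrite /f; under eq_integral do rewrite EFinM.
  rewrite ge0_integralZl//; last 3 first.
  - apply: mEF => //; apply: measurable_funM; first exact: measurable_ppow.
    by apply: measurableT_comp => //; apply: measurableT_comp => //; exact: measurable_funM.
  - by move=> s _; rewrite lee_fin mulr_ge0 ?ppow_ge0 ?expR_ge0.
  - by rewrite lee_fin ppow_ge0.
  rewrite (egamma_scale a01 y1) Ea -!EFinM; congr EFin.
  rewrite (ppow_gt0E _ y1) (_ : - a = q - 1); last by rewrite /a /q; field.
  by ring.
rewrite (tonelli mf)//.
transitivity (\int[mu]_s (gq%:E * (ppow (D - 1) s * expR (- s))%:E))%E.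
  apply: eq_integral => s _; have [s0|s0] := leP s 0.
    have an : a - 1 != 0 by case/andP: a01 => _ a1; rewrite lt_eqF// subr_lt0.
    have Dn : D - 1 != 0 by rewrite lt_eqF// subr_lt0.
    rewrite (ppow_le0E Dn s0) mul0r mule0; apply/integral0_eq => y _.
    by rewrite /f (ppow_le0E an s0) mul0r mulr0.
  rewrite (_ : (fun y => _) = fun y => ((ppow (a - 1) s * expR (- s))%:E *
      (ppow (q - 1) y * expR (- (s * y)))%:E)%E); last first.
    apply/funext => y; rewrite -EFinM /f.
    have -> : expR (- ((1 + y) * s)) = expR (- s) * expR (- (s * y)).
      by rewrite -expRD; congr expR; ring.
    by congr EFin; ring.
  rewrite ge0_integralZl//; last 3 first.
  - apply: mEF => //; apply: measurable_funM; first exact: measurable_ppow.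
    by apply: measurableT_comp => //; apply: measurableT_comp => //; exact: measurable_funM.
  - by move=> y _; rewrite lee_fin mulr_ge0 ?ppow_ge0 ?expR_ge0.
  - by rewrite lee_fin mulr_ge0 ?ppow_ge0 ?expR_ge0.
  rewrite (egamma_scale q01 s0) Eq -!EFinM; congr EFin.
  rewrite !(ppow_gt0E _ s0) (_ : D - 1 = a - 1 + (- q)); last by rewrite /a /q; field.
  by rewrite (powRDpos (a - 1) (- q) s0); ring.
rewrite ge0_integralZl//; last 3 first.
- apply: mEF => //; apply: measurable_funM; first exact: measurable_ppow.
  by apply: measurableT_comp.
- by move=> s _; rewrite lee_fin mulr_ge0 ?ppow_ge0 ?expR_ge0.
- by rewrite lee_fin ltW.
by rewrite -[(\int[mu]_s _)%E]/(egamma D) ED -EFinM.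
Qed.

Let ind (u : R) : R := \1_(`[0, 1]) u.

Let ind_ge0 u : 0 <= ind u.
Proof. by rewrite /ind indicE ler0n. Qed.

Let mind : measurable_fun setT ind.
Proof. exact: measurable_indic. Qed.

Let indE u : ind u = (0 <= u <= 1)%R%:R.
Proof.
rewrite /ind indicE; suff -> : (u \in `[0, 1]%classic) = (0 <= u <= 1) by [].
by apply/idP/idP; rewrite inE/= in_itv.
Qed.

Let mpaff b c d : measurable_fun setT (fun v : R => ppow b (c * v + d)).
Proof.
apply: (measurableT_comp (measurable_ppow b)).
by apply: measurable_funD => //; exact: measurable_funM.
Qed.

Lemma integral_ppowBl (p c : R) : -1 < p -> p != 0 -> 0 <= c <= 1 ->
  (\int[mu]_v (ind v * ppow p (c - v))%:E = (c `^ (p + 1) / (p + 1))%:E)%E.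
Proof.
move=> p1 pn /andP[c0 c1].
have m1 : measurable_fun setT (fun v : R => ind v * ppow p (c - v)).
  apply: measurable_funM => //; have := mpaff p (-1) c.
  by under eq_fun do rewrite mulN1r addrC.
rewrite (@ge0_integral_affine _ (-1) c); last 3 first.
- by rewrite oppr_eq0 oner_neq0.
- exact: mEF.
- by move=> v; rewrite lee_fin mulr_ge0 ?ppow_ge0.
rewrite normrN1 mul1e -(@integral_ppow _ (p + 1) c)//; last 2 first.
- by rewrite -ltrBlDr sub0r.
- by rewrite -subr_eq0 addrK.
rewrite [RHS]integral_mkcond; apply: eq_integral => y _; rewrite patchE addrK.
rewrite (_ : c - (-1 * y + c) = y); last by ring.
have [y0|y0] := leP y 0; first by rewrite ppow_le0E// mulr0; case: ifP.
rewrite indE (_ : (0 <= -1 * y + c <= 1) = (y <= c)); last first.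
  by apply/idP/idP => [/andP[]|] *; [lra|apply/andP; split; lra].
have -> : (y \in `]-oo, c]%classic) = (y <= c) by apply/idP/idP; rewrite inE/= in_itv.
by case: ifP; rewrite ?mul1r ?mul0r.
Qed.

Lemma integral_ppowBr (p c : R) : -1 < p -> p != 0 -> 0 <= c <= 1 ->
  (\int[mu]_v (ind v * ppow p (v - c))%:E = ((1 - c) `^ (p + 1) / (p + 1))%:E)%E.
Proof.
move=> p1 pn /andP[c0 c1].
have m1 : measurable_fun setT (fun v : R => ind v * ppow p (v - c)).
  apply: measurable_funM => //; have := mpaff p 1 (- c).
  by under eq_fun do rewrite mul1r.
have m2 : measurable_fun setT (fun v : R => ind v * ppow p (1 - c - v)).
  apply: measurable_funM => //; have := mpaff p (-1) (1 - c).
  by under eq_fun do rewrite mulN1r addrC.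
rewrite -integral_ppowBl//; last by apply/andP; split; lra.
rewrite (@ge0_integral_affine _ (-1) 1); last 3 first.
- by rewrite oppr_eq0 oner_neq0.
- exact: mEF.
- by move=> v; rewrite lee_fin mulr_ge0 ?ppow_ge0.
rewrite normrN1 mul1e; apply: eq_integral => v _.
rewrite !indE; congr ((_ * ppow _ _)%:E); last by ring.
suff -> : (0 <= -1 * v + 1 <= 1) = (0 <= v <= 1) by [].
by apply/idP/idP => /andP[] *; apply/andP; split; lra.
Qed.

Let w (y : R) := ppow (q - 1) y.

Let mw : measurable_fun setT w.
Proof. exact: measurable_ppow. Qed.

Let w_ge0 y : 0 <= w y.
Proof. exact: ppow_ge0. Qed.

Let J (u v : R) : \bar R := (\int[mu]_x (w (u - x) * w (v - x))%:E)%E.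

Let JC u v : J u v = J v u.
Proof. by apply: eq_integral => x _; rewrite mulrC. Qed.

Let mww u v : measurable_fun setT (fun x : R => w (u - x) * w (v - x)).
Proof.
by apply: measurable_funM; apply: (measurableT_comp mw); exact: measurable_funB.
Qed.

(** The substitution x = u - h y, with h = v - u, scales to the Beta integral; the power of h is 1 +
    2 (q - 1) = - D. *)
Let J_lt u v : u < v -> J u v = (kD D * ppow (- D) (v - u))%:E.
Proof.
move=> uv; set h := v - u; have h0 : 0 < h by rewrite subr_gt0.
rewrite /J (@ge0_integral_affine _ (- h) u); last 3 first.
- by rewrite oppr_eq0 gt_eqF.
- exact: mEF.
- by move=> x; rewrite lee_fin mulr_ge0.
rewrite normrN gtr0_norm//.
under eq_integral => x _.
  rewrite (_ : u - (- h * x + u) = h * x); last by ring.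
  rewrite (_ : v - (- h * x + u) = h * (1 + x)); last by rewrite /h; ring.
  rewrite /w !ppowM// mulrACA EFinM; over.
rewrite ge0_integralZl//; last 3 first.
- apply: mEF => //; apply: measurable_funM; first exact: measurable_ppow.
  by apply: (measurableT_comp (measurable_ppow _)); exact: measurable_funD.
- by move=> x _; rewrite lee_fin mulr_ge0 ?ppow_ge0.
- by rewrite lee_fin mulr_ge0 ?powR_ge0.
have [-> _] := beta_integral; rewrite -!EFinM ppow_gt0E//; congr EFin.
rewrite -{1}(powRr1 (ltW h0)) mulrA -!powRDpos// mulrC; congr (_ * _ `^ _).
by rewrite /q; field.
Qed.

(** One of the two truncated powers is 0, so their sum is |u - v|^(-D) without a case distinction.
    On the diagonal the integral diverges. *)
Let J_neq u v : v != u ->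
  J u v = (kD D * (ppow (- D) (u - v) + ppow (- D) (v - u)))%:E.
Proof.
have Dn : - D != 0 by rewrite oppr_eq0 gt_eqF.
rewrite neq_lt => /orP[vu|uv].
  by rewrite JC J_lt// (ppow_le0E Dn (_ : v - u <= 0)) ?addr0// subr_le0 ltW.
by rewrite J_lt// (ppow_le0E Dn (_ : u - v <= 0)) ?add0r// subr_le0 ltW.
Qed.

Let k (x : R) : \bar R := (\int[mu]_u (ind u * w (u - x))%:E)%E.

Let U (u x : R) := ind u * w (u - x).

Let U_ge0 u x : 0 <= U u x.
Proof. by rewrite mulr_ge0. Qed.

Let mU : measurable_fun setT (fun z : measurableTypeR R * measurableTypeR R => U z.2 z.1).
Proof.
apply: measurable_funM; first exact: (measurableT_comp mind measurable_snd).
by apply: (measurableT_comp mw); apply: measurable_funB.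
Qed.

Let mk : measurable_fun setT k.
Proof.
apply: (measurable_tonelli (f := fun x u => (U u x)%:E)).
  exact/measurable_EFinP.
by move=> x u; rewrite lee_fin.
Qed.

Let k_ge0 x : (0 <= k x)%E.
Proof. by apply: integral_ge0 => u _; rewrite lee_fin mulr_ge0. Qed.

Let k_fin x : k x \is a fin_num.
Proof.
rewrite ge0_fin_numE//; have /andP[q0 q1] := q01.
have mx : measurable_fun setT (fun u : R => ind u * w (u - x)).
  by apply: measurable_funM => //; apply: (measurableT_comp mw); exact: measurable_funB.
pose c := Num.max (1 - x) 0; have c0 : 0 <= c by rewrite le_max lexx orbT.
apply: (@le_lt_trans _ _ (\int[mu]_(y in `]-oo, c]) (w y)%:E)%E); last first.
  by rewrite (integral_ppow q0 (negbT (lt_eqF q1)) c0) ltry.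
rewrite /k (@ge0_integral_affine _ 1 x) ?oner_neq0//; last 2 first.
- exact: mEF.
- by move=> u; rewrite lee_fin mulr_ge0.
rewrite normr1 mul1e [leRHS]integral_mkcond; apply: ge0_le_integral => //.
- by move=> u _; rewrite lee_fin mulr_ge0.
- apply: mEF => //; apply: (@measurableT_comp _ _ _ _ _ _ (fun u : R => ind u * w (u - x))) => //.
  by apply: measurable_funD => //; exact: measurable_funM.
- by apply/(measurable_restrictT _ _).1 => //; apply: mEF.
move=> u _; rewrite patchE mul1r addrK; case: ifPn => [_|].
  by rewrite lee_fin ler_piMl// indE lern1 leq_b1.
rewrite notin_setE/= in_itv/= => /negP; rewrite -ltNge => cu.
rewrite indE (_ : (0 <= u + x <= 1) = false) ?mul0r//.
apply/negbTE/negP => /andP[_ h]; have : 1 - x <= c by rewrite le_max lexx.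
lra.
Qed.

(** The square is a double integral over u and v in [0, 1]. Integrating first in x leaves k(D) |u -
    v|^(-D), whose integral over the unit square is 2 / ((1 - D) (2 - D)). *)
Lemma integral_sqr_conv :
  (\int[mu]_x (k x * k x) = (kD D * (2 / ((1 - D) * (2 - D))))%:E)%E.
Proof.
have [_ k0] := beta_integral; move: D_gt0 D_lt1 => D0 D1.
have Dn : - D != 0 by rewrite oppr_eq0 gt_eqF.
transitivity (\int[mu]_x \int[mu]_u ((U u x)%:E * k x))%E.
  apply: eq_integral => x _; rewrite ge0_integralZr//.
  - apply: mEF => //; apply: measurable_funM => //.
    by apply: (measurableT_comp mw); exact: measurable_funB.
  - by move=> u _; rewrite lee_fin.
rewrite (tonelli (f := fun x u => ((U u x)%:E * k x)%E)); last 2 first.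
- apply: emeasurable_funM; first exact/measurable_EFinP.
  exact: (measurableT_comp mk measurable_fst).
- by move=> x u; rewrite mule_ge0// lee_fin.
transitivity (\int[mu]_u (kD D / (1 - D) *
    (ind u * ppow (1 - D) (u - 0) + ind u * ppow (1 - D) (1 - u)))%:E)%E.
  apply: eq_integral => u _.
  transitivity (\int[mu]_x \int[mu]_v (U u x * U v x)%:E)%E.
    apply: eq_integral => x _; rewrite -ge0_integralZl//.
    - apply: mEF => //; apply: measurable_funM => //.
      by apply: (measurableT_comp mw); exact: measurable_funB.
    - by move=> v _; rewrite lee_fin mulr_ge0.
    - by rewrite lee_fin.
  have mUU : measurable_fun setT
      (fun z : measurableTypeR R * measurableTypeR R => U u z.1 * U z.2 z.1).
    apply: measurable_funM => //; apply: measurable_funM => //.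
    by apply: (measurableT_comp mw); apply: measurable_funB.
  transitivity (\int[mu]_v \int[mu]_x (U u x * U v x)%:E)%E.
    apply: (tonelli (f := fun x v => (U u x * U v x)%:E)).
      exact/measurable_EFinP.
    by move=> x v; rewrite lee_fin mulr_ge0.
  have [u01|u01] := boolP (0 <= u <= 1); last first.
    have iu : ind u = 0 by rewrite indE (negbTE u01).
    rewrite iu !mul0r addr0 mulr0; apply: integral0_eq => v _.
    by apply: integral0_eq => x _; rewrite /U iu !mul0r.
  have iu : ind u = 1 by rewrite indE u01.
  have mpB : measurable_fun setT (fun v : R => ind v * ppow (- D) (u - v)).
    apply: measurable_funM => //; apply: (measurableT_comp (measurable_ppow _)).
    exact: measurable_funB.
  have mpA : measurable_fun setT (fun v : R => ind v * ppow (- D) (v - u)).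
    apply: measurable_funM => //; apply: (measurableT_comp (measurable_ppow _)).
    exact: measurable_funB.
  transitivity (\int[mu]_v ((kD D)%:E * ((ind v * ppow (- D) (u - v))%:E +
      (ind v * ppow (- D) (v - u))%:E)))%E.
    have mF : measurable_fun setT (fun v => \int[mu]_x (U u x * U v x)%:E)%E.
      apply: (measurable_tonelli (f := fun v x => (U u x * U v x)%:E)).
        apply/measurable_EFinP; apply: measurable_funM.
          apply: measurable_funM => //; apply: (measurableT_comp mw).
          by apply: measurable_funB.
        apply: measurable_funM; first exact: (measurableT_comp mind measurable_fst).
        by apply: (measurableT_comp mw); apply: measurable_funB.
      by move=> v x; rewrite lee_fin mulr_ge0.
    apply: ae_eq_integral => //.
      by apply: measurable_funeM; apply: emeasurable_funD; exact: mEF.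
    (* The formula for [J] fails only at [v = u], a null set. *)
    exists [set u]; split; [exact: measurable_set1|exact: lebesgue_measure_set1|].
    move=> v /= H; apply: contrapT => vu; apply: H => _.
    have {}vu : v != u by apply/eqP.
    rewrite -EFinD -EFinM -mulrDr mulrCA EFinM -(J_neq vu) /J -ge0_integralZl//.
    - by apply: eq_integral => x _; rewrite -EFinM /U iu mul1r; congr EFin; ring.
    - exact: mEF.
    - by move=> x _; rewrite lee_fin mulr_ge0.
    - by rewrite lee_fin.
  rewrite ge0_integralZl//; last 3 first.
  - by apply: emeasurable_funD; exact: mEF.
  - by move=> v _; rewrite -EFinD lee_fin addr_ge0// mulr_ge0// ppow_ge0.
  - by rewrite lee_fin ltW.
  rewrite ge0_integralD//; last 4 first.
  - by move=> v _; rewrite lee_fin mulr_ge0// ppow_ge0.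
  - exact: mEF.
  - by move=> v _; rewrite lee_fin mulr_ge0// ppow_ge0.
  - exact: mEF.
  rewrite integral_ppowBl// ?integral_ppowBr//; last 2 first.
  - by rewrite ltrN2.
  - by rewrite ltrN2.
  have /andP[u0 u1] := u01.
  rewrite -EFinD -EFinM iu subr0 !mul1r; congr EFin.
  rewrite (addrC (- D) 1) /ppow !max_l ?subr_ge0//; ring.
have m1D : measurable_fun setT (fun u : R => ind u * ppow (1 - D) (u - 0)).
  apply: measurable_funM => //; apply: (measurableT_comp (measurable_ppow _)).
  exact: measurable_funB.
have m2D : measurable_fun setT (fun u : R => ind u * ppow (1 - D) (1 - u)).
  apply: measurable_funM => //; apply: (measurableT_comp (measurable_ppow _)).
  exact: measurable_funB.
have D1p : 0 < 1 - D by rewrite subr_gt0.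
under eq_integral do rewrite EFinM EFinD.
rewrite ge0_integralZl//; last 3 first.
- by apply: emeasurable_funD; exact: mEF.
- by move=> v _; rewrite -EFinD lee_fin addr_ge0// mulr_ge0// ppow_ge0.
- by rewrite lee_fin divr_ge0// ltW.
rewrite ge0_integralD//; last 4 first.
- by move=> v _; rewrite lee_fin mulr_ge0// ppow_ge0.
- exact: mEF.
- by move=> v _; rewrite lee_fin mulr_ge0// ppow_ge0.
- exact: mEF.
have c1 : -1 < 1 - D by lra.
have c2 : 1 - D != 0 by rewrite gt_eqF.
have c3 : 0 <= (0 : R) <= 1 by rewrite lexx ler01.
have c4 : 0 <= (1 : R) <= 1 by rewrite lexx ler01.
rewrite (integral_ppowBr c1 c2 c3) (integral_ppowBl c1 c2 c4).
rewrite subr0 powR1 -EFinD -EFinM; congr EFin; field.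
by rewrite !gt_eqF//; lra.
Qed.

Lemma Z1D_kernelE x : Z1D_kernel D 1 x = fine (k x).
Proof.
rewrite /Z1D_kernel Rintegral_mkcond /Rintegral; congr fine.
apply: eq_integral => u _; congr EFin; rewrite patchE /ind indicE.
rewrite /w /ppow (_ : q - 1 = - ((D + 1) / 2)); last by rewrite /q; field.
by case: ifPn => _; rewrite ?mul1r ?mul0r.
Qed.

Lemma Z1D_kernel_norm : sqint mu (Z1D_kernel D 1) /\
  \int[mu]_x Z1D_kernel D 1 x ^+ 2 = kD D * (2 / ((1 - D) * (2 - D))).
Proof.
have mK : measurable_fun setT (Z1D_kernel D 1).
  rewrite (_ : Z1D_kernel D 1 = fine \o k); last by apply/funext => x; rewrite Z1D_kernelE.
  exact: measurableT_comp.
have E : (\int[mu]_x (Z1D_kernel D 1 x ^+ 2)%:E = (kD D * (2 / ((1 - D) * (2 - D))))%:E)%E.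
  rewrite -integral_sqr_conv; apply: eq_integral => x _.
  by rewrite expr2 EFinM Z1D_kernelE fineK.
split; last by rewrite /Rintegral E.
split => //; apply/integrableP; split.
  by apply/measurable_EFinP; exact: measurable_funX.
under eq_integral do rewrite /= ger0_norm ?sqr_ge0//.
by rewrite E ltry.
Qed.

End kernel_norm.

(** * The limit theorem *)

Section convergence_in_distribution.
Context {R : realType} {d} {T : measurableType d} (P : probability T R).
Context {d'} {T' : measurableType d'} (Q : probability T' R).

Lemma chebyshev_sqr (h : T -> R) (e : R) : sqint P h -> 0 < e ->
  (P [set w | (e <= `|h w|)%R] <= (e ^- 2 * \int[P]_w h w ^+ 2)%:E)%E.
Proof.
move=> [mh ih] e0.
have mS : measurable [set w | e <= `|h w|].
  have -> : [set w | e <= `|h w|] = (fun w => `|h w|) @^-1` `[e, +oo[.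
    by apply/seteqP; split => w /=; rewrite in_itv/= andbT.
  rewrite -[X in measurable X]setTI.
  by apply: (measurableT_comp (@normr_measurable R setT) mh) => //; exact: measurable_itv.
rewrite -[P _]fineK ?fin_num_measure// lee_fin.
have -> : fine (P [set w | e <= `|h w|]) = \int[P]_w (\1_[set w | e <= `|h w|] w : R).
  by rewrite /Rintegral integral_indic// setIT.
rewrite -RintegralZl//; apply: le_Rintegral => //.
- exact: integrable_indic.
- exact: intgbZ.
move=> w _; rewrite indicE; have [wS|wS] := boolP (w \in _); last first.
  by rewrite mulr_ge0 ?sqr_ge0// invr_ge0 exprn_ge0// ltW.
move: wS; rewrite inE/= => eh.
rewrite mulrC ler_pdivlMr ?exprn_gt0// mul1r -[leRHS]real_normK ?num_real//.
by rewrite lerXn2r ?nnegrE ?(ltW e0).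
Qed.

(** Since [G n] has the law of [Z], the distribution function of [Y n] at r lies between those of
    [Z] at r - h and r + h, up to the probability that |Y n - G n| >= h, which Chebyshev's
    inequality controls. *)
Lemma cvg_in_distribution_sqint (Y : nat -> {RV P >-> R}) (Z : {RV Q >-> R})
    (G : nat -> T -> R) :
  (\forall n \near \oo, [/\ measurable_fun setT (G n), sqint P (fun w => Y n w - G n w) &
     forall A, measurable A -> P (G n @^-1` A) = Q (Z @^-1` A)]) ->
  \int[P]_w (Y n w - G n w) ^+ 2 @[n --> \oo] --> (0 : R) ->
  cvg_in_distribution Y Z.
Proof.
move=> HG D0 r cr.
pose F s := fine (cdf Z s).
have Ffin s : cdf Z s = (F s)%:E by rewrite /F fineK// fin_num_measure.
have cF : {for r, continuous F}.
  by apply: fine_cvg; rewrite -Ffin; exact: cr.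
pose H n := fine (cdf (Y n) r).
have Hfin n : cdf (Y n) r = (H n)%:E by rewrite /H fineK// fin_num_measure.
rewrite (_ : (fun n => cdf (Y n) r) = EFin \o H); last by apply/funext => n; rewrite /= Hfin.
rewrite Ffin; apply: cvg_EFin; first exact: nearW.
apply/cvgrPdist_le => e e0.
have e20 : 0 < e / 2 by rewrite divr_gt0.
move/cvgrPdist_le : cF => /(_ _ e20)[del /= del0 Hdel].
pose h := del / 2; have h0 : 0 < h by rewrite divr_gt0.
have hd : h < del by rewrite /h; lra.
have F1 : `|F r - F (r + h)| <= e / 2.
  by apply: Hdel; rewrite /ball/= opprD addNKr normrN gtr0_norm.
have F2 : `|F r - F (r - h)| <= e / 2.
  by apply: Hdel; rewrite /ball/= subKr gtr0_norm.
have c0 : 0 < h ^+ 2 * (e / 2) by rewrite mulr_gt0// exprn_gt0.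
move/cvgr0Pnorm_le : D0 => /(_ _ c0).
apply: filterS2 HG => n [mG sD lG] Dn.
set D := fun w => Y n w - G n w in sD Dn.
have chb := chebyshev_sqr sD h0.
have chb2 : (P [set w | (h <= `|D w|)%R] <= (e / 2)%:E)%E.
  apply: le_trans chb _; rewrite lee_fin mulrC ler_pdivrMr ?exprn_gt0// mulrC.
  by apply: le_trans Dn; exact: ler_norm.
have mY : measurable_fun setT (Y n) by [].
have mYr s : measurable (Y n @^-1` `]-oo, s]).
  by rewrite -[X in measurable X]setTI; exact: mY.
have mGr s : measurable (G n @^-1` `]-oo, s]).
  by rewrite -[X in measurable X]setTI; apply: mG => //; exact: measurable_itv.
have mS : measurable [set w | (h <= `|D w|)%R].
  have [mD _] := sD.
  have -> : [set w | h <= `|D w|] = (fun w => `|D w|) @^-1` `[h, +oo[.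
    by apply/seteqP; split => w /=; rewrite in_itv/= andbT.
  rewrite -[X in measurable X]setTI.
  by apply: (measurableT_comp (@normr_measurable R setT) mD) => //; exact: measurable_itv.
have GF s : P (G n @^-1` `]-oo, s]) = (F s)%:E.
  by rewrite lG; [exact: Ffin|exact: measurable_itv].
have YH : P (Y n @^-1` `]-oo, r]) = (H n)%:E by exact: Hfin.
have up : H n <= F (r + h) + e / 2.
  rewrite -lee_fin EFinD -YH -GF.
  apply: (@le_trans _ _ (P (G n @^-1` `]-oo, (r + h)%R]) + P [set w | (h <= `|D w|)%R])%E); last first.
    by rewrite leeD2l.
  apply: le_trans; last by apply: measureU2.
  apply: le_measure; rewrite ?inE//.
    exact: measurableU.
  move=> w /=; rewrite !in_itv/= => Yr.
  have [Dh|Dh] := leP h `|D w|; [by right|left].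
  move: Dh; rewrite /D ltr_norml => /andP[? ?]; lra.
have lo : F (r - h) <= H n + e / 2.
  rewrite -lee_fin EFinD -YH -GF.
  apply: (@le_trans _ _ (P (Y n @^-1` `]-oo, r]) + P [set w | (h <= `|D w|)%R])%E); last first.
    by rewrite leeD2l.
  apply: le_trans; last by apply: measureU2.
  apply: le_measure; rewrite ?inE//.
    exact: measurableU.
  move=> w /=; rewrite !in_itv/= => Yr.
  have [Dh|Dh] := leP h `|D w|; [by right|left].
  move: Dh; rewrite /D ltr_norml => /andP[? ?]; lra.
move: F1 F2 up lo; rewrite !ler_norml; move: (F r) (F (r + h)) (F (r - h)) (H n) => f f1 f2 x.
by move=> /andP[? ?] /andP[? ?] *; apply/andP; split; lra.
Qed.

End convergence_in_distribution.

Definition lag (i j : nat) : nat := ((i - j) + (j - i))%N.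

(** In a row each lag occurs at most twice, once on each side of the diagonal. *)
Lemma lag_row_sum_le {R : realDomainType} (f : nat -> R) n (a : nat) : (a < n)%N ->
  (forall m, 0 <= f m) ->
  \sum_(b < n) f (lag a b) <= 2 * \sum_(0 <= m < n) f m.
Proof.
move=> an f0.
have widen p : (p <= n)%N -> \sum_(0 <= m < p) f m <= \sum_(0 <= m < n) f m.
  by move=> pn; rewrite [leRHS](big_cat_nat _ (n := p))//= lerDl; apply: sumr_ge0.
rewrite -(big_mkord xpredT (fun b => f (lag a b))) (big_cat_nat _ (n := a))//=; last exact: ltnW.
rewrite mulr_natl mulr2n; apply: lerD.
  rewrite big_nat_rev/= add0n.
  rewrite (eq_big_nat _ _ (F2 := fun b => f b.+1)); last first.
    move=> b /andP[_ ba]; congr f; rewrite /lag subKn//.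
    have /eqP -> : (a - b.+1 - a == 0)%N by rewrite subn_eq0 leq_subr.
    by rewrite addn0.
  by apply: le_trans (widen a.+1 an); rewrite big_nat_recl//= lerDr.
rewrite -{1}[a]add0n big_addn.
rewrite (eq_big_nat _ _ (F2 := f)); last first.
  move=> b _; congr f; rewrite /lag addnK.
  by have /eqP -> : (a - (b + a) == 0)%N by rewrite subn_eq0 leq_addl.
by apply: widen; exact: leq_subr.
Qed.

(** With h = k / (2 s) the left side equals (I - k^2 c / (t t')) / 4 + k^2 (1/t - 1/s) (1/t' - 1/s)
    c / 4. The first term is quadratic in c; in the second the two differences are at most e, and
    their product too because e <= 1 / 2. *)
Lemma arcsine_algebra {R : realFieldType} (k h c I t t' s e : R) :
  0 <= k ^+ 2 -> k ^+ 2 <= 1 -> s ^+ 2 = 2 -> 0 < s -> h = k / (2 * s) ->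
  1 <= t -> 1 <= t' -> `|t^-1 - s^-1| <= e -> `|t'^-1 - s^-1| <= e -> e <= 1 / 2 ->
  `|I - k ^+ 2 * (c / (t * t'))| <= (c / (t * t')) ^+ 2 ->
  `|1 / 4 * I + (- (h / 2) * (k * (c / t)) + (- (h / 2) * (k * (c / t')) + h ^+ 2 * c))| <=
    (e * `|c| + c ^+ 2) / 4.
Proof.
move=> k0 k1 s2 s0 -> t1 t'1 T1 T'1 e2 S.
have t0 : 0 < t by lra.
have t'0 : 0 < t' by lra.
have -> : 1 / 4 * I + (- (k / (2 * s) / 2) * (k * (c / t)) + (- (k / (2 * s) / 2) * (k * (c / t')) +
    (k / (2 * s)) ^+ 2 * c)) =
  (I - k ^+ 2 * (c / (t * t'))) / 4 + (k ^+ 2 * (t^-1 - s^-1) * (t'^-1 - s^-1) * c) / 4.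
  by field; rewrite ?gt_eqF.
move: (k ^+ 2) k0 k1 S => a k0 k1 S.
apply: (le_trans (ler_normD _ _)); rewrite !normrM [`|4^-1|]ger0_norm// -mulrDl.
rewrite ler_wpM2r// addrC lerD//.
- rewrite ler_wpM2r// (ger0_norm k0).
  have x0 := normr_ge0 (t^-1 - s^-1); have y0 := normr_ge0 (t'^-1 - s^-1).
  set x := `|_| in T1 x0 *; set y := `|_| in T'1 y0 *.
  have xy : x * y <= e by nra.
  have : a * (x * y) <= 1 * (x * y) by rewrite ler_wpM2r// mulr_ge0.
  by rewrite mulrA; lra.
- apply: (le_trans S); rewrite exprMn ler_piMr ?sqr_ge0// exprVn invf_le1 ?exprn_gt0 ?mulr_gt0//.
  by rewrite exprn_ege1//; nra.
Qed.

Lemma normal_prob_set1 {R : realType} (m s x : R) : normal_prob m s [set x] = 0%E.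
Proof.
have /null_content_dominatesP := @normal_prob_dominates R m s.
by apply; [exact: measurable_set1|exact: lebesgue_measure_set1].
Qed.

(** * Pairs of a stationary Gaussian process, and the remainders of the rank kernel *)

Section gaussian_process_moments.
Context {R : realType} {d} {T : measurableType d} (P : probability T R).
Variables (X : {RV P >-> R}^nat) (rho : nat -> R).
Hypothesis X_gaussian : gaussian_process X.
Hypothesis X_stationary : stationary X.
Hypothesis X_centered : forall i, ('E_P[X i] = 0)%E.
Hypothesis X_cov : forall k, ('E_P[X 0%N \* X k] = (rho k)%:E)%E.
Hypothesis rho0 : rho 0%N = 1.

Let mX i : measurable_fun setT (X i). Proof. exact: measurable_funP. Qed.

Let combo_gaussian (n : nat) (a : nat -> R) :
  gaussian_rv P (fun w => \sum_(i < n) a i * X i w).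
Proof. exact: (X_gaussian (fun i : 'I_n => a i)). Qed.

(** Indices may coincide: the coefficients are sums of Kronecker deltas over a common range. *)
Lemma process_sum4_gaussian i j k l (a b c e : R) :
  gaussian_rv P (fun w => a * X i w + b * X j w + c * X k w + e * X l w).
Proof.
pose n := (maxn (maxn i j) (maxn k l)).+1.
have sumE (p : nat) (x : R) w : (p < n)%N ->
    \sum_(m < n) (x * (m == p :> nat)%:R) * X m w = x * X p w.
  move=> pn; rewrite (bigD1 (Ordinal pn))//= eqxx mulr1 big1 ?addr0// => m mp.
  have -> : (m == p :> nat) = false by apply: contraNF mp => /eqP h; apply/eqP/val_inj.
  by rewrite mulr0 mul0r.
have -> : (fun w => a * X i w + b * X j w + c * X k w + e * X l w) = (fun w => \sum_(m < n)
    (a * (m == i :> nat)%:R + b * (m == j :> nat)%:R + c * (m == k :> nat)%:R +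
     e * (m == l :> nat)%:R) * X m w).
  apply/funext => w; under [RHS]eq_bigr do rewrite !mulrDl.
  by rewrite !big_split/= !sumE// ltnS !leq_max leqnn ?orbT.
exact: (combo_gaussian n (fun m => a * (m == i)%:R + b * (m == j)%:R + c * (m == k)%:R +
     e * (m == l)%:R)).
Qed.

Lemma process_sqint i : sqint P (X i).
Proof.
apply: gaussian_rv_sqint; first exact: mX.
have := process_sum4_gaussian i i i i 1 0 0 0.
by under eq_fun do rewrite !mul0r !addr0 mul1r.
Qed.

Lemma process_mean i : \int[P]_w X i w = 0.
Proof. by have := X_centered i; rewrite unlock /Rintegral => ->. Qed.

(** Stationarity compares windows: X_i and X_j are the first and last entries of a window of length
    j - i + 1, which is shifted to start at 0. *)
Lemma process_cov i j : \int[P]_w (X i w * X j w) = rho (lag i j).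
Proof.
wlog ij : i j / (i <= j)%N => [H|].
  have [ij|/ltnW ij] := leqP i j; first exact: H.
  under eq_Rintegral do rewrite mulrC.
  by rewrite H// /lag addnC.
pose k := (j - i)%N.
pose g (t : k.+1.-tuple (measurableTypeR R)) : R := (tnth t ord0 : R) * (tnth t ord_max : R).
have mg : measurable_fun setT g.
  by apply: (@measurable_funM _ _ R setT (fun t : k.+1.-tuple (measurableTypeR R) => tnth t ord0) (fun t => tnth t ord_max)); exact: (@measurable_tnth _ (measurableTypeR R)).
pose Y w := X 0%N w * X k w.
have mY : measurable_fun setT Y by exact: (measurable_funM (mX 0%N) (mX k)).
have law1 A : measurable A -> P ((fun w => X i w * X j w) @^-1` A) = P (Y @^-1` A).
  move=> mA.
  have := @X_stationary i k.+1 (g @^-1` A).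
  rewrite -[g @^-1` A]setTI => /(_ (mg measurableT A mA)).
  rewrite setTI.
  have -> : (fun w => [tuple X (i + i0)%N w | i0 < k.+1]) @^-1` (g @^-1` A) =
      (fun w => X i w * X j w) @^-1` A.
    by apply/funext => w; rewrite /preimage /mkset /g !tnth_mktuple/= addn0 subnKC.
  move=> ->; congr (P _).
  by apply/funext => w; rewrite /preimage /mkset /g !tnth_mktuple.
pose m1 : {measure set (measurableTypeR R) -> \bar R} := pushforward P (Y : T -> measurableTypeR R).
have mid : measurable_fun setT (@id R) by exact: measurable_id.
have E1 := @Rintegral_law _ T R _ (measurableTypeR R) P (m1 mY) _
  (measurable_funM (mX i) (mX j)) (fun A mA => law1 A mA) id mid.
have E2 := @Rintegral_law _ T R _ (measurableTypeR R) P (m1 mY) _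
  mY (fun A mA => erefl) id mid.
rewrite -E1 E2 /lag.
have -> : (i - j = 0)%N by apply/eqP; rewrite subn_eq0.
rewrite add0n -/k.
by have := X_cov k; rewrite unlock /Rintegral => ->.
Qed.

Lemma lagnn i : lag i i = 0%N. Proof. by rewrite /lag subnn. Qed.

Lemma lagC i j : lag i j = lag j i. Proof. by rewrite /lag addnC. Qed.

Lemma process_pair_cov i j k l (a b : R) :
  \int[P]_w ((X i w + a * X j w) * (X k w + b * X l w)) =
  rho (lag i k) + b * rho (lag i l) + a * rho (lag j k) + a * b * rho (lag j l).
Proof.
have iM m n : intgb P (fun w => X m w * X n w) by apply: sqintM; exact: process_sqint.
rewrite -!process_cov.
under eq_Rintegral => w _.
  rewrite (_ : _ * _ = X i w * X k w + (b * (X i w * X l w) + (a * (X j w * X k w) +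
    (a * b) * (X j w * X l w)))); last by ring.
  over.
have i1 : intgb P (fun w => a * b * (X j w * X l w)) by exact: intgbZ.
have i2 : intgb P (fun w => a * (X j w * X k w)) by exact: intgbZ.
have i3 : intgb P (fun w => b * (X i w * X l w)) by exact: intgbZ.
rewrite RintegralD//; last by do 2 (apply: intgbD => //).
rewrite RintegralD//; last exact: intgbD.
by rewrite RintegralD// !RintegralZl// !addrA.
Qed.

Lemma process_pair_var i j (a : R) :
  \int[P]_w (X i w + a * X j w) ^+ 2 = 1 + a ^+ 2 + 2 * a * rho (lag i j).
Proof.
under eq_Rintegral do rewrite expr2.
by rewrite process_pair_cov !lagnn rho0 (lagC j i); ring.
Qed.

Lemma cov_le1 m : `|rho m| <= 1.
Proof.
have V (a : R) : 0 <= 1 + a ^+ 2 + 2 * a * rho m.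
  rewrite (_ : m = lag 0 m); last by rewrite /lag sub0n subn0.
  by rewrite -process_pair_var; apply: Rintegral_ge0 => w _; exact: sqr_ge0.
rewrite ler_norml; have := V 1; have := V (-1); lra.
Qed.

(** The variance 2 + 2 a rho is positive, so the law is a genuine normal law and has no atoms. With
    a = 1 and a = -1 this excludes ties of |X_i| and |X_j| almost surely. *)
Lemma process_pair_neq0 i j (a : R) : `|a| = 1 -> `|rho (lag i j)| < 1 ->
  P ((fun w => X i w + a * X j w) @^-1` [set 0]) = 0%E.
Proof.
move=> a1; rewrite ltr_norml => /andP[r1 r2].
have mW : measurable_fun setT (fun w => X i w + a * X j w).
  by apply: measurable_funD => //; exact: measurable_funM.
have gW : gaussian_rv P (fun w => X i w + a * X j w).
  have := process_sum4_gaussian i j i i 1 a 0 0.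
  by under eq_fun do rewrite !mul0r !addr0 mul1r.
have W0 : \int[P]_w (X i w + a * X j w) = 0.
  have iX m : intgb P (X m) by apply: sqint_intgb; exact: process_sqint.
  have i1 : intgb P (fun w => a * X j w) by exact: intgbZ.
  by rewrite RintegralD// RintegralZl// !process_mean mulr0 addr0.
have [s [s0 law var _ _]] := gaussian_rv_centered mW gW W0.
have sN0 : s != 0.
  apply/eqP => s00; move: var; rewrite s00 process_pair_var expr0n/= -real_normK ?num_real// a1.
  move: (ler_norm a) (ler_norm (- a)); rewrite normrN a1 => h1 h2.
  have /orP[/eqP ->|/eqP ->] : (a == 1) || (a == -1).
    by rewrite -sqrf_eq1 -real_normK ?num_real// a1 expr1n.
  - lra.
  - lra.
rewrite law//.
exact: normal_prob_set1.
Qed.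

Local Notation k := (2 * normal_peak 1 : R).

(** Symmetrized over the two orders of a pair, so that summing over all ordered pairs yields twice
    the signed-rank statistic. *)
Definition rank_kernel (x y : R) : R :=
  (`|x| <= `|y|)%R%:R * (0 < y)%R%:R + (`|y| <= `|x|)%R%:R * (0 < x)%R%:R.

(** The regression coefficient of sg (W) / 2 on W for a centered Gaussian W of variance 2: half of E
    |W| = k sqrt 2, divided by 2. *)
Definition hoeffding_slope : R := k / (2 * Num.sqrt 2).

Definition remainder (i j : nat) (w : T) : R :=
  rank_kernel (X i w) (X j w) - 1 / 2 - hoeffding_slope * (X i w + X j w).

(** Without a tie of absolute values exactly one of the two comparisons holds, and the larger
    variable in absolute value has the sign of x + y. *)
Lemma rank_kernelE (x y : R) : x + y != 0 -> x - y != 0 ->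
  rank_kernel x y = 1 / 2 + Num.sg (x + y) / 2.
Proof.
rewrite /rank_kernel neq_lt => /orP[s0|s0]; rewrite neq_lt => /orP[d0|d0].
- have h : `|y| < - x by rewrite ltr_norml; lra.
  have x0 : x < 0 by lra.
  rewrite (ltr0_norm x0) (ltW h) (leNgt (- x)) h (ltNge 0 x) (ltW x0) ltr0_sg//=.
  by rewrite mulr0 mul0r; lra.
- have h : `|x| < - y by rewrite ltr_norml; lra.
  have y0 : y < 0 by lra.
  rewrite (ltr0_norm y0) (ltW h) (leNgt (- y)) h (ltNge 0 y) (ltW y0) ltr0_sg//=.
  by rewrite mulr0 mul0r; lra.
- have h : `|x| < y by rewrite ltr_norml; lra.
  have y0 : 0 < y by lra.
  rewrite (gtr0_norm y0) (ltW h) (leNgt y) h y0 gtr0_sg//=.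
  by rewrite mul0r; lra.
- have h : `|y| < x by rewrite ltr_norml; lra.
  have x0 : 0 < x by lra.
  rewrite (gtr0_norm x0) (ltW h) (leNgt x) h x0 gtr0_sg//=.
  by rewrite mul0r; lra.
Qed.

(** The value 2 of the kernel occurs, at ties of positive variables. *)
Lemma rank_kernel_bound (x y : R) : `|rank_kernel x y - 1 / 2| <= 3 / 2.
Proof.
rewrite /rank_kernel ler_norml.
by case: (`|x| <= `|y|); case: (`|y| <= `|x|); case: (0 < x); case: (0 < y);
  rewrite /= ?mulr1 ?mulr0 ?mul0r; apply/andP; split; lra.
Qed.

Lemma measurable_rank_kernel i j :
  measurable_fun setT (fun w => rank_kernel (X i w) (X j w)).
Proof.
have mN m : measurable_fun setT (fun w => `|X m w|) by exact: measurableT_comp.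
have mB (b : T -> bool) : measurable_fun setT b -> measurable_fun setT (fun w => (b w)%:R : R).
  by move=> mb; rewrite (_ : (fun w => _) = fun w => if b w then 1 else 0);
    [exact: measurable_fun_ifT|apply/funext => w; case: (b w)].
by apply: measurable_funD; apply: measurable_funM; apply: mB;
  [exact: measurable_fun_ler|exact: measurable_fun_ltr|
   exact: measurable_fun_ler|exact: measurable_fun_ltr].
Qed.

Lemma remainder_sqint i j : sqint P (remainder i j).
Proof.
apply: sqintB; last by apply: sqintZ; apply: sqintD; exact: process_sqint.
apply: (@sqint_bounded _ _ _ _ _ (3 / 2)); last by move=> w; exact: rank_kernel_bound.
by apply: measurable_funB => //; exact: measurable_rank_kernel.
Qed.

Lemma normal_peak1_sqr : k ^+ 2 = 2 / pi.
Proof.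
have p0 := @pi_gt0 R.
rewrite exprMn /normal_peak expr1n mul1r exprVn sqr_sqrtr; last first.
  by apply: mulrn_wge0; exact: ltW.
by rewrite -mulr_natl; field; lra.
Qed.

Lemma normal_peak1_sqr_le1 : k ^+ 2 <= 1.
Proof. by rewrite normal_peak1_sqr ler_pdivrMr ?pi_gt0// mul1r pi_ge2. Qed.

Lemma hoeffding_slope_sqr : hoeffding_slope ^+ 2 = k ^+ 2 / 8.
Proof. by rewrite /hoeffding_slope expr_div_n [in X in _ / X]exprMn sqr_sqrtr//; congr (_ / _); ring. Qed.

Lemma hoeffding_slopeE : hoeffding_slope = (2 * Num.sqrt pi)^-1.
Proof.
have p0 := @pi_gt0 R.
have q0 : 0 < Num.sqrt (pi : R) by rewrite sqrtr_gt0.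
have s0 : 0 < Num.sqrt (2 : R) by rewrite sqrtr_gt0.
apply/eqP; rewrite -(@eqrXn2 _ 2)//; last first.
  by rewrite /hoeffding_slope; apply: divr_ge0; apply: mulr_ge0 => //; exact: normal_peak_ge0.
rewrite hoeffding_slope_sqr normal_peak1_sqr exprVn exprMn sqr_sqrtr ?(ltW p0)//.
by apply/eqP; field; lra.
Qed.

(** A crude constant, valid for every pair: 2 (3/2)^2 from the kernel, plus twice the squared slope,
    at most 1/8, times a variance of at most 4. *)
Lemma remainder_sqr_le i j : \int[P]_w remainder i j w ^+ 2 <= 7.
Proof.
have sX : sqint P (fun w => - hoeffding_slope * (X i w + 1 * X j w)).
  by apply: sqintZ; apply: sqintD; [|apply: sqintZ]; exact: process_sqint.
have sT : sqint P (fun w => rank_kernel (X i w) (X j w) - 1 / 2).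
  apply: (@sqint_bounded _ _ _ _ _ (3 / 2)); last by move=> w; exact: rank_kernel_bound.
  by apply: measurable_funB => //; exact: measurable_rank_kernel.
have E : \int[P]_w remainder i j w ^+ 2 = \int[P]_w ((rank_kernel (X i w) (X j w) - 1 / 2) +
    - hoeffding_slope * (X i w + 1 * X j w)) ^+ 2.
  by apply: eq_Rintegral => w _; rewrite (mul1r (X j w)) mulNr.
rewrite E; apply: (le_trans (Rintegral_sqrD_le sT sX)).
under [X in _ + 2 * X]eq_Rintegral do rewrite exprMn sqrrN.
rewrite RintegralZl//; last first.
  by have [] : sqint P (fun w => X i w + 1 * X j w)
    by apply: sqintD; [|apply: sqintZ]; exact: process_sqint.
rewrite process_pair_var hoeffding_slope_sqr.
have h1 : \int[P]_w (rank_kernel (X i w) (X j w) - 1 / 2) ^+ 2 <= (3 / 2) ^+ 2.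
  rewrite -[leRHS](Rintegral_prob_cst P); apply: le_Rintegral => //.
  - by case: sT.
  - exact: intgb_cst.
  - by move=> w _; rewrite -real_normK ?num_real// lerXn2r ?nnegrE// rank_kernel_bound.
have /andP[_ r1] : -1 <= rho (lag i j) <= 1 by rewrite -ler_norml cov_le1.
have k1 := normal_peak1_sqr_le1; have k0 : 0 <= k ^+ 2 by exact: sqr_ge0.
set K := k ^+ 2 in k1 k0 *.
have : K / 8 * (1 + 1 ^+ 2 + 2 * 1 * rho (lag i j)) <= 1 / 8 * 4.
  apply: (@le_trans _ _ (K / 8 * 4)); first by apply: ler_wpM2l; lra.
  by lra.
by lra.
Qed.

Lemma remainder_ae i j : `|rho (lag i j)| < 1 ->
  {ae P, forall w, remainder i j w =
    Num.sg (X i w + X j w) / 2 - hoeffding_slope * (X i w + X j w)}.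
Proof.
move=> r1.
have N (a : R) : `|a| = 1 -> {ae P, forall w, X i w + a * X j w != 0}.
  move=> a1; exists ((fun w => X i w + a * X j w) @^-1` [set 0]); split.
  - rewrite -[X in measurable X]setTI.
    by apply: (measurable_funD (mX i) (measurable_funM (measurable_cst a) (mX j))) => //;
      exact: measurable_set1.
  - exact: process_pair_neq0.
  - by move=> w /= /negP; rewrite negbK => /eqP.
have N1 := N 1 (normr1 R); have N2 := N (-1) (normrN1 R).
apply: filterS2 N1 N2 => w; rewrite mul1r mulN1r => h1 h2.
by rewrite /remainder rank_kernelE//; ring.
Qed.

(** With s = sqrt 2 the difference of the inverses is - 2 r / (t s (s + t)), and the denominator is
    at least 2. *)
Lemma invr_sqrt2_dist (t e r : R) : 0 < t -> t ^+ 2 = 2 + 2 * r -> `|r| <= e -> e <= 1 / 2 ->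
  1 <= t /\ `|t^-1 - (Num.sqrt 2)^-1| <= e.
Proof.
move=> t0 tE re e2; have /andP[r1 r2] : - e <= r <= e by rewrite -ler_norml.
have s0 : 0 < Num.sqrt (2 : R) by rewrite sqrtr_gt0.
have s2 : Num.sqrt (2 : R) ^+ 2 = 2 by rewrite sqr_sqrtr.
set s := Num.sqrt 2 in s0 s2 *.
have t1 : 1 <= t by rewrite -(@ler_pXn2r _ 2) ?nnegrE ?ler01 ?(ltW t0)// expr1n tE; lra.
have s1 : 1 <= s by rewrite -(@ler_pXn2r _ 2) ?nnegrE ?ler01 ?(ltW s0)// expr1n s2; lra.
split => //.
have -> : t^-1 - s^-1 = (- (2 * r)) / (t * s * (s + t)).
  have -> : - (2 * r) = (s - t) * (s + t) by rewrite -subr_sqr s2 tE; ring.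
  by field; rewrite ?gt_eqF//; lra.
have d2 : 2 <= t * s * (s + t) by nra.
have d0 : 0 < t * s * (s + t) by lra.
rewrite normrM normrN normfV (gtr0_norm d0) ler_pdivrMr// normrM ger0_norm//.
have e0 : 0 <= e by exact: le_trans re.
have : 2 * `|r| <= 2 * e by rewrite ler_pM2l.
have : e * 2 <= e * (t * s * (s + t)) by exact: ler_wpM2l.
by lra.
Qed.

Section remainder_pair.
Variables (e : R) (K : nat).
Hypothesis e0 : 0 < e.
Hypothesis e2 : e <= 1 / 2.
Hypothesis rho_small : forall m, (K <= m)%N -> `|rho m| <= e.

(** For lags from [K] on, 2 e |rho| dominates e |rho| + rho^2. For the finitely many smaller lags, 7
    is the crude bound on the second moment of a remainder. *)
Definition lag_weight (m : nat) : R := 2 * e * `|rho m| + 7 * (m < K)%N%:R.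

Lemma lag_weight_ge0 m : 0 <= lag_weight m.
Proof.
by apply: addr_ge0; apply: mulr_ge0 => //; apply: mulr_ge0 => //; exact: ltW.
Qed.

Lemma cov_sqr_le m : e * `|rho m| + rho m ^+ 2 <= lag_weight m.
Proof.
rewrite /lag_weight -real_normK ?num_real//.
have h0 := normr_ge0 (rho m); have h1 := cov_le1 m.
set x := `|rho m| in h0 h1 *.
have [mK|/rho_small] := ltnP m K; rewrite /= -/x; last by nra.
by have := e0; have := e2; nra.
Qed.

(** Both remainders are almost surely sg (W) / 2 - h W, so the covariance has four terms, evaluated
    by [gaussian_pair_sgr] and combined by [arcsine_algebra]. *)
Let good_pair i j k' l : (K <= lag i j)%N -> (K <= lag k' l)%N ->
  `|\int[P]_w (remainder i j w * remainder k' l w)| <=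
  lag_weight (lag i k') + lag_weight (lag i l) + lag_weight (lag j k') + lag_weight (lag j l).
Proof.
move=> gij gkl; have e20 := e2.
have r1 : `|rho (lag i j)| < 1 by apply: (le_lt_trans (rho_small gij)); lra.
have r2 : `|rho (lag k' l)| < 1 by apply: (le_lt_trans (rho_small gkl)); lra.
pose W w := X i w + X j w; pose W' w := X k' w + X l w.
have mW : measurable_fun setT W by exact: measurable_funD.
have mW' : measurable_fun setT W' by exact: measurable_funD.
have sW : sqint P W by apply: sqintD; exact: process_sqint.
have sW' : sqint P W' by apply: sqintD; exact: process_sqint.
have mean m n : \int[P]_w (X m w + X n w) = 0.
  by rewrite RintegralD// ?process_mean ?addr0//; apply: sqint_intgb; exact: process_sqint.
have V m n : \int[P]_w (X m w + X n w) ^+ 2 = 2 + 2 * rho (lag m n).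
  under eq_Rintegral => w _ do rewrite -(mul1r (X n w)).
  by rewrite process_pair_var; ring.
have V0 m n : `|rho (lag m n)| < 1 -> 0 < 2 + 2 * rho (lag m n).
  by rewrite ltr_norml => /andP[? ?]; lra.
pose t := Num.sqrt (2 + 2 * rho (lag i j)); pose t' := Num.sqrt (2 + 2 * rho (lag k' l)).
have t0 : 0 < t by rewrite sqrtr_gt0 V0.
have t'0 : 0 < t' by rewrite sqrtr_gt0 V0.
have tE : t ^+ 2 = 2 + 2 * rho (lag i j) by rewrite sqr_sqrtr// (ltW (V0 _ _ r1)).
have t'E : t' ^+ 2 = 2 + 2 * rho (lag k' l) by rewrite sqr_sqrtr// (ltW (V0 _ _ r2)).
have gW a b : gaussian_rv P (fun w => a * W w + b * W' w).
  have := process_sum4_gaussian i j k' l a a b b.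
  by rewrite (_ : (fun w => _) = fun w => a * W w + b * W' w)//; apply/funext => w; rewrite /W /W'; ring.
have gW' a b : gaussian_rv P (fun w => a * W' w + b * W w).
  by have := gW b a; under eq_fun do rewrite addrC.
have [S1 S2] := gaussian_pair_sgr mW mW' gW (mean i j) (mean k' l) t0 t'0
  (etrans (V i j) (esym tE)) (etrans (V k' l) (esym t'E)).
have [S3 _] := gaussian_pair_sgr mW' mW gW' (mean k' l) (mean i j) t'0 t0
  (etrans (V k' l) (esym t'E)) (etrans (V i j) (esym tE)).
have cC : \int[P]_w (W' w * W w) = \int[P]_w (W w * W' w).
  by under eq_Rintegral do rewrite mulrC.
rewrite cC in S3.
have cE : \int[P]_w (W w * W' w) =
    rho (lag i k') + rho (lag i l) + rho (lag j k') + rho (lag j l).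
  have := process_pair_cov i j k' l 1 1; rewrite !mul1r => <-.
  by apply: eq_Rintegral => w _; rewrite !mul1r.
set c := \int[P]_w (W w * W' w) in S1 S2 S3 cE.
have sg_bound (Y : T -> R) : measurable_fun setT Y -> sqint P (fun w => Num.sg (Y w)).
  move=> mY; apply: (@sqint_bounded _ _ _ _ _ 1); first exact: (measurableT_comp measurable_sgr mY).
  by move=> w; rewrite normr_sg; case: (Y w != 0); rewrite ?normr1// ?ler01.
have sS := sg_bound W mW; have sS' := sg_bound W' mW'.
pose h := hoeffding_slope.
have E : \int[P]_w (remainder i j w * remainder k' l w) =
   \int[P]_w ((1 / 4) * (Num.sg (W w) * Num.sg (W' w)) + ((- (h / 2)) * (Num.sg (W w) * W' w) +
     ((- (h / 2)) * (Num.sg (W' w) * W w) + h ^+ 2 * (W w * W' w)))).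
  have mR m n := intgb_measurable (sqint_intgb (remainder_sqint m n)).
  apply: eq_Rintegral_ae.
  - exact: measurable_funM.
  - have m1 := intgb_measurable (sqintM sS sS'); have m2 := intgb_measurable (sqintM sS sW').
    have m3 := intgb_measurable (sqintM sS' sW); have m4 := intgb_measurable (sqintM sW sW').
    by do 3 (apply: measurable_funD; first exact: measurable_funM); exact: measurable_funM.
  apply: filterS2 (remainder_ae r1) (remainder_ae r2) => w -> ->.
  by rewrite /W /W' /h; field.
have i1 := intgbZ (1 / 4) (sqintM sS sS'); have i2 := intgbZ (- (h / 2)) (sqintM sS sW').
have i3 := intgbZ (- (h / 2)) (sqintM sS' sW); have i4 := intgbZ (h ^+ 2) (sqintM sW sW').
rewrite E RintegralD//; last by do 2 (apply: intgbD => //).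
rewrite RintegralD//; last exact: intgbD.
rewrite RintegralD// !RintegralZl//; [|exact: sqintM..].
rewrite S1 S3 -/c.
have [t1 T1] := invr_sqrt2_dist t0 tE (rho_small gij) e2.
have [t'1 T'1] := invr_sqrt2_dist t'0 t'E (rho_small gkl) e2.
move: S2; set I := \int[P]_w _ => S2.
have k1 := normal_peak1_sqr_le1; have k0 : 0 <= k ^+ 2 by exact: sqr_ge0.
have s0 : 0 < Num.sqrt (2 : R) by rewrite sqrtr_gt0.
have s2 : Num.sqrt (2 : R) ^+ 2 = 2 by rewrite sqr_sqrtr.
have hE : h = k / (2 * Num.sqrt 2) by [].
(* The square of a sum of four numbers is at most four times the sum of their squares. *)
have cs : (e * `|c| + c ^+ 2) / 4 <= (e * `|rho (lag i k')| + rho (lag i k') ^+ 2) +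
    (e * `|rho (lag i l)| + rho (lag i l) ^+ 2) + (e * `|rho (lag j k')| + rho (lag j k') ^+ 2) +
    (e * `|rho (lag j l)| + rho (lag j l) ^+ 2).
  rewrite cE; set x1 := rho _; set x2 := rho _; set x3 := rho _; set x4 := rho _.
  have N : `|x1 + x2 + x3 + x4| <= `|x1| + `|x2| + `|x3| + `|x4|.
    have := ler_normD (x1 + x2 + x3) x4; have := ler_normD (x1 + x2) x3.
    by have := ler_normD x1 x2; lra.
  have N' : e * `|x1 + x2 + x3 + x4| <= e * (`|x1| + `|x2| + `|x3| + `|x4|).
    by apply: ler_wpM2l; [exact: ltW|].
  have M (x : R) : 0 <= e * `|x| by apply: mulr_ge0 => //; exact: ltW.
  have := M x1; have := M x2; have := M x3; have := M x4.
  by have := sqr_ge0 (x1 - x2); have := sqr_ge0 (x1 - x3); have := sqr_ge0 (x1 - x4);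
    have := sqr_ge0 (x2 - x3); have := sqr_ge0 (x2 - x4); have := sqr_ge0 (x3 - x4); lra.
apply: le_trans (le_trans cs _); last by do 3 (apply: lerD; last exact: cov_sqr_le); exact: cov_sqr_le.
exact: (arcsine_algebra k0 k1 s2 s0 hE t1 t'1 T1 T'1 e2 S2).
Qed.

(** If the lag within one of the pairs is below [K], which includes the diagonal, its weight is at
    least 7 and already dominates the crude bound. This is the purpose of the last two terms. *)
Lemma remainder_pair_le i j k' l :
  \int[P]_w (remainder i j w * remainder k' l w) <=
  lag_weight (lag i k') + lag_weight (lag i l) + lag_weight (lag j k') + lag_weight (lag j l) +
  lag_weight (lag i j) + lag_weight (lag k' l).
Proof.
have w0 m := lag_weight_ge0 m.
have bad m : (m < K)%N -> 7 <= lag_weight m.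
  by move=> mK; rewrite /lag_weight mK/= mulr1 lerDr; do 2 (apply: mulr_ge0 => //); exact: ltW.
have h1 := w0 (lag i k'); have h2 := w0 (lag i l); have h3 := w0 (lag j k').
have h4 := w0 (lag j l); have h5 := w0 (lag i j); have h6 := w0 (lag k' l).
have I7 : \int[P]_w (remainder i j w * remainder k' l w) <= 7.
  have [m1 i1] := remainder_sqint i j; have [m2 i2] := remainder_sqint k' l.
  apply: (@le_trans _ _ (\int[P]_w (1 / 2 * remainder i j w ^+ 2 + 1 / 2 * remainder k' l w ^+ 2))).
    apply: le_Rintegral => //; first exact: sqintM (remainder_sqint _ _) (remainder_sqint _ _).
      by apply: intgbD; exact: intgbZ.
    by move=> w _; have := sqr_ge0 (remainder i j w - remainder k' l w); lra.
  rewrite RintegralD//; [|exact: intgbZ..].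
  rewrite !RintegralZl//.
  by have := remainder_sqr_le i j; have := remainder_sqr_le k' l; lra.
have [gij|/bad] := leqP K (lag i j); last by lra.
have [gkl|/bad] := leqP K (lag k' l); last by lra.
by have := good_pair gij gkl; rewrite ler_norml => /andP[_]; lra.
Qed.

Lemma remainder_sum_le n :
  \int[P]_w (\sum_(i < n) \sum_(j < n) remainder i j w) ^+ 2 <=
  12 * n%:R ^+ 3 * \sum_(0 <= m < n) lag_weight m.
Proof.
under eq_Rintegral do rewrite pair_big/=.
rewrite (@Rintegral_sqr_sum _ _ _ _ _ _ (fun p : 'I_n * 'I_n => remainder p.1 p.2)); last first.
  by move=> p; exact: remainder_sqint.
move: lag_weight lag_weight_ge0 remainder_pair_le => W w0 pl.
set M := \sum_(0 <= m < n) _.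
have rM (a : 'I_n) : \sum_(b < n) W (lag a b) <= 2 * M.
  exact: lag_row_sum_le.
have cM (a : R) : \sum_(i < n) a = n%:R * a by rewrite sumr_const card_ord mulr_natl.
(* With the first pair fixed, five of the six weights vary and each sums to at most 2 n M, whence 10
   n M; the weight of the fixed pair is repeated n^2 times. *)
apply: (@le_trans _ _ (\sum_(p : 'I_n * 'I_n) (n%:R ^+ 2 * W (lag p.1 p.2) + n%:R * (10 * M)))).
  apply: ler_sum => -[i j] _ /=.
  apply: (@le_trans _ _ (\sum_(k' < n) \sum_(l < n) (W (lag i k') + W (lag i l) +
    W (lag j k') + W (lag j l) + W (lag i j) + W (lag k' l)))).
    rewrite [leRHS]pair_big/=; apply: ler_sum => -[k' l] _ /=; exact: pl.
  under eq_bigr do rewrite !big_split/= !cM.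
  rewrite !big_split/= !cM -!mulr_sumr.
  have n0 : 0 <= n%:R :> R by [].
  have X1 := ler_wpM2l n0 (rM i); have X2 := ler_wpM2l n0 (rM j).
  have X3 : \sum_(k' < n) \sum_(l < n) W (lag k' l) <= n%:R * (2 * M).
    by rewrite -cM; apply: ler_sum => k' _; exact: rM.
  by lra.
rewrite -[leLHS](pair_big xpredT xpredT (fun i j : 'I_n => n%:R ^+ 2 * W (lag i j) + n%:R * (10 * M)))/=.
under eq_bigr do rewrite big_split/= cM -mulr_sumr.
rewrite big_split/= cM -mulr_sumr.
have X3 : \sum_(k' < n) \sum_(l < n) W (lag k' l) <= n%:R * (2 * M).
  by rewrite -cM; apply: ler_sum => k' _; exact: rM.
have n0 : 0 <= n%:R ^+ 2 :> R by exact: sqr_ge0.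
have := ler_wpM2l n0 X3.
by lra.
Qed.

End remainder_pair.
End gaussian_process_moments.

(** A lag k >= 1 occurs at 2 (n - k) of the n^2 positions. *)
Lemma sum_lag {R : comRingType} (f : nat -> R) n :
  \sum_(i < n) \sum_(j < n) f (lag i j) =
  n%:R * f 0%N + 2 * \sum_(1 <= k < n) (n%:R - k%:R) * f k.
Proof.
elim: n => [|n IH]; first by rewrite !big_ord0 big_geq// mul0r mulr0 addr0.
rewrite big_ord_recr/=.
under eq_bigr do rewrite big_ord_recr/=.
rewrite big_split/= IH big_ord_recr/=.
have E1 : \sum_(i < n) f (lag i n) = \sum_(1 <= k < n.+1) f k.
  rewrite -(big_mkord xpredT (fun i => f (lag i n))) big_nat_rev/= add0n.
  rewrite [RHS]big_add1/=; apply: eq_big_nat => b /andP[_ bn]; congr f.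
  rewrite /lag subKn//.
  have /eqP -> : (n - b.+1 - n == 0)%N by rewrite subn_eq0 leq_subr.
  by rewrite add0n.
have E2 : \sum_(i < n) f (lag n i) = \sum_(1 <= k < n.+1) f k.
  by rewrite -E1; apply: eq_bigr => i _; rewrite /lag addnC.
have E3 : \sum_(1 <= k < n.+1) (n.+1%:R - k%:R) * f k =
    \sum_(1 <= k < n) (n%:R - k%:R) * f k + \sum_(1 <= k < n.+1) f k.
  have -> : \sum_(1 <= k < n) (n%:R - k%:R) * f k = \sum_(1 <= k < n.+1) (n%:R - k%:R) * f k.
    case: n {IH E1 E2} => [|n]; first by rewrite !big_geq.
    by rewrite [RHS]big_nat_recr//= subrr mul0r addr0.
  rewrite -big_split/=; apply: eq_bigr => b _; rewrite -natr1; ring.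
rewrite E1 E2 E3 {1}/lag subnn -natr1; ring.
Qed.

Section wilcoxon_decomposition.
Context {R : realType} {d} {T : measurableType d} (P : probability T R).
Variables (X : {RV P >-> R}^nat).

(** The rank counts the [i] with |X_i| <= |X_j|, so the statistic is a double sum; adding the same
    sum with indices exchanged gives the symmetric kernel. The identity is pointwise and holds with
    ties. *)
Lemma wilcoxon_rank_kernel n w :
  2 * wilcoxon X n w = \sum_(i < n) \sum_(j < n) rank_kernel (X i w) (X j w).
Proof.
have E : wilcoxon X n w =
    \sum_(i < n) \sum_(j < n) (`|X i w| <= `|X j w|)%R%:R * (0 < X j w)%R%:R.
  rewrite exchange_big/=; apply: eq_bigr => j _.
  rewrite -mulr_suml; congr (_ * _).
    rewrite /abs_rank -sum1_card natr_sum big_mkcond/=.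
    by apply: eq_bigr => i _; rewrite inE; case: ifPn.
  rewrite indicE; case: ltP => h; first by rewrite mem_set.
  by rewrite memNset//=; apply/negP; rewrite -leNgt.
under [RHS]eq_bigr do rewrite big_split/=.
by rewrite big_split/= -E [X in _ = _ + X]exchange_big/= -E mulr_natl mulr2n.
Qed.

Variables (D : R) (L : R -> R).

(** The centering of the statistic amounts to n (n + 1) / 2 for the kernel sum, while 1 / 2 for each
    of the n^2 pairs gives n^2 / 2. The excess n / 2 is due to the diagonal, where the kernel has
    mean close to 1 rather than 1 / 2. *)
Lemma normalized_wilcoxonE n w : (1 < n)%N ->
  let a := n%:R `^ (D / 2) * L n%:R `^ (- (1 / 2)) in
  normalized_wilcoxon X D L n w - a * (Num.sqrt pi)^-1 / (n%:R - 1) * \sum_(i < n) X i w =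
  a / (n%:R * (n%:R - 1)) * (\sum_(i < n) \sum_(j < n) remainder X i j w - n%:R / 2).
Proof.
move=> n1 a; rewrite /normalized_wilcoxon -/a.
have n1R : 1 < n%:R :> R by rewrite ltr1n.
have q0 : 0 < Num.sqrt (pi : R) by rewrite sqrtr_gt0 pi_gt0.
have E : \sum_(i < n) \sum_(j < n) remainder X i j w = 2 * wilcoxon X n w - n%:R ^+ 2 / 2 -
    n%:R * (Num.sqrt pi)^-1 * \sum_(i < n) X i w.
  rewrite wilcoxon_rank_kernel /remainder hoeffding_slopeE.
  have E1 (i : 'I_n) : \sum_(j < n) (rank_kernel (X i w) (X j w) - 1 / 2 -
      (2 * Num.sqrt pi)^-1 * (X i w + X j w)) = \sum_(j < n) rank_kernel (X i w) (X j w) -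
      n%:R / 2 - (2 * Num.sqrt pi)^-1 * (n%:R * X i w + \sum_(j < n) X j w).
    rewrite !sumrB/=; congr (_ - _ - _).
      by rewrite sumr_const card_ord -mulr_natl; field.
    by rewrite -mulr_sumr big_split/= sumr_const card_ord (mulr_natl (X i w)).
  under eq_bigr do rewrite E1.
  have E2 : \sum_(i < n) (n%:R * X i w + \sum_(j < n) X j w) = 2 * (n%:R * \sum_(j < n) X j w).
    by rewrite big_split/= -mulr_sumr sumr_const card_ord -mulr_natl; ring.
  rewrite !sumrB/= -[X in _ - X = _]mulr_sumr E2 sumr_const card_ord -mulr_natl.
  by field; rewrite gt_eqF.
rewrite E; field.
by rewrite !gt_eqF//=; lra.
Qed.

End wilcoxon_decomposition.

Section limit_theorem.
Context {R : realType} {d} {T : measurableType d} (P : probability T R).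
Variables (X : {RV P >-> R}^nat) (rho : nat -> R) (D : R) (L : R -> R).
Hypothesis X_gaussian : gaussian_process X.
Hypothesis X_stationary : stationary X.
Hypothesis X_centered : forall i, ('E_P[X i] = 0)%E.
Hypothesis X_cov : forall k, ('E_P[X 0%N \* X k] = (rho k)%:E)%E.
Hypotheses (D_gt0 : 0 < D) (D_lt1 : D < 1).
Hypothesis L_slow : slowly_varying L.
Hypothesis L_gt0 : \forall k \near \oo, 0 < L k%:R.
Hypothesis rho0 : rho 0%N = 1.
Hypothesis rho_decay : forall k : nat, (0 < k)%N -> rho k = k%:R `^ (- D) * L k%:R.

Let a (n : nat) : R := n%:R `^ (D / 2) * L n%:R `^ (- (1 / 2)).
Let S (n : nat) (w : T) : R := \sum_(i < n) X i w.
Let b (n : nat) : R := a n * (Num.sqrt pi)^-1 / (n%:R - 1).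

Lemma sum_process_sqint n : sqint P (S n).
Proof. by apply: sqint_sum => i; exact: process_sqint. Qed.

Lemma sum_process_variance n :
  \int[P]_w S n w ^+ 2 = n%:R + 2 * \sum_(1 <= k < n) (n%:R - k%:R) * rho k.
Proof.
rewrite (@Rintegral_sqr_sum _ _ _ _ _ _ (fun i : 'I_n => X i)); last first.
  by move=> i; exact: process_sqint.
under eq_bigr do under eq_bigr do rewrite (process_cov X_stationary X_cov).
by rewrite sum_lag rho0 mulr1.
Qed.

Let a_sqr : \forall n \near \oo, a n ^+ 2 = (rho n)^-1 /\ 0 < a n.
Proof.
apply: filterS2 L_gt0 (nbhs_infty_ge 1%N) => n Ln n1.
have n0 : 0 < n%:R :> R by rewrite ltr0n.
split; last by apply: mulr_gt0; exact: powR_gt0.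
rewrite rho_decay//= /a exprMn -!powR_mulrn ?powR_ge0// -!powRrM divfK//.
by rewrite mulNr divfK// invfM -powRN opprK powR_inv1// ltW.
Qed.

Lemma remainder_part_sqint n : (1 < n)%N ->
  sqint P (fun w => normalized_wilcoxon X D L n w - b n * S n w).
Proof.
move=> n1; have -> : (fun w => normalized_wilcoxon X D L n w - b n * S n w) =
    fun w => a n / (n%:R * (n%:R - 1)) *
      (\sum_(i < n) \sum_(j < n) remainder X i j w - n%:R / 2).
  by apply/funext => w; rewrite normalized_wilcoxonE.
apply: sqintZ; apply: sqintB.
  by apply: sqint_sum => i; apply: sqint_sum => j; exact: remainder_sqint.
exact: (@sqint_bounded _ _ _ _ _ `|n%:R / 2|).
Qed.

(** The squared prefactor is at most 4 / (n^4 rho(n)). Against it, the e-part of the weights leaves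
    a multiple of [e], and the small lags and the diagonal leave a constant over n rho(n). *)
Lemma remainder_negligible :
  \int[P]_w (normalized_wilcoxon X D L n w - b n * S n w) ^+ 2 @[n --> \oo] --> (0 : R).
Proof.
have r0 := covariance_cvg0 D_gt0 L_slow L_gt0 rho_decay.
have r1 := covariance_inv_cvg0 D_lt1 L_slow L_gt0 rho_decay.
have [C C0 HC] := covariance_abs_sum_le D_gt0 D_lt1 L_slow L_gt0 rho_decay.
have rp := covariance_gt0 L_slow L_gt0 rho_decay.
apply/cvgr0Pnorm_le => eta eta0.
(* Chosen so that the e-part 192 e C of the final bound is at most eta / 2. *)
pose e := Num.min (1 / 2) (eta / (384 * C)).
have e0 : 0 < e by rewrite lt_min; apply/andP; split; [lra|apply: divr_gt0 => //; lra].
have e2 : e <= 1 / 2 by rewrite ge_min lexx.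
have eC : 192 * e * C <= eta / 2.
  have h : e <= eta / (384 * C) by rewrite ge_min lexx orbT.
  have : e * (384 * C) <= eta by rewrite -ler_pdivlMr//; lra.
  by lra.
have [K _ rK] : \forall m \near \oo, `|rho m| <= e by move/cvgr0Pnorm_le : r0; apply.
have rK' m : (K <= m)%N -> `|rho m| <= e by move=> /rK.
(* 672 is 4 * 24 * 7: the prefactor, twice the constant 12 of [remainder_sum_le], and the crude
   weight. The 2 bounds the contribution 2 / n of the diagonal. *)
pose c : R := 672 * K%:R + 2.
have c0 : 0 < c by rewrite /c; have : 0 <= K%:R :> R by []; lra.
have rc : \forall n \near \oo, `|(n%:R * rho n)^-1| <= eta / (2 * c).
  by move/cvgr0Pnorm_le : r1; apply; apply: divr_gt0 => //; lra.
near=> n.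
have nC : \sum_(0 <= k < n) `|rho k| <= C * (n%:R * rho n) by near: n; exact: HC.
have rn : 0 < rho n by near: n; exact: rp.
have [an a0] : a n ^+ 2 = (rho n)^-1 /\ 0 < a n by near: n; exact: a_sqr.
have nc : `|(n%:R * rho n)^-1| <= eta / (2 * c) by near: n; exact: rc.
have n2 : (2 <= n)%N by near: n; exact: nbhs_infty_ge.
have n2R : 2 <= n%:R :> R by rewrite (ler_nat R 2 n).
have n0 : 0 < n%:R :> R by lra.
rewrite ger0_norm; last by apply: Rintegral_ge0 => w _; exact: sqr_ge0.
set N : R := n%:R in n2R n0 nC nc *.
pose A : R := a n / (N * (N - 1)).
pose Q w := \sum_(i < n) \sum_(j < n) remainder X i j w.
have sQ : sqint P Q.
  by apply: sqint_sum => i; apply: sqint_sum => j; exact: remainder_sqint.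
have sN : sqint P (fun _ => - (N / 2)) by apply: (@sqint_bounded _ _ _ _ _ `|N / 2|) => // w; rewrite normrN.
have -> : \int[P]_w (normalized_wilcoxon X D L n w - b n * S n w) ^+ 2 =
    A ^+ 2 * \int[P]_w (Q w + - (N / 2)) ^+ 2.
  rewrite -RintegralZl//; last by case: (sqintD sQ sN).
  by apply: eq_Rintegral => w _; rewrite -exprMn normalized_wilcoxonE.
have I1 := Rintegral_sqrD_le sQ sN.
rewrite Rintegral_prob_cst sqrrN in I1.
have I2 := remainder_sum_le X_gaussian X_stationary X_centered X_cov rho0 e0 e2 rK' n.
have I3 : \sum_(0 <= m < n) lag_weight rho e K m <= 2 * e * (C * (N * rho n)) + 7 * K%:R.
  rewrite big_split/= -!mulr_sumr; apply: lerD.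
    by apply: ler_wpM2l => //; apply: mulr_ge0 => //; exact: ltW.
  apply: ler_wpM2l => //.
  rewrite -natr_sum ler_nat; apply: leq_trans (geq_minr n K).
  elim: {+}n => [|m IH]; first by rewrite big_geq.
  rewrite big_nat_recr//=; case: (ltnP m K) => mK; last by rewrite addn0 (leq_trans IH)// leq_min geq_minr andbT (leq_trans (geq_minl _ _)).
  by rewrite (minn_idPl mK) addn1 ltnS (leq_trans IH)// geq_minl.
rewrite ger0_norm in nc; last by rewrite invr_ge0; apply: mulr_ge0; exact: ltW.
(* For n >= 2 one has n - 1 >= n / 2. *)
have A2 : A ^+ 2 <= 4 / (N ^+ 4 * rho n).
  rewrite /A expr_div_n an; have -> : 4 / (N ^+ 4 * rho n) = (rho n)^-1 / (N ^+ 2 / 2) ^+ 2.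
    by field; rewrite !gt_eqF.
  rewrite ler_wpM2l ?invr_ge0 ?(ltW rn)// lef_pV2 ?posrE ?exprn_gt0//; last 2 first.
  - by apply: mulr_gt0 => //; lra.
  - by apply: divr_gt0 => //; exact: exprn_gt0.
  by rewrite ler_pXn2r// ?nnegrE; nra.
have I4 : \int[P]_w (Q w + - (N / 2)) ^+ 2 <=
    24 * N ^+ 3 * (2 * e * (C * (N * rho n)) + 7 * K%:R) + 2 * (N / 2) ^+ 2.
  apply: (le_trans I1); rewrite lerD2r.
  have N3 : 0 <= 24 * N ^+ 3 by apply: mulr_ge0 => //; apply: exprn_ge0; exact: ltW.
  by have := ler_wpM2l N3 I3; move: I2; rewrite -/Q -/N; lra.
have Q0 : 0 <= \int[P]_w (Q w + - (N / 2)) ^+ 2 by apply: Rintegral_ge0 => w _; exact: sqr_ge0.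
apply: le_trans (ler_pM (sqr_ge0 A) Q0 A2 I4) _.
have -> : 4 / (N ^+ 4 * rho n) * (24 * N ^+ 3 * (2 * e * (C * (N * rho n)) + 7 * K%:R) + 2 * (N / 2) ^+ 2) =
  192 * e * C + (672 * K%:R + 2 / N) * (N * rho n)^-1.
  by field; rewrite !gt_eqF.
have : (672 * K%:R + 2 / N) * (N * rho n)^-1 <= c * (N * rho n)^-1.
  rewrite ler_wpM2r//; first by rewrite invr_ge0; apply: mulr_ge0; exact: ltW.
  by rewrite lerD2l ler_pdivrMr//; lra.
have : c * (N * rho n)^-1 <= c * (eta / (2 * c)) by rewrite ler_pM2l.
have -> : c * (eta / (2 * c)) = eta / 2 by field; rewrite gt_eqF.
by lra.
Unshelve. all: by end_near.
Qed.

Lemma sum_process_gaussian c n : gaussian_rv P (fun w => c * S n w).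
Proof. by have := X_gaussian (fun _ : 'I_n => c); under eq_fun do rewrite -mulr_sumr. Qed.

(** After dividing by n^2 rho(n), the variance of the sum is 1 / (n rho(n)), from the diagonal, plus
    twice the convolution of [covariance_conv_cvg]. *)
Lemma linear_part_variance_cvg :
  b n ^+ 2 * \int[P]_w S n w ^+ 2 @[n --> \oo] --> 2 / (pi * ((1 - D) * (2 - D))).
Proof.
have p0 := @pi_gt0 R.
have r1 := covariance_inv_cvg0 D_lt1 L_slow L_gt0 rho_decay.
have cc := covariance_conv_cvg D_gt0 D_lt1 L_slow L_gt0 rho_decay.
have rp := covariance_gt0 L_slow L_gt0 rho_decay.
have i0 : (n%:R : R)^-1 @[n --> \oo] --> (0 : R).
  apply/gtr0_cvgV0; last exact: cvgr_idn.
  by apply: filterS (nbhs_infty_ge 1%N) => n n1; rewrite ltr0n.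
have i1 : (1 - (n%:R : R)^-1)^-1 @[n --> \oo] --> ((1 - 0)^-1 : R).
  by apply: cvgV; [rewrite subr0 oner_eq0|apply: cvgB => //; exact: cvg_cst].
have lim := cvgM (cvgM (@cvg_cst _ (pi : R)^-1 _ (\oo) _) (cvgM i1 i1)) (cvgD r1 (cvgM (@cvg_cst _ (2 : R) _ (\oo) _) cc)).
have -> : 2 / (pi * ((1 - D) * (2 - D))) =
    pi^-1 * ((1 - 0)^-1 * (1 - 0)^-1) * (0 + 2 * ((1 - D) * (2 - D))^-1) :> R.
  have D1 := D_lt1; have p1 := gt_eqF p0.
  have d1 : 0 < 1 - D by lra.
  have d2 : 0 < 2 - D by lra.
  rewrite subr0 invr1 add0r; move: (pi : R) p0 p1 => p _ p1.
  by field; rewrite p1 (gt_eqF d1) (gt_eqF d2).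
apply: cvg_trans; last exact: lim.
apply: near_eq_cvg; near=> n.
have rn : 0 < rho n by near: n; exact: rp.
have [an _] : a n ^+ 2 = (rho n)^-1 /\ 0 < a n by near: n; exact: a_sqr.
have n2 : (2 <= n)%N by near: n; exact: nbhs_infty_ge.
have n2R : 2 <= n%:R :> R by rewrite (ler_nat R 2 n).
have q0 : 0 < Num.sqrt (pi : R) by rewrite sqrtr_gt0.
have -> : b n ^+ 2 = (rho n)^-1 * pi^-1 / (n%:R - 1) ^+ 2.
  by rewrite /b expr_div_n [in LHS]exprMn an exprVn sqr_sqrtr// ltW.
rewrite sum_process_variance/=.
have n1 : n%:R - 1 != 0 :> R by rewrite gt_eqF//; lra.
have n0 : n%:R != 0 :> R by rewrite gt_eqF//; lra.
move: (pi : R) p0 => p p0.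
set A := \sum_(1 <= k < n) _.
rewrite [X in _ * X](_ : _ = (n%:R * rho n)^-1 + 2 * (A / (n%:R ^+ 2 * rho n)))//.
by field; rewrite (gt_eqF p0) n0 n1 (gt_eqF rn).
Unshelve. all: by end_near.
Qed.

Lemma normalized_wilcoxon_cvg {d'} {T' : measurableType d'} (Q : probability T' R)
    (Z : {RV Q >-> R}) (s : R) : 0 < s -> s ^+ 2 = 2 / (pi * ((1 - D) * (2 - D))) ->
  (forall A, measurable A -> Q (Z @^-1` A) = normal_prob 0 s A) ->
  cvg_in_distribution (fun n => normalized_wilcoxon X D L n : {RV P >-> R}) Z.
Proof.
move=> s0 sE lawZ.
pose V n := \int[P]_w S n w ^+ 2.
have V0 n : 0 <= V n by apply: Rintegral_ge0 => w _; exact: sqr_ge0.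
have bV : b n ^+ 2 * V n @[n --> \oo] --> s ^+ 2 by rewrite sE; exact: linear_part_variance_cvg.
have Vp : \forall n \near \oo, 0 < V n.
  have s20 : 0 < s ^+ 2 by exact: exprn_gt0.
  have /cvgr_gt/(_ _ s20) := bV; apply: filterS => n h.
  by rewrite lt_neqAle V0 andbT; apply/eqP => V00; move: h; rewrite -V00 mulr0 ltxx.
have bp : \forall n \near \oo, 0 <= b n.
  near=> n.
  have [_ a0] : a n ^+ 2 = (rho n)^-1 /\ 0 < a n by near: n; exact: a_sqr.
  have n1 : (1 <= n)%N by near: n; exact: nbhs_infty_ge.
  rewrite /b; apply: divr_ge0; last by rewrite subr_ge0 ler1n.
  by apply: mulr_ge0; [exact: ltW|rewrite invr_ge0 sqrtr_ge0].
(* The partial sum rescaled to variance s^2: being centered Gaussian, it has exactly the law of [Z],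
   and it differs from the linear part by a variance (sqrt (b^2 V) - s)^2. *)
pose G n w := s / Num.sqrt (V n) * S n w.
have sS n : sqint P (S n) by exact: sum_process_sqint.
have sG n : sqint P (fun w => b n * S n w - G n w) by apply: sqintB; exact: sqintZ.
have GE : \forall n \near \oo, \int[P]_w (b n * S n w - G n w) ^+ 2 =
    (Num.sqrt (b n ^+ 2 * V n) - s) ^+ 2.
  apply: filterS2 Vp bp => n Vn bn.
  have q0 : 0 < Num.sqrt (V n) by rewrite sqrtr_gt0.
  transitivity ((b n - s / Num.sqrt (V n)) ^+ 2 * V n).
    rewrite -RintegralZl//; last by case: (sS n).
    by apply: eq_Rintegral => w _; rewrite -exprMn mulrBl.
  rewrite sqrtrM ?sqr_ge0// sqrtr_sqr ger0_norm// -{2}(sqr_sqrtr (V0 n)) -exprMn.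
  by rewrite mulrBl divfK// gt_eqF.
have G0 : \int[P]_w (b n * S n w - G n w) ^+ 2 @[n --> \oo] --> (0 : R).
  have lim : (Num.sqrt (b n ^+ 2 * V n) - s) ^+ 2 @[n --> \oo] --> (0 : R).
    have c1 : Num.sqrt (b n ^+ 2 * V n) @[n --> \oo] --> s.
      rewrite -[X in _ --> X](ger0_norm (ltW s0)) -sqrtr_sqr.
      by apply: (cvg_comp _ _ bV); exact: sqrt_continuous.
    have c2 : Num.sqrt (b n ^+ 2 * V n) - s @[n --> \oo] --> s - s by apply: cvgB => //; exact: cvg_cst.
    have c3 := cvgM c2 c2; rewrite subrr mulr0 in c3.
    apply: cvg_trans; last exact: c3.
    by apply: near_eq_cvg; apply: nearW => n; rewrite expr2.
  by apply: cvg_trans; last exact: lim; apply: near_eq_cvg; apply: filterS GE => n ->.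
apply: (@cvg_in_distribution_sqint _ _ _ P _ _ Q _ _ G).
- apply: filterS2 Vp (nbhs_infty_ge 2%N) => n Vn n2; split.
  + by case: (sqintZ (s / Num.sqrt (V n)) (sS n)).
  + have := sqintD (remainder_part_sqint n2) (sG n).
    by rewrite (_ : (fun w => _) = fun w => normalized_wilcoxon X D L n w - G n w)//;
      apply/funext => w; rewrite addrA subrK.
  + move=> A mA; rewrite lawZ//.
    have mG := (sqintZ (s / Num.sqrt (V n)) (sS n)).1.
    have gG := sum_process_gaussian (s / Num.sqrt (V n)) n.
    have m0 : \int[P]_w (s / Num.sqrt (V n) * S n w) = 0.
      rewrite RintegralZl//; last exact: sqint_intgb.
      rewrite Rintegral_sum; last by move=> i; apply: sqint_intgb; exact: process_sqint.
      by rewrite big1 ?mulr0// => i _; exact: process_mean.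
    have [t [t0 law var _ _]] := gaussian_rv_centered mG gG m0.
    have tE : t = s.
      apply/eqP; rewrite -(@eqrXn2 _ 2) ?(ltW s0)//; apply/eqP; rewrite -var.
      under eq_Rintegral do rewrite exprMn.
      rewrite RintegralZl//; last by case: (sS n).
      by rewrite -/(V n) expr_div_n sqr_sqrtr// divfK// gt_eqF.
    by rewrite -tE law// tE gt_eqF.
- have lim : 2 * \int[P]_w (normalized_wilcoxon X D L n w - b n * S n w) ^+ 2 +
      2 * \int[P]_w (b n * S n w - G n w) ^+ 2 @[n --> \oo] --> (0 : R).
    rewrite -[X in _ --> X](addr0 0) -{1}(mulr0 2) -{2}(mulr0 2).
    by apply: cvgD; apply: cvgM; first [exact: cvg_cst|exact: remainder_negligible|exact: G0].
  apply: squeeze_cvgr (cvg_cst 0) lim.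
  apply: filterS (nbhs_infty_ge 2%N) => n n2; apply/andP; split.
    by apply: Rintegral_ge0 => w _; exact: sqr_ge0.
  have := Rintegral_sqrD_le (remainder_part_sqint n2) (sG n).
  by under eq_Rintegral do rewrite addrA subrK.
Unshelve. all: by end_near.
Qed.

End limit_theorem.

Theorem proposition6 (R : realType)
  (d : measure_display) (T : measurableType d) (P : probability T R)
  (X : nat -> {RV P >-> R}) (rho : nat -> R) (D : R) (L : R -> R)
  (X_gaussian : gaussian_process X)
  (X_stationary : stationary X)
  (X_centered : forall i : nat, ('E_P[X i] = 0)%E)
  (X_cov : forall k : nat, ('E_P[X 0%N \* X k] = (rho k)%:E)%E)
  (D_gt0 : 0 < D) (D_lt1 : D < 1)
  (L_slow : slowly_varying L)
  (L_gt0 : \forall k \near \oo, 0 < L k%:R)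
  (rho0 : rho 0%N = 1)
  (rho_decay : forall k : nat, (0 < k)%N ->
     rho k = k%:R `^ (- D) * L k%:R)
  (d' : measure_display) (T' : measurableType d') (Q : probability T' R)
  (B : R -> {RV Q >-> R}) (B_brownian : brownian_motion B)
  (Z1 : {RV Q >-> R}) (Z1_def : wiener_integral B (Z1D_kernel D 1) Z1) :
  let c : R := kD D `^ (- (1 / 2)) / Num.sqrt pi in
  cvg_in_distribution (fun n => normalized_wilcoxon X D L n : {RV P >-> R})
                      (c \o* Z1 : {RV Q >-> R})
  /\ nondegenerate_gaussian_rv Q (c \o* Z1).
Proof.
move=> c.
have [sK IK] := Z1D_kernel_norm D_gt0 D_lt1.
have [_ k0] := beta_integral D_gt0 D_lt1.
have p0 := @pi_gt0 R.
have d0 : 0 < (1 - D) * (2 - D) by apply: mulr_gt0; lra.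
have c0 : 0 < c by apply: divr_gt0; [exact: powR_gt0|rewrite sqrtr_gt0].
have I0 : 0 < \int[lebesgue_measure]_x Z1D_kernel D 1 x ^+ 2.
  by rewrite IK; apply: mulr_gt0 => //; exact: divr_gt0.
have law := wiener_integral_law B_brownian sK Z1_def c0 I0.
set s := c * Num.sqrt _ in law.
have s0 : 0 < s by apply: mulr_gt0 => //; rewrite sqrtr_gt0.
have c2 : c ^+ 2 = (kD D)^-1 / pi.
  rewrite /c expr_div_n sqr_sqrtr ?(ltW p0)// -powR_mulrn ?powR_ge0// -powRrM.
  by rewrite mulNr divfK// powR_inv1// ltW.
(* The factor k(D) in the square norm of the kernel cancels against the constant k(D)^(-1/2) of the
   limit. *)
have sE : s ^+ 2 = 2 / (pi * ((1 - D) * (2 - D))).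
  rewrite /s exprMn c2 sqr_sqrtr ?(ltW I0)// IK.
  move: (pi : R) p0 (kD D) k0 ((1 - D) * (2 - D)) d0 => p p0 k k0 q q0.
  by field; rewrite !gt_eqF.
split; last by exists 0, s.
exact: (@normalized_wilcoxon_cvg _ _ _ _ _ _ _ _ X_gaussian X_stationary X_centered X_cov
  D_gt0 D_lt1 L_slow L_gt0 rho0 rho_decay _ _ Q (c \o* Z1 : {RV Q >-> R}) s s0 sE law).
Qed.
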